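(* Let $\mathbb{H}^n(-1)$ be the $n$-dimensional hyperbolic space in the upper half space model $\left(\mathbb{R}^n_+,\frac{dx_1^2+dx_2^2+\cdots+dx_n^2}{x_n^2}\right)$, where $\mathbb{R}^n_+=\{x\in\mathbb{R}^n: x_n>0\}$, and let $\Omega$ be a bounded connected domain in $\mathbb{H}^n(-1)$. Then the first two eigenvalues $\lambda_1,\lambda_2$ of the Dirichlet problem $\Delta u=-\lambda u$ in $\Omega$, $u|_{\partial\Omega}=0$, satisfy $$\lambda_2-\lambda_1\le\frac4n\left(\lambda_1-\frac{n^2-2n-4}{4}\right).$$
   Context: $\Delta$ is the Laplacian (Laplace--Beltrami operator, the divergence of the gradient) of the hyperbolic metric. The Dirichlet eigenvalues are listed as $0<\lambda_1<\lambda_2\le\lambda_3\le\cdots$, repeated according to multiplicity; the Dirichlet condition is understood in the usual sense ($u\in H^1_0(\Omega)$). *)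

(* Defs.v *)
From HB Require Import structures.
From mathcomp Require Import all_boot all_order all_algebra.
From mathcomp Require Import all_classical all_reals all_analysis.

Set Implicit Arguments.
Unset Strict Implicit.
Unset Printing Implicit Defensive.

Import Order.TTheory GRing.Theory Num.Theory.
Import numFieldNormedType.Exports.

Local Open Scope classical_set_scope.
Local Open Scope ring_scope.

(* Product sigma-algebra on 'rV[R]_n, generated by the coordinates (for the
   reals it is the Borel sigma-algebra). *)
Definition rV_display : measure_display.
Proof. exact: default_measure_display. Qed.

Section measurable_rV.
Context (R : realType) (n : nat).

Definition rV_coord (i : 'I_n) (x : 'rV[R]_n) : R := x ord0 i.

Let rV_set0 : g_sigma_preimage rV_coord set0.
Proof. exact: sigma_algebra0. Qed.

Let rV_setC A : g_sigma_preimage rV_coord A -> g_sigma_preimage rV_coord (~` A).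
Proof. exact: sigma_algebraC. Qed.

Let rV_bigcup (F : (set 'rV[R]_n)^nat) :
  (forall i, g_sigma_preimage rV_coord (F i)) ->
  g_sigma_preimage rV_coord (\bigcup_i F i).
Proof. exact: sigma_algebra_bigcup. Qed.

HB.instance Definition _ := @isMeasurable.Build rV_display 'rV[R]_n
  (g_sigma_preimage rV_coord) rV_set0 rV_setC rV_bigcup.

End measurable_rV.

(* Lebesgue measure on R^n, by recursion on n: the image of the product of
   lebesgue_measure with Lebesgue measure on R^n under (t, y) |-> (t, y_0, ...,
   y_(n-1)), starting from the unit mass on R^0. *)
Section rV_lebesgue.
Context (R : realType).

Definition rV_cons (n : nat) (p : measurableTypeR R * 'rV[R]_n) : 'rV[R]_n.+1 :=
  \row_(i < n.+1) oapp (fun j => p.2 ord0 j) (p.1 : R) (unlift ord0 i).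

Lemma measurable_rV_coord (n : nat) (i : 'I_n) :
  measurable_fun [set: 'rV[R]_n] (rV_coord i).
Proof.
move=> _ Y mY; rewrite setTI; apply: sub_sigma_algebra => /=.
rewrite -bigcup_seq/=; exists i => /=; first by rewrite mem_index_enum.
by exists Y => //; rewrite setTI.
Qed.

Lemma measurable_fun_rV d (T : measurableType d) (n : nat) (f : T -> 'rV[R]_n) :
  (forall i, measurable_fun [set: T] (fun t => f t ord0 i)) ->
  measurable_fun [set: T] f.
Proof.
move=> mf _ A mA; rewrite setTI.
suff sub : (g_sigma_preimage (@rV_coord R n)) `<=` [set B | measurable (f @^-1` B)].
  exact: sub.
apply: smallest_sub.
  split => /=.
  - by rewrite preimage_set0.
  - by move=> B mB; rewrite setTD preimage_setC; exact: measurableC.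
  - by move=> F mF; rewrite preimage_bigcup; exact: bigcupT_measurable.
move=> B; rewrite -bigcup_seq => -[i _ [Y mY <-]] /=.
by have := mf i measurableT Y mY; rewrite !setTI.
Qed.

Lemma measurable_rV_cons (n : nat) : measurable_fun setT (@rV_cons n).
Proof.
apply: measurable_fun_rV => i; rewrite /rV_cons.
case: (unliftP ord0 i) => [j ->|->].
  rewrite (_ : (fun _ => _) = rV_coord j \o snd).
    by apply: measurableT_comp; [exact: measurable_rV_coord|].
  by apply/funext => p; rewrite !mxE liftK.
rewrite (_ : (fun _ => _) = fst); first exact: measurable_fst.
by apply/funext => p; rewrite !mxE unlift_none.
Qed.

Section step.
Context (n : nat) (m : {sigma_finite_measure set 'rV[R]_n -> \bar R}).

Definition rV_lebesgue_step : set 'rV[R]_n.+1 -> \bar R :=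
  pushforward (lebesgue_measure \x m)%E (@rV_cons n).

Let mcons : measurable_fun setT (@rV_cons n) := @measurable_rV_cons n.

Let step0 : rV_lebesgue_step set0 = 0%E.
Proof. by rewrite /rV_lebesgue_step /pushforward preimage_set0 measure0. Qed.

Let step_ge0 A : (0 <= rV_lebesgue_step A)%E.
Proof. exact: (@measure_ge0 _ _ _ (lebesgue_measure \x m)%E). Qed.

Let step_sigma_additive : semi_sigma_additive rV_lebesgue_step.
Proof.
move=> F mF tF mUF; rewrite /rV_lebesgue_step /pushforward preimage_bigcup.
apply: (@measure_semi_sigma_additive _ _ _ (lebesgue_measure \x m)%E).
- by move=> k; rewrite -[X in measurable X]setTI; exact: mcons.
- apply/trivIsetP => /= i j _ _ ij; rewrite -preimage_setI.
  by move/trivIsetP : tF => /(_ _ _ _ _ ij) ->//; rewrite preimage_set0.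
- by rewrite -preimage_bigcup -[X in measurable X]setTI; exact: mcons.
Qed.

HB.instance Definition _ := isMeasure.Build _ _ _ rV_lebesgue_step
  step0 step_ge0 step_sigma_additive.

Let uncons (x : 'rV[R]_n.+1) : measurableTypeR R * 'rV[R]_n :=
  (x ord0 ord0, \row_j x ord0 (lift ord0 j)).

Let measurable_uncons : measurable_fun setT uncons.
Proof.
apply/measurable_fun_pairP; split; first exact: (@measurable_rV_coord n.+1 ord0).
apply: measurable_fun_rV => i.
rewrite (_ : (fun _ => _) = @rV_coord R n.+1 (lift ord0 i)).
  exact: measurable_rV_coord.
by apply/funext => x /=; rewrite mxE.
Qed.

Let consK : cancel (@rV_cons n) uncons.
Proof.
move=> [t y]; rewrite /uncons /rV_cons; congr pair.
  by rewrite mxE unlift_none.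
by apply/rowP => j; rewrite !mxE liftK.
Qed.

Let step_sigma_finite : sigma_finite setT rV_lebesgue_step.
Proof.
have /sigma_finiteP[F [FT ndF Foo]] := sigma_finiteT (@lebesgue_measure R).
have /sigma_finiteP[G [GT ndG Goo]] := sigma_finiteT m.
exists (fun k => uncons @^-1` (F k `*` G k)).
  apply/esym/seteqP; split=> // x _.
  have : setT (uncons x).1 by [].
  have : setT (uncons x).2 by [].
  rewrite {1}GT FT => -[k _ Gk] [l _ Fl]; exists (maxn l k) => //; split.
  - by move: Fl; exact/subsetPset/ndF/leq_maxl.
  - by move: Gk; exact/subsetPset/ndG/leq_maxr.
move=> k; have [mF Fk] := Foo k; have [mG Gk] := Goo k; split.
  rewrite -[X in measurable X]setTI; apply: measurable_uncons => //.
  exact: measurableX.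
rewrite /rV_lebesgue_step /pushforward -comp_preimage.
rewrite (_ : _ \o _ = id); last by apply/funext => p /=; rewrite consK.
by rewrite preimage_id product_measure1E// lte_mul_pinfty// ge0_fin_numE.
Qed.

HB.instance Definition _ := Measure_isSigmaFinite.Build _ _ _ rV_lebesgue_step
  step_sigma_finite.

End step.

Fixpoint rV_lebesgue (n : nat) : {sigma_finite_measure set 'rV[R]_n -> \bar R} :=
  match n with
  | 0 => \d_(0 : 'rV[R]_0)
  | k.+1 => rV_lebesgue_step (rV_lebesgue k)
  end.

End rV_lebesgue.

Section smooth_functions.
Context (R : realType) (n : nat).
Implicit Types f : 'rV[R]_n -> R.

Definition partial (i : 'I_n) f : 'rV[R]_n -> R :=
  fun x => 'D_(delta_mx ord0 i) f x.

Fixpoint Ck (k : nat) f : Prop :=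
  match k with
  | 0 => continuous f
  | j.+1 => [/\ continuous f,
      forall i x, derivable f x (delta_mx ord0 i : 'rV[R]_n) &
      forall i, Ck j (partial i f)]
  end.

Definition smooth f : Prop := forall k, Ck k f.

Definition supp f : set 'rV[R]_n := closure [set x | f x != 0].

(* C_c^oo(Omega), functions being extended by 0 outside Omega *)
Definition test_function (Omega : set 'rV[R]_n) f : Prop :=
  [/\ smooth f, compact (supp f) & supp f `<=` Omega].

End smooth_functions.

(* The upper half-space model of the hyperbolic space of dimension N = n.+1,
   the distinguished coordinate x_N being the last one. The metric tensor is
   g_ij = x_N^-2 delta_ij, so g^ij = x_N^2 delta_ij and sqrt(det g) = x_N^-N. *)
Section hyperbolic_space.
Context (R : realType) (n : nat).
Implicit Types (x y : 'rV[R]_n.+1) (u f : 'rV[R]_n.+1 -> R)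
  (Omega : set 'rV[R]_n.+1).

Definition height x : R := x ord0 ord_max.

Definition half_space : set 'rV[R]_n.+1 := [set x | 0 < height x].

Definition arcosh (c : R) : R := ln (c + Num.sqrt (c ^+ 2 - 1)).

(* geodesic distance: cosh d(x, y) = 1 + |x - y|^2 / (2 x_N y_N) *)
Definition hyp_dist x y : R :=
  arcosh (1 + (\sum_i (x ord0 i - y ord0 i) ^+ 2) / (2 * height x * height y)).

Definition bounded_domain Omega : Prop :=
  [/\ Omega `<=` half_space, open Omega, connected Omega, Omega !=set0 &
      exists M : R, forall x y, Omega x -> Omega y -> hyp_dist x y <= M].

(* density of the Riemannian volume dV with respect to Lebesgue measure *)
Definition vol_density x : R := height x ^- n.+1.

Definition integralV Omega f : R :=
  \int[@rV_lebesgue R n.+1]_(x in Omega) (f x * vol_density x).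

(* the same integral with values in [0, +oo], for nonnegative f *)
Definition eintegralV Omega f : \bar R :=
  (\int[@rV_lebesgue R n.+1]_(x in Omega) (f x * vol_density x)%:E)%E.

(* (grad f)^i = g^ij d_j f *)
Definition hyp_grad f : 'rV[R]_n.+1 -> 'rV[R]_n.+1 :=
  fun x => \row_i (height x ^+ 2 * partial i f x).

(* div X = (det g)^(-1/2) d_i ((det g)^(1/2) X^i) *)
Definition hyp_div (X : 'rV[R]_n.+1 -> 'rV[R]_n.+1) : 'rV[R]_n.+1 -> R :=
  fun x => (vol_density x)^-1 *
    \sum_i partial i (fun y => vol_density y * X y ord0 i) x.

Definition hyp_laplacian f : 'rV[R]_n.+1 -> R := hyp_div (hyp_grad f).

(* squared g-norm of the covector with components xi_i at the point x *)
Definition conorm2 x (xi : 'rV[R]_n.+1) : R :=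
  height x ^+ 2 * \sum_i xi ord0 i ^+ 2.

Definition differential f : 'rV[R]_n.+1 -> 'rV[R]_n.+1 :=
  fun x => \row_i partial i f x.

Definition L2 Omega u : Prop :=
  measurable_fun Omega u /\ (eintegralV Omega (fun x => (u x ^+ 2)%R) < +oo)%E.

(* H^1_0(Omega): closure of C_c^oo(Omega) for the H^1 norm. The limit W of the
   differentials of the phi_k is the weak differential of u. *)
Definition H10 Omega u : Prop :=
  L2 Omega u /\
  exists (W : 'rV[R]_n.+1 -> 'rV[R]_n.+1) (phi : nat -> 'rV[R]_n.+1 -> R),
    [/\ measurable_fun Omega W,
        forall k, test_function Omega (phi k) &
        (fun k => eintegralV Omega (fun x => (u x - phi k x) ^+ 2
           + conorm2 x (W x - differential (phi k) x))) @ \oo --> 0%E].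

(* u is in H^1_0(Omega) and Delta u = - mu u in the sense of distributions on
   Omega; u = 0 is allowed. *)
Definition dirichlet_eigenspace Omega (mu : R) u : Prop :=
  H10 Omega u /\
  forall phi, test_function Omega phi ->
    integralV Omega (fun x => u x * hyp_laplacian phi x) =
    - mu * integralV Omega (fun x => u x * phi x).

(* linear independence in L^2(Omega), i.e. modulo equality almost everywhere *)
Definition ae_free Omega (m : nat) (u : 'I_m -> 'rV[R]_n.+1 -> R) : Prop :=
  forall c : 'I_m -> R,
    {ae @rV_lebesgue R n.+1, forall x, Omega x -> \sum_i c i * u i x = 0} ->
    forall i, c i = 0.

(* lam 0 <= lam 1 <= ... lists the Dirichlet eigenvalues of Omega, repeated
   according to multiplicity: for each mu and m, the eigenspace of mu has
   dimension at least m iff mu occurs at least m times in the list. *)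
Definition dirichlet_eigenvalues Omega (lam : nat -> R) : Prop :=
  (forall k, lam k <= lam k.+1) /\
  forall (mu : R) (m : nat),
    (exists u : 'I_m -> 'rV[R]_n.+1 -> R,
       (forall i, dirichlet_eigenspace Omega mu (u i)) /\ ae_free Omega u) <->
    (exists k : 'I_m -> nat, injective k /\ forall i, lam (k i) = mu).

End hyperbolic_space.

(* Main.v *)
Require Import Defs.
From mathcomp Require Import all_boot all_order all_algebra.
From mathcomp Require Import all_classical all_reals all_analysis measurable_realfun.
From mathcomp Require Import ring lra.

Set Implicit Arguments.
Unset Strict Implicit.
Unset Printing Implicit Defensive.

Import Order.TTheory GRing.Theory Num.Theory.
Import numFieldNormedType.Exports.
Local Open Scope classical_set_scope.
Local Open Scope ring_scope.

(** The hyperbolic metric is conformal to the Euclidean one, so the problem can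
    be compared with one in Euclidean space.  Write N for the dimension, h for the
    last coordinate x_N, dV = h^-N dx, and substitute
    u = h^(N/2 - 1) w.  The eigenvalue equation Delta u = - lambda u becomes the
    equation of a vibrating Euclidean membrane of density h^-2,
    - Delta_euc w = m h^-2 w with m = lambda - N (N - 2) / 4, and the claim reads
    m_2 - m_1 <= (4 / N) (m_1 + 1).  It follows from the argument of Payne, Polya
    and Weinberger.  Let w be a first eigenfunction and take the N trial functions
    (x_i - a_i) w, with a_i such that they are orthogonal to w for the density.
    With A_i = int (x_i - a_i)^2 w^2 h^-2 dx and B = int w^2 dx:
    - as the gradient of x_i has Euclidean length one, the variational
      characterization of the second eigenvalue gives (m_2 - m_1) A_i <= B;
    - as d_i and x_i have commutator one, int (x_i - a_i) w d_i w dx = - B / 2,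
      hence B^2 / 4 <= A_i int h^2 (d_i w)^2 dx by Cauchy-Schwarz;
    - the equation tested against h^2 w gives
      sum_i int h^2 (d_i w)^2 dx = (m_1 + 1) B.
    Multiplying the first two lines and summing over i gives the claim.  Below
    everything is expressed with u, which avoids half-integral powers of h: the
    orthonormal frame D_i = h d_i replaces d_i, and the three lines rest on
    [localization_identity], [commutator_identity] and
    [sum_conj_deriv_identity].  These are identities between test functions;
    [gap_bound] passes to the limit along test functions converging to u.

    What has to be proved besides is the variational characterization itself:
    the hypothesis only lists the eigenvalues, so a small Rayleigh quotient must be
    shown to produce an eigenfunction.  Let u be a normalized eigenfunction for
    lambda_1, let a be the Dirichlet form and b the scalar product of L^2.  If
    a(f, f) + (L - lambda_1) b(u, f)^2 < L b(f, f) for some f, then the quotient of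
    the left-hand form by b has an infimum nu < L, attained at a limit v of test
    functions ([min_rayleigh]); comparing the equations of u and v shows that v is
    orthogonal to u, so that v is an eigenfunction for nu, in addition to u
    ([rayleigh_or_eigen]).  With L = lambda_2 this contradicts the list
    ([second_eigenvalue_bound]).

    The minimum is attained because of two facts.  A minimizing sequence has a
    subsequence that is Cauchy in L^2, by an inequality of Ehrling's type
    ([ehrling]): up to a small multiple of the Dirichlet integral, the L^2 norm is
    controlled by finitely many integrals over fixed sets.  And Cauchy sequences
    converge ([riesz_fischer]).  Integration by parts and [ehrling] are both
    obtained by slicing, that is by induction on the dimension with Fubini's
    theorem. *)

(** * Forms on spaces of functions and minimization of a Rayleigh quotient *)
Section forms.
Context (R : realType) (T : Type).
Implicit Types (f g u v w : T -> R) (P : (T -> R) -> Prop).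

(** Linear combinations are written as functions, and linear structure is
    only required of a predicate on functions, so that forms can live on classes
    such as test functions without bundling these into a type. *)
Definition lincomb (a : R) u v : T -> R := fun x => a * u x + v x.

Definition increment (v : nat -> T -> R) k : T -> R := lincomb (-1) (v k) (v k.+1).

Definition lin_closed P := forall a u v, P u -> P v -> P (lincomb a u v).

(** No definiteness is asked for: functions vanishing almost everywhere are
    not identified with zero. *)
Record pos_form P (b : (T -> R) -> (T -> R) -> R) : Prop := PosForm {
  formC : forall u v, P u -> P v -> b u v = b v u;
  formL : forall a u v w, P u -> P v -> P w ->
    b (lincomb a u v) w = a * b u w + b v w;
  form_ge0 : forall u, P u -> 0 <= b u u }.

Lemma form_sq P b a u v : lin_closed P -> pos_form P b -> P u -> P v ->
  b (lincomb a u v) (lincomb a u v) = a ^+ 2 * b u u + 2 * a * b u v + b v v.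
Proof.
move=> lP hb Pu Pv; have Pl := lP a _ _ Pu Pv.
rewrite (formL hb)// (formC hb Pu Pl) (formC hb Pv Pl) !(formL hb)//.
by rewrite (formC hb Pv Pu); ring.
Qed.

Lemma form_CS P b u v : lin_closed P -> pos_form P b -> P u -> P v ->
  b u v ^+ 2 <= b u u * b v v.
Proof.
move=> lP hb Pu Pv.
have H t : 0 <= t ^+ 2 * b u u + 2 * t * b u v + b v v.
  by rewrite -(form_sq t lP hb Pu Pv); apply: (form_ge0 hb); exact: lP.
have u0 := form_ge0 hb Pu; have v0 := form_ge0 hb Pv.
have [uu|uu] := eqVneq (b u u) 0.
  have [-> |uv] := eqVneq (b u v) 0; first by rewrite expr0n/= mulr_ge0.
  (* chosen to make the affine function of t negative *)
  have := H (- (b v v + 1) / (2 * b u v)).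
  rewrite uu mulr0 add0r.
  rewrite (_ : 2 * (- (b v v + 1) / (2 * b u v)) * b u v = - (b v v + 1)); last first.
    by field.
  by move=> ?; exfalso; lra.
(* the minimum of the quadratic polynomial in t *)
have := H (- b u v / b u u).
rewrite (_ : (- b u v / b u u) ^+ 2 * b u u + 2 * (- b u v / b u u) * b u v + b v v
   = b v v - b u v ^+ 2 / b u u); last by field.
by rewrite subr_ge0 ler_pdivrMr ?lt0r ?uu// mulrC.
Qed.

Lemma form_sub_le P b u v : lin_closed P -> pos_form P b -> P u -> P v ->
  b (lincomb (-1) u v) (lincomb (-1) u v) <= 2 * b u u + 2 * b v v.
Proof.
move=> lP hb Pu Pv.
have : 0 <= b (lincomb 1 u v) (lincomb 1 u v) by apply: (form_ge0 hb); exact: lP.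
by rewrite !(form_sq _ lP hb Pu Pv) => ?; lra.
Qed.

(** Used with nu the infimum of the Rayleigh quotient: the shifted form
    then satisfies the Cauchy-Schwarz inequality, which is how a minimizing
    sequence is seen to satisfy the Euler-Lagrange equation asymptotically. *)
Lemma form_shift P q b nu : pos_form P q -> pos_form P b ->
  (forall u, P u -> nu * b u u <= q u u) ->
  pos_form P (fun u v => q u v - nu * b u v).
Proof.
move=> hq hb h; split=> [u v Pu Pv|a u v w Pu Pv Pw|u Pu].
- by rewrite (formC hq)// (formC hb).
- by rewrite (formL hq)// (formL hb)//; ring.
- by rewrite subr_ge0 h.
Qed.

(** Adding tau l^2 to a form penalizes the direction of l: it moves the
    eigenvalue of that direction up by tau and so replaces the constraint of being
    orthogonal to it. *)
Lemma form_addsq P q (l : (T -> R) -> R) tau : 0 <= tau -> pos_form P q ->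
  (forall a u v, P u -> P v -> l (lincomb a u v) = a * l u + l v) ->
  pos_form P (fun u v => q u v + tau * (l u * l v)).
Proof.
move=> t0 hq hl; split=> [u v Pu Pv|a u v w Pu Pv Pw|u Pu].
- by rewrite (formC hq)// (mulrC (l u)).
- by rewrite (formL hq)// hl//; ring.
- by rewrite addr_ge0 ?(form_ge0 hq)// mulr_ge0// -expr2 sqr_ge0.
Qed.

End forms.

(** Along an ultrafilter every bounded sequence converges; this handles
    finitely many sequences at once and spares successive extractions. *)
Lemma ultra_cvg_bounded (R : realType) (U : set_system nat) (x : nat -> R) (M : R) :
  UltraFilter U -> (forall k, `|x k| <= M) ->
  exists p : R, forall d, 0 < d -> U [set k | `|x k - p| < d].
Proof.
move=> UU xM.
have cpt : compact (`[- M, M] : set R) by exact: segment_compact.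
move: cpt; rewrite compact_ultra => /(_ (x @ U)).
have fx : UltraFilter (x @ U).
  split; first exact: fmap_proper_filter.
  move=> G FG sG; apply/seteqP; split=> // A GA.
  have [//|UnA] := @in_ultra_setVsetC _ U (x @^-1` A) UU.
  have /sG GnA : (x @ U) (~` A) by [].
  have : G (A `&` ~` A) by apply: filterI.
  by rewrite setICr => /filter_not_empty.
case=> //.
  have : U (x @^-1` `[- M, M]); last by [].
  apply: filterE => k /=; rewrite in_itv/=.
  by have := xM k; rewrite ler_norml.
move=> p [_ xp]; exists p => d d0.
have : U (x @^-1` (ball p d)) by apply: xp; exact: nbhsx_ballx.
by apply: filterS => k /=; rewrite /ball/= distrC.
Qed.

Section rayleigh.
Context (R : realType) (T : Type) (P : (T -> R) -> Prop).
Context (q b : (T -> R) -> (T -> R) -> R).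
Hypotheses (lP : lin_closed P) (hq : pos_form P q) (hb : pos_form P b).
Implicit Types u v w : T -> R.

(** The form of Rellich's theorem that is convenient here: up to a small
    multiple of q, the form b is controlled by finitely many b-bounded linear
    functionals. *)
Definition finitely_dominated := forall eps : R, 0 < eps ->
  exists (J : finType) (L : J -> (T -> R) -> R) (C : R),
  [/\ forall j a u v, P u -> P v -> L j (lincomb a u v) = a * L j u + L j v,
      forall j u, P u -> L j u ^+ 2 <= C * b u u &
      forall u, P u -> b u u <= eps * q u u + \sum_j L j u ^+ 2].

(** On a bounded sequence each of the finitely many functionals converges
    along the ultrafilter, hence takes nearly equal values on a large set of
    indices, and the domination inequality turns this into closeness for b. *)
Lemma ultra_cauchy (U : set_system nat) (w : nat -> T -> R) M :
  UltraFilter U -> finitely_dominated ->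
  (forall k, P (w k)) -> (forall k, q (w k) (w k) <= M) ->
  (forall k, b (w k) (w k) <= M) ->
  forall d, 0 < d -> exists2 A, U A & forall k l, A k -> A l ->
    b (lincomb (-1) (w k) (w l)) (lincomb (-1) (w k) (w l)) <= d.
Proof.
move=> UU fd Pw qM bM d d0.
have M0 : 0 <= M by apply: le_trans (bM 0%N); exact: (form_ge0 hb).
pose eps := d / 2 / (4 * M + 1).
have eps0 : 0 < eps by rewrite divr_gt0 ?divr_gt0//; lra.
have [J [L [C [Llin LC Lb]]]] := fd _ eps0.
have LM j k : `|L j (w k)| <= `|C| * M + 1.
  have h : L j (w k) ^+ 2 <= `|C| * M.
    apply: (le_trans (LC j _ (Pw k))); apply: (le_trans (ler_wpM2r _ (ler_norm C))).
      exact: (form_ge0 hb).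
    by rewrite ler_wpM2l.
  have CM : 0 <= `|C| * M by rewrite mulr_ge0.
  rewrite -(@ler_pXn2r _ 2) ?nnegrE ?addr_ge0// real_normK ?num_real//.
  apply: (le_trans h); move: CM; move: (_ * _) => t t0.
  by rewrite sqrrD expr1n mulr1; have := sqr_ge0 t; lra.
have HL j : exists p : R, forall d, 0 < d -> U [set k | `|L j (w k) - p| < d].
  exact: (@ultra_cvg_bounded _ U (fun k => L j (w k)) (`|C| * M + 1) UU (LM j)).
pose p j := sval (cid (HL j)).
have pE j : forall d, 0 < d -> U [set k | `|L j (w k) - p j| < d].
  exact: (svalP (cid (HL j))).
pose e := Num.min 1 (d / 2 / (4 * #|J|%:R + 1)).
have e0 : 0 < e.
  by rewrite lt_min ltr01/= divr_gt0 ?divr_gt0.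
exists [set k | forall j, `|L j (w k) - p j| < e].
  by apply: filter_forall => j; exact: pE.
move=> k l /= Ak Al.
have Pkl : P (lincomb (-1) (w k) (w l)) by exact: lP.
apply: (le_trans (Lb _ Pkl)).
have h1 : eps * q (lincomb (-1) (w k) (w l)) (lincomb (-1) (w k) (w l)) <= d / 2.
  have := form_sub_le lP hq (Pw k) (Pw l).
  have := qM k; have := qM l => *.
  apply: (@le_trans _ _ (eps * (4 * M + 1))).
    by rewrite ler_wpM2l// ?ltW//; lra.
  by rewrite /eps divfK// gt_eqF//; lra.
have h2 : \sum_j L j (lincomb (-1) (w k) (w l)) ^+ 2 <= d / 2.
  apply: (@le_trans _ _ (\sum_(j : J) (4 * e))).
    apply: ler_sum => j _; rewrite Llin//.
    have := Ak j; have := Al j; rewrite !ltr_norml => /andP[? ?] /andP[? ?].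
    have e1 : e <= 1 by rewrite ge_min lexx.
    set z := _ + _; have : `|z| <= 2 * e by rewrite ler_norml /z; apply/andP; split; lra.
    move=> ze; rewrite -real_normK ?num_real//.
    have z0 : 0 <= `|z| by []. nra.
  rewrite sumr_const -[leLHS]mulr_natr.
  have : e <= (d / 2 / (4 * #|J|%:R + 1)) by rewrite ge_min lexx orbT.
  rewrite ler_pdivlMr; last by rewrite ltr_wpDl ?mulr_ge0.
  by move: e0; move: (#|J|%:R : R) => t; nra.
lra.
Qed.

(** The direct method.  With nu the infimum and r = q - nu b, a normalized
    minimizing sequence satisfies r(w_k, w_k) -> 0.  Hence r(w_k, w) -> 0 for every
    w by Cauchy-Schwarz, and r(w_k - w_l, w_k - w_l) -> 0, so that being Cauchy for
    b, which [ultra_cauchy] provides, implies being Cauchy for q. *)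
Lemma min_rayleigh Lam u0 : finitely_dominated -> P u0 ->
  q u0 u0 < Lam * b u0 u0 ->
  exists (nu : R) (v : nat -> T -> R),
  [/\ nu < Lam, forall k, P (v k), forall k, b (v k) (v k) = 1,
      forall k, q (increment v k) (increment v k) +
        b (increment v k) (increment v k) <= 16 ^- k &
      forall w, P w -> (fun k => q (v k) w - nu * b (v k) w) @ \oo --> 0].
Proof.
move=> fd Pu0 u0L.
have b0 : 0 < b u0 u0.
  have := form_ge0 hb Pu0; rewrite le_eqVlt => /orP[/eqP b0|//].
  by have := form_ge0 hq Pu0; move: u0L; rewrite -b0 mulr0 => /lt_le_trans h /h;
    rewrite ltxx.
have P0 : P (lincomb (-1) u0 u0) by exact: lP.
have b00 v : P v -> b (lincomb (-1) u0 u0) v = 0 by move=> Pv; rewrite (formL hb)//; ring.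
have q00 v : P v -> q (lincomb (-1) u0 u0) v = 0 by move=> Pv; rewrite (formL hq)//; ring.
pose nrm (u : T -> R) := lincomb ((Num.sqrt (b u u))^-1) u (lincomb (-1) u0 u0).
have nrmP u : P u -> P (nrm u) by move=> Pu; exact: lP.
have nrmb u : P u -> 0 < b u u -> b (nrm u) (nrm u) = 1.
  move=> Pu bu; rewrite (form_sq _ lP hb)// (formC hb Pu P0) !b00// mulr0 !addr0.
  by rewrite exprVn sqr_sqrtr ?ltW// mulVf// gt_eqF.
have nrmq u : P u -> 0 < b u u -> q (nrm u) (nrm u) = q u u / b u u.
  move=> Pu bu; rewrite (form_sq _ lP hq)// (formC hq Pu P0) !q00// mulr0 !addr0.
  by rewrite exprVn sqr_sqrtr ?ltW// mulrC.
pose S := [set q u u | u in [set u | P u /\ b u u = 1]].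
have S0 : S !=set0 by exists (q (nrm u0) (nrm u0)), (nrm u0) => //; split; auto.
have lbS : lbound S 0 by move=> _ [u [Pu _] <-]; exact: (form_ge0 hq).
have infS : has_inf S by split=> //; exists 0.
pose nu := inf S.
have nuS u : P u -> nu * b u u <= q u u.
  move=> Pu; have := form_ge0 hb Pu; rewrite le_eqVlt => /orP[/eqP <-|bu].
    by rewrite mulr0; exact: (form_ge0 hq).
  rewrite -ler_pdivlMr// -nrmq//; apply: ge_inf; first by exists 0.
  by exists (nrm u) => //; split; auto.
have hr := form_shift hq hb nuS.
set r := (X in pos_form P X) in hr.
have nu0 : 0 <= nu by apply: lb_le_inf.
have nuL : nu < Lam.
  have := nuS _ Pu0 => h; rewrite -(ltr_pM2r b0); exact: le_lt_trans h u0L.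
have Hw (k : nat) : exists w, [/\ P w, b w w = 1 & q w w < nu + k.+1%:R^-1].
  have [|_ [w [Pw bw] <-] qw] := @inf_adherent _ S (k.+1%:R^-1) _ infS.
    by rewrite invr_gt0.
  by exists w; split.
pose w k := sval (cid (Hw k)).
have Pw k : P (w k) by have [] := svalP (cid (Hw k)).
have bw k : b (w k) (w k) = 1 by have [] := svalP (cid (Hw k)).
have qw k : q (w k) (w k) < nu + k.+1%:R^-1 by have [] := svalP (cid (Hw k)).
have rw_ k : r (w k) (w k) < k.+1%:R^-1 by rewrite /r bw mulr1 ltrBlDl.
have [U [UU sU]] := ultraFilterLemma (F := \oo) _.
pose qb d := q d d + b d d.
have Hd (i : nat) : exists A : set nat, U A /\ forall k l, A k -> A l ->
    qb (lincomb (-1) (w k) (w l)) <= 16 ^- i.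
  have e0 : 0 < 16 ^- i :> R by rewrite invr_gt0 exprn_gt0.
  have d0 : 0 < 16 ^- i / 2 / (nu + 1) :> R by rewrite divr_gt0 ?divr_gt0//; lra.
  have qM k : q (w k) (w k) <= nu + 1.
    by rewrite (le_trans (ltW (qw k)))// lerD2l invf_le1// ler1n.
  have bM k : b (w k) (w k) <= nu + 1 by rewrite bw; lra.
  have [A UA AA] := ultra_cauchy UU fd Pw qM bM d0.
  pose K := `|Num.ceil (8 / 16 ^- i : R)|%N.
  have UK : U [set k | (K <= k)%N] by apply: sU; exists K.
  exists (A `&` [set k | (K <= k)%N]); split; first exact: filterI.
  have rK k : (K <= k)%N -> r (w k) (w k) <= 16 ^- i / 8.
    move=> Kk; apply: (le_trans (ltW (rw_ k))).
    rewrite -[leRHS]invrK lef_pV2 ?posrE ?invr_gt0 ?divr_gt0// invf_div.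
    apply: (@le_trans _ _ K%:R); last by rewrite ler_nat ltnW.
    rewrite /K natr_absz ger0_norm; first exact: Num.Theory.ceil_ge.
    by rewrite ceil_ge0// (lt_le_trans _ (ltW (divr_gt0 _ _)))//; lra.
  move=> k l [Ak /= Kk] [Al /= Kl]; rewrite /qb; set dd := lincomb _ _ _.
  have bd : b dd dd <= 16 ^- i / 2 / (nu + 1) by exact: AA.
  have rd : r dd dd <= 16 ^- i / 2.
    apply: (le_trans (form_sub_le lP hr (Pw k) (Pw l))).
    have := rK _ Kk; have := rK _ Kl; lra.
  have -> : q dd dd + b dd dd = r dd dd + (nu + 1) * b dd dd by rewrite /r; ring.
  have : (nu + 1) * b dd dd <= 16 ^- i / 2.
    by rewrite mulrC -ler_pdivlMr//; lra.
  lra.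
pose A i := sval (cid (Hd i)).
have UA i : U (A i) by have [] := svalP (cid (Hd i)).
have AP i : forall k l, A i k -> A i l ->
  qb (lincomb (-1) (w k) (w l)) <= 16 ^- i by have [] := svalP (cid (Hd i)).
(* an index that lies in A_0, ..., A_i keeps close to all later choices *)
have Hk (i : nat) : exists k, (i <= k)%N /\ forall j, (j <= i)%N -> A j k.
  have : U ([set k | (i <= k)%N] `&` [set k | forall j : 'I_i.+1, A j k]).
    apply: filterI; first by apply: sU; exists i.
    by apply: filter_forall => j; exact: UA.
  move=> /filter_ex[k /= [ik Ak]]; exists k; split => // j ji.
  by have := Ak (Ordinal (ji : (j < i.+1)%N)).
pose s i := sval (cid (Hk i)).
have sge i : (i <= s i)%N by have [] := svalP (cid (Hk i)).
have sA i j : (j <= i)%N -> A j (s i) by have [_] := svalP (cid (Hk i)); exact.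
exists nu, (fun i => w (s i)); split => //.
- by move=> k; exact: (AP k _ _ (sA k k (leqnn k)) (sA k.+1 k (leqnSn k))).
move=> u Pu.
have rsu k : `|r (w (s k)) u| ^+ 2 <= k.+1%:R^-1 * r u u.
  rewrite real_normK ?num_real//; apply: (le_trans (form_CS lP hr (Pw _) Pu)).
  rewrite ler_wpM2r ?(form_ge0 hr)// (le_trans (ltW (rw_ _)))//.
  by rewrite lef_pV2 ?posrE// ler_nat ltnS.
apply/cvgrPdist_le => e e0.
near=> k.
rewrite sub0r normrN -(@ler_pXn2r _ 2) ?nnegrE// ?(ltW e0)//.
apply: le_trans (rsu k) _.
rewrite mulrC ler_pdivrMr ?ltr0Sn// mulrC -ler_pdivrMr ?exprn_gt0//.
rewrite (@le_trans _ _ k%:R) ?ler_nat//.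
near: k; exact: nbhs_infty_ger.
Unshelve. all: by end_near. Qed.

End rayleigh.

(** * Convergence for a form *)
Section form_limits.
Context (R : realType) (T : Type) (P : (T -> R) -> Prop).
Context (b : (T -> R) -> (T -> R) -> R).
Hypotheses (lP : lin_closed P) (hb : pos_form P b).
Implicit Types (u v : nat -> T -> R) (f g : T -> R) (a : R).

(** The difference is taken in the order u_k - f because that is what
    [lincomb] with coefficient -1 gives. *)
Definition form_cvg u f : Prop :=
  (fun k => b (lincomb (-1) f (u k)) (lincomb (-1) f (u k))) @ \oo --> 0.

Lemma form_cvg_const f : P f -> form_cvg (fun=> f) f.
Proof.
move=> Pf; rewrite /form_cvg (_ : (fun _ => _) = fun=> 0); first exact: cvg_cst.
by apply/funext => k; rewrite (form_sq _ lP hb)//; ring.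
Qed.

Lemma form_cvg_lc a u v f g : (forall k, P (u k)) -> (forall k, P (v k)) ->
  P f -> P g -> form_cvg u f -> form_cvg v g ->
  form_cvg (fun k => lincomb a (u k) (v k)) (lincomb a f g).
Proof.
move=> Pu Pv Pf Pg uf vg.
have Px k : P (lincomb (-1) f (u k)) by exact: lP.
have Py k : P (lincomb (-1) g (v k)) by exact: lP.
set x := fun k => lincomb (-1) f (u k); set y := fun k => lincomb (-1) g (v k).
have H k : b (lincomb (-1) (lincomb a f g) (lincomb a (u k) (v k)))
    (lincomb (-1) (lincomb a f g) (lincomb a (u k) (v k))) <=
  2 * a ^+ 2 * b (x k) (x k) + 2 * b (y k) (y k).
  have -> : lincomb (-1) (lincomb a f g) (lincomb a (u k) (v k)) = lincomb a (x k) (y k).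
    by apply/funext => t; rewrite /x /y /lincomb; ring.
  have : 0 <= b (lincomb (- a) (x k) (y k)) (lincomb (- a) (x k) (y k)).
    by apply: (form_ge0 hb); apply: lP; [exact: Px|exact: Py].
  by rewrite !(form_sq _ lP hb (Px k) (Py k)); lra.
apply: (@squeeze_cvgr _ _ _ _ (fun=> 0) (fun k => 2 * a ^+ 2 * b (x k) (x k) +
    2 * b (y k) (y k))); last 2 first.
- exact: cvg_cst.
- rewrite -[X in _ --> X](_ : 2 * a ^+ 2 * 0 + 2 * 0 = 0); last by ring.
  by apply: cvgD; apply: cvgM => //; exact: cvg_cst.
by near=> k; rewrite H andbT; apply: (form_ge0 hb); apply: lP => //; exact: lP.
Unshelve. all: by end_near. Qed.

Lemma form_cvg_form u v f g : (forall k, P (u k)) -> (forall k, P (v k)) ->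
  P f -> P g -> form_cvg u f -> form_cvg v g ->
  (fun k => b (u k) (v k)) @ \oo --> b f g.
Proof.
move=> Pu Pv Pf Pg uf vg.
set x := fun k => lincomb (-1) f (u k); set y := fun k => lincomb (-1) g (v k).
have Px k : P (x k) by exact: lP.
have Py k : P (y k) by exact: lP.
have CS (s t : R) (X Y : nat -> T -> R) : (forall k, P (X k)) -> (forall k, P (Y k)) ->
    (fun k => b (X k) (X k)) @ \oo --> s -> (fun k => b (Y k) (Y k)) @ \oo --> t ->
    s * t = 0 -> (fun k => b (X k) (Y k)) @ \oo --> (0 : R).
  move=> PX PY Xs Yt st.
  apply: norm_cvg0; rewrite -(@sqrtr0 R).
  rewrite (_ : (fun _ => _) = Num.sqrt \o (fun k => b (X k) (Y k) ^+ 2)); last first.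
    by apply/funext => k /=; rewrite sqrtr_sqr.
  apply: continuous_cvg; first exact: sqrt_continuous.
  apply: (@squeeze_cvgr _ _ _ _ (fun=> 0) (fun k => b (X k) (X k) * b (Y k) (Y k))).
  - by near=> k; rewrite sqr_ge0 (form_CS lP hb).
  - exact: cvg_cst.
  - by rewrite -st; exact: cvgM.
have -> : (fun k => b (u k) (v k)) =
    fun k => b (x k) (y k) + b f (y k) + b (x k) g + b f g.
  apply/funext => k.
  have -> : u k = lincomb 1 f (x k) by apply/funext => t; rewrite /x /lincomb; ring.
  have -> : v k = lincomb 1 g (y k) by apply/funext => t; rewrite /y /lincomb; ring.
  move: (x k) (y k) (Px k) (Py k) => X Y PX PY.
  have Pl1 : P (lincomb 1 g Y) by exact: lP.
  rewrite (formL hb)// (formC hb Pf Pl1) (formC hb PX Pl1) !(formL hb)//.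
  by rewrite (formC hb Pf Pg) (formC hb Pf PY) (formC hb PX Pg) (formC hb PX PY); ring.
rewrite -[X in _ --> X](_ : 0 + 0 + 0 + b f g = b f g); last by ring.
apply: cvgD; last exact: cvg_cst.
apply: cvgD; first apply: cvgD.
- by apply: (CS 0 0) => //; rewrite mulr0.
- by apply: (CS (b f f) 0) => //; [exact: cvg_cst|rewrite mulr0].
- by apply: (CS 0 (b g g)) => //; [exact: cvg_cst|rewrite mul0r].
Unshelve. all: by end_near. Qed.

End form_limits.

Lemma fast_cauchy (R : realType) (a : nat -> R) (c : R) :
  (forall k, `|a k.+1 - a k| <= c * 2 ^- k) ->
  exists2 L, a @ \oo --> L & forall k, `|L - a k| <= 2 * c * 2 ^- k.
Proof.
move=> ac.
have c0 : 0 <= c by have := ac 0%N; rewrite expr0 invr1 mulr1; apply: le_trans.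
have H k p : `|a (k + p)%N - a k| <= 2 * c * 2 ^- k - 2 * c * 2 ^- (k + p).
  elim: p => [|p IH]; first by rewrite addn0 !subrr normr0.
  rewrite addnS -(subrKA (a (k + p)%N)).
  apply: (le_trans (ler_normD _ _)).
  have := ac (k + p)%N; rewrite exprS invfM.
  move: IH; move: (2 ^- (k + p)) (`|a (k + p).+1 - _|) (`|_ - a k|) => s t r.
  have -> : 2 * c * (2^-1 * s) = c * s by field.
  by move=> *; lra.
have H2 k m : (k <= m)%N -> `|a m - a k| <= 2 * c * 2 ^- k.
  move=> km; have := H k (m - k)%N; rewrite subnKC// => /le_trans; apply.
  by rewrite gerBl !mulr_ge0// invr_ge0 exprn_ge0.
have ca : cauchy (a @ \oo).
  apply/cauchy_exP => e e0.
  have [k ke] : exists k, 2 * c * 2 ^- k < e.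
    have : (fun k => 2 * c * 2 ^- k) @ \oo --> (2 * c * 0 : R).
      apply: cvgM; first exact: cvg_cst.
      rewrite (_ : (fun _ => _) = fun k => 2^-1 ^+ k :> R).
        by apply: cvg_expr; rewrite ger0_norm ?invr_ge0// invf_lt1// ltr1n.
      by apply/funext => k; rewrite exprVn.
    rewrite mulr0 => /cvgrPdist_lt /(_ _ e0)[k _ /(_ k (leqnn k))] /=.
    by rewrite sub0r normrN => /(le_lt_trans (ler_norm _)); exists k.
  exists (a k); exists k => // m /= km; rewrite /ball/= distrC.
  exact: le_lt_trans (H2 _ _ km) ke.
have /cvg_ex[/= L aL] : cvg (a @ \oo) by exact: cauchy_cvg.
exists L => // k.
have Lk : (fun m => `|a m - a k|) @ \oo --> `|L - a k|.
  by apply: cvg_norm; apply: cvgB => //; exact: cvg_cst.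
rewrite -(cvg_lim _ Lk)//; apply: limr_le; first by apply/cvg_ex; exists `|L - a k|.
by exists k => // m /= km; exact: H2.
Qed.

(** * Weighted square-integrable functions and their completeness *)
Section weighted_L2.
Context d (X : measurableType d) (R : realType).
Context (mu : {measure set X -> \bar R}) (D : set X) (w : X -> R).
Hypotheses (mD : measurable D) (mw : measurable_fun D w).
Hypothesis w0 : forall x, D x -> 0 < w x.
Implicit Types f g h : X -> R.

Definition sqint f := measurable_fun D f /\
  mu.-integrable D (fun x => (f x ^+ 2 * w x)%:E).

Definition wdot f g : R := \int[mu]_(x in D) (f x * g x * w x).

(** From |2 f g| <= f^2 + g^2. *)
Lemma sqint_mulw f g : sqint f -> sqint g ->
  mu.-integrable D (fun x => (f x * g x * w x)%:E).
Proof.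
move=> [mf fi] [mg gi]; apply: (le_integrable mD _ _ (integrableD mD fi gi)).
  by apply/measurable_EFinP; do 2 apply: measurable_funM => //.
move=> x Dx /=; rewrite lee_fin normrM (gtr0_norm (w0 Dx)).
rewrite -mulrDl [leRHS]normrM (gtr0_norm (w0 Dx)) ler_wpM2r ?(ltW (w0 Dx))//.
apply: (le_trans _ (ler_norm _)).
rewrite ler_norml; have := sqr_ge0 (f x + g x); have := sqr_ge0 (f x - g x).
rewrite !expr2 => *.
have := sqr_ge0 (f x); have := sqr_ge0 (g x); rewrite !expr2 => *.
by apply/andP; split; nra.
Qed.

Lemma sqint_lc : lin_closed sqint.
Proof.
move=> a f g Hf Hg; have fg := sqint_mulw Hf Hg; have [mf fi] := Hf; have [mg gi] := Hg.
split; first by apply: measurable_funD => //; exact: measurable_funM.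
have := integrableD mD (integrableZl mD (a ^+ 2) fi)
  (integrableD mD (integrableZl mD (2 * a) fg) gi).
apply: eq_integrable => // x _ /=.
by rewrite -!EFinM -!EFinD /lincomb; congr EFin; ring.
Qed.

Lemma wdot_form : pos_form sqint wdot.
Proof.
split=> [f g _ _|a f g h Hf Hg Hh|f Hf].
- by apply: eq_Rintegral => x _; rewrite (mulrC (f x)).
- rewrite /wdot -RintegralZl//; last exact: sqint_mulw.
  rewrite -RintegralD//; last 2 first.
  + have := integrableZl mD a (sqint_mulw Hf Hh).
    by apply: eq_integrable => // x _ /=; rewrite -EFinM.
  + exact: sqint_mulw.
  by apply: eq_Rintegral => x _; rewrite /lincomb; ring.
- by apply: Rintegral_ge0 => x Dx; rewrite mulr_ge0 -?expr2 ?sqr_ge0// (ltW (w0 Dx)).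
Qed.

Lemma wdot_integral f : sqint f ->
  (\int[mu]_(x in D) (f x ^+ 2 * w x)%:E = (wdot f f)%:E)%E.
Proof.
move=> [mf fi]; rewrite /wdot /Rintegral fineK.
  by apply: eq_integral => x _; rewrite expr2.
rewrite (_ : (fun x => _) = fun x => (f x ^+ 2 * w x)%:E); last first.
  by apply/funext => x; rewrite expr2.
exact: integrable_fin_num.
Qed.

Lemma sqint_lty f : measurable_fun D f ->
  (\int[mu]_(x in D) (f x ^+ 2 * w x)%:E < +oo)%E -> sqint f.
Proof.
move=> mf foo; split=> //; apply/integrableP; split.
  by apply/measurable_EFinP; apply: measurable_funM => //; exact: measurable_funX.
rewrite (eq_integral (fun x => (f x ^+ 2 * w x)%:E))// => x /[!inE] Dx.
by rewrite gee0_abs// lee_fin mulr_ge0 ?sqr_ge0// (ltW (w0 Dx)).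
Qed.

Lemma wdot_le f g : sqint f -> sqint g -> (forall x, D x -> `|f x| <= `|g x|) ->
  wdot f f <= wdot g g.
Proof.
move=> Hf Hg fg; apply: le_Rintegral => //; [exact: sqint_mulw..|].
move=> x Dx; rewrite ler_wpM2r ?(ltW (w0 Dx))// -!expr2 -(real_normK (num_real (f x))).
by rewrite -(real_normK (num_real (g x))) ler_pXn2r ?nnegrE ?fg.
Qed.

Lemma sqint_le f g : measurable_fun D f -> sqint g ->
  (forall x, D x -> `|f x| <= `|g x|) -> sqint f.
Proof.
move=> mf [mg gi] fg; split=> //; apply: (le_integrable mD _ _ gi).
  by apply/measurable_EFinP; apply: measurable_funM => //; exact: measurable_funX.
move=> x Dx; have h y : 0 <= y ^+ 2 * w x by rewrite mulr_ge0 ?sqr_ge0 ?(ltW (w0 Dx)).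
rewrite lee_fin (ger0_norm (h _)) (ger0_norm (h _)).
rewrite ler_wpM2r ?(ltW (w0 Dx))// -(real_normK (num_real (f x))).
by rewrite -(real_normK (num_real (g x))) ler_pXn2r ?nnegrE ?fg.
Qed.

Lemma sqint_scale (a : R) f : sqint f -> sqint (fun x => a * f x).
Proof.
move=> Hf; rewrite (_ : (fun _ => _) = lincomb (a - 1) f f); first exact: sqint_lc.
by apply/funext => x; rewrite /lincomb; ring.
Qed.

Lemma sqint_mul h (C : R) f : measurable_fun D h -> (forall x, D x -> `|h x| <= C) ->
  sqint f -> sqint (fun x => h x * f x).
Proof.
move=> mh hC Hf; apply: (@sqint_le _ (fun x => C * f x)); last 2 first.
- exact: sqint_scale.
- by move=> x Dx; rewrite !normrM ler_wpM2r// (le_trans (hC x Dx))// ler_norm.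
- by apply: measurable_funM => //; case: Hf.
Qed.

Lemma form_cvg_mul h (C : R) (u : nat -> X -> R) f :
  measurable_fun D h -> (forall x, D x -> `|h x| <= C) ->
  (forall k, sqint (u k)) -> sqint f -> form_cvg wdot u f ->
  form_cvg wdot (fun k x => h x * u k x) (fun x => h x * f x).
Proof.
move=> mh hC Hu Hf uf.
have Hz k : sqint (lincomb (-1) f (u k)) by exact: sqint_lc.
have C2 : (fun k => C ^+ 2 * wdot (lincomb (-1) f (u k)) (lincomb (-1) f (u k))) @ \oo --> 0.
  by rewrite -(mulr0 (C ^+ 2)); apply: cvgM => //; exact: cvg_cst.
apply: squeeze_cvgr (@cvg_cst _ (0 : R) _ \oo _) C2.
near=> k.
rewrite (_ : lincomb (-1) _ _ = fun x => h x * lincomb (-1) f (u k) x); last first.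
  by apply/funext => x; rewrite /lincomb; ring.
rewrite (form_ge0 wdot_form (sqint_mul mh hC (Hz k)))/=.
apply: (@le_trans _ _ (wdot (fun x => C * lincomb (-1) f (u k) x) (fun x => C * lincomb (-1) f (u k) x))).
  apply: wdot_le; [exact: (sqint_mul mh hC (Hz k))|exact: (sqint_scale _ (Hz k))|].
  by move=> x Dx; rewrite !normrM ler_wpM2r// (le_trans (hC x Dx))// ler_norm.
rewrite /wdot -RintegralZl//; last exact: (sqint_mulw (Hz k) (Hz k)).
by rewrite le_eqVlt; apply/orP; left; apply/eqP; apply: eq_Rintegral => x _; ring.
Unshelve. all: by end_near. Qed.

(** The increments are so small that 4^k times their squares have a summable
    integral.  So the sum S of these squares is finite almost everywhere, where it
    bounds the k-th increment by a multiple of 2^-k; the sequence then converges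
    pointwise, and its distance to the limit is at most a multiple of 4^-k S. *)
Lemma riesz_fischer (f : nat -> X -> R) : (forall k, sqint (f k)) ->
  (forall k, wdot (increment f k) (increment f k) <= 16 ^- k) ->
  exists2 g, sqint g & form_cvg wdot f g.
Proof.
move=> Hf fk.
pose e k := increment f k.
have He k : sqint (e k) by exact: sqint_lc.
pose G k x := (4 ^+ k * (e k x ^+ 2 * w x))%:E.
have G0 k x : D x -> (0 <= G k x)%E.
  by move=> Dx; rewrite lee_fin mulr_ge0 ?exprn_ge0// mulr_ge0 ?sqr_ge0 ?(ltW (w0 Dx)).
have mG k : measurable_fun D (G k).
  apply/measurable_EFinP; apply: measurable_funM => //; apply: measurable_funM => //.
  by apply: measurable_funX; case: (He k).
have iG k : (\int[mu]_(x in D) G k x <= (4 ^- k)%:E)%E.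
  under eq_integral do rewrite /G EFinM.
  rewrite ge0_integralZl_EFin ?exprn_ge0//; last 2 first.
  - by move=> x Dx; rewrite lee_fin mulr_ge0 ?sqr_ge0 ?(ltW (w0 Dx)).
  - apply/measurable_EFinP; apply: measurable_funM => //.
    by apply: measurable_funX; case: (He k).
  rewrite wdot_integral// -EFinM lee_fin.
  apply: (@le_trans _ _ (4 ^+ k * 16 ^- k)).
    by rewrite ler_wpM2l ?exprn_ge0//; exact: fk.
  rewrite (_ : 16 = 4 * 4 :> R); last by ring.
  by rewrite exprMn invfM mulrA divff ?mul1r// expf_neq0.
pose S x := (\sum_(k <oo) G k x)%E.
have S0 x : D x -> (0 <= S x)%E by move=> Dx; apply: nneseries_ge0 => k _ _; exact: G0.
have mS : measurable_fun D S by apply: ge0_emeasurable_sum => // k x Dx _; exact: G0.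
have iS : (\int[mu]_(x in D) S x <= 2%:E)%E.
  rewrite integral_nneseries//.
  apply: lime_le.
    by apply: is_cvg_nneseries => k _ _; apply: integral_ge0 => x Dx; exact: G0.
  apply: nearW => n.
  have : (\sum_(0 <= k < n) \int[mu]_(x in D) G k x <= (2 - 2 * 4 ^- n)%:E)%E.
    elim: n => [|n IH]; first by rewrite big_geq// expr0 invr1 mulr1 subrr.
    rewrite big_nat_recr//=; apply: (le_trans (leeD IH (iG n))).
    rewrite -EFinD lee_fin exprS invfM.
    have : 0 <= 4 ^- n :> R by rewrite invr_ge0 exprn_ge0.
    move: (4 ^- n : R) => s; lra.
  by move=> /le_trans; apply; rewrite lee_fin gerBl mulr_ge0// invr_ge0 exprn_ge0.
have intS : mu.-integrable D S.
  apply/integrableP; split => //.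
  rewrite (eq_integral S) ?(le_lt_trans iS) ?ltry// => x /[!inE] Dx.
  by rewrite gee0_abs ?S0.
pose A := D `&` [set x | S x \is a fin_num].
have mA : measurable A by exact: emeasurable_fin_num.
have key x : A x -> exists2 L, (fun k => f k x) @ \oo --> L &
    forall k, (L - f k x) ^+ 2 * w x <= 4 * 4 ^- k * fine (S x).
  move=> [Dx Sx]; have wx := w0 Dx.
  have s0 : 0 <= fine (S x) by rewrite fine_ge0// S0.
  pose c := Num.sqrt (fine (S x) / w x).
  have c0 : 0 <= c by exact: sqrtr_ge0.
  have c2 : c ^+ 2 = fine (S x) / w x by rewrite sqr_sqrtr// divr_ge0// ltW.
  have p2 k : (2 ^- k) ^+ 2 = 4 ^- k :> R.
    by rewrite exprVn -exprM mulnC exprM -natrX.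
  have ek k : 4 ^+ k * (e k x ^+ 2 * w x) <= fine (S x).
    rewrite -lee_fin fineK//; apply: (le_trans _ (nneseries_lim_ge k.+1 _)).
      rewrite big_nat_recr//= leeDr// sume_ge0// => j _; exact: G0.
    by move=> n _ _; exact: G0.
  have [k|L fL HL] := @fast_cauchy R (fun k => f k x) c.
    have -> : f k.+1 x - f k x = e k x by rewrite /e /increment /lincomb; ring.
    rewrite -(@ler_pXn2r _ 2) ?nnegrE ?mulr_ge0 ?invr_ge0 ?exprn_ge0//.
    rewrite real_normK ?num_real// exprMn c2 p2.
    rewrite -(@ler_pM2r _ (4 ^+ k * w x)) ?mulr_gt0 ?exprn_gt0//.
    have := ek k; rewrite mulrCA mulrA => /le_trans; apply.
    rewrite le_eqVlt; apply/orP; left; apply/eqP; field.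
    by rewrite expf_neq0//= gt_eqF.
  exists L => // k.
  have h : (L - f k x) ^+ 2 <= 4 * 4 ^- k * (fine (S x) / w x).
    rewrite -c2 -p2 -(real_normK (num_real (L - _))).
    rewrite (_ : 4 * _ * _ = (2 * c * 2 ^- k) ^+ 2); last by ring.
    by rewrite ler_pXn2r ?nnegrE// !mulr_ge0// invr_ge0 exprn_ge0.
  rewrite -(ler_pM2r wx) in h; apply: (le_trans h).
  by rewrite mulrA divfK// gt_eqF.
pose g x := if pselect (A x) is left Ax then s2val (cid2 (key x Ax)) else 0.
have gL x : A x -> (fun k => f k x) @ \oo --> g x.
  by rewrite /g; case: pselect => // Ax _; exact: (s2valP (cid2 (key x Ax))).
have gB x : A x -> forall k, (g x - f k x) ^+ 2 * w x <= 4 * 4 ^- k * fine (S x).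
  by rewrite /g; case: pselect => // Ax _; exact: (s2valP' (cid2 (key x Ax))).
have mg : measurable_fun D g.
  apply: (@measurable_fun_cvg _ _ _ D (fun k x => f k x * \1_A x)) => [k|x Dx].
    by apply: measurable_funM; [case: (Hf k)|exact: measurable_indic].
  have [Ax|nAx] := pselect (A x).
    by rewrite indicE mem_set//=; under eq_fun do rewrite mulr1; exact: gL.
  rewrite indicE memNset//=; under eq_fun do rewrite mulr0.
  by rewrite /g; case: pselect => // _; exact: cvg_cst.
have ig k : (\int[mu]_(x in D) ((lincomb (-1) g (f k) x) ^+ 2 * w x)%:E <=
    (8 * 4 ^- k)%:E)%E.
  have -> : (8 * 4 ^- k)%:E = ((4 * 4 ^- k)%:E * 2%:E)%E :> \bar R.
    by rewrite -EFinM; congr EFin; ring.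
  have c0 : 0 <= 4 * 4 ^- k :> R by rewrite mulr_ge0// invr_ge0 exprn_ge0.
  apply: (@le_trans _ _ (\int[mu]_(x in D) ((4 * 4 ^- k)%:E * S x)))%E; last first.
    by rewrite ge0_integralZl_EFin// lee_wpmul2l.
  apply: ae_ge0_le_integral => //.
  - by move=> x Dx; rewrite lee_fin mulr_ge0 ?sqr_ge0 ?(ltW (w0 Dx)).
  - apply/measurable_EFinP; apply: measurable_funM => //; apply: measurable_funX.
    apply: measurable_funD; last by case: (Hf k).
    by apply: measurable_funM.
  - by move=> x Dx; rewrite mule_ge0// S0.
  - exact: measurable_funeM.
  have := integrable_ae mD intS; apply: filterS => x Sx Dx.
  have := gB x (conj Dx (Sx Dx)) k.
  rewrite -(fineK (Sx Dx)) -EFinM lee_fin; apply: le_trans.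
  by rewrite le_eqVlt; apply/orP; left; apply/eqP; rewrite /lincomb; ring.
have Hgf k : sqint (lincomb (-1) g (f k)).
  apply: sqint_lty; last by rewrite (le_lt_trans (ig k)) ?ltry.
  by apply: measurable_funD; [exact: measurable_funM|case: (Hf k)].
exists g.
  have -> : g = lincomb (-1) (lincomb (-1) g (f 0%N)) (f 0%N).
    by apply/funext => x; rewrite /lincomb; ring.
  exact: sqint_lc.
have c80 : (fun k => 8 * 4 ^- k) @ \oo --> (0 : R).
  rewrite -(mulr0 8); apply: cvgM; first exact: cvg_cst.
  rewrite (_ : (fun _ => _) = fun k => 4^-1 ^+ k :> R).
    by apply: cvg_expr; rewrite ger0_norm ?invr_ge0// invf_lt1// ltr1n.
  by apply/funext => k; rewrite exprVn.
apply: squeeze_cvgr (@cvg_cst _ (0 : R) _ \oo _) c80.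
near=> k; rewrite (form_ge0 wdot_form)//=.
by rewrite -lee_fin -wdot_integral.
Unshelve. all: by end_near. Qed.

End weighted_L2.

(** * Borel sets and boxes in R^n *)
Section borel.
Context (R : realType) (n : nat).
Implicit Types (A : set 'rV[R]_n) (f : 'rV[R]_n -> R).

Lemma rV_ballP (x : 'rV[R]_n) e y : 0 < e ->
  ball x e y <-> forall i, `|x ord0 i - y ord0 i| < e.
Proof.
move=> e0; split=> [[_ h] i|h]; first exact: (h ord0 i).
by split=> // i j; rewrite (ord1 i); exact: h.
Qed.

Lemma measurable_rV_ball (x : 'rV[R]_n) e : 0 < e -> measurable (ball x e : set 'rV[R]_n).
Proof.
move=> e0.
have -> : ball x e = \bigcap_(i in [set: 'I_n]) (@rV_coord R n i @^-1` ball (x ord0 i) e).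
  apply/seteqP; split => y; first by move/(rV_ballP _ _ e0) => h i _; exact: h.
  by move=> h; apply/(rV_ballP _ _ e0) => i; exact: (h i I).
apply: fin_bigcap_measurable => // i _.
rewrite -[X in measurable X]setTI; apply: measurable_rV_coord => //.
exact: measurable_ball.
Qed.

(** An open set is the union of the countably many balls with rational
    centre and radius 1 / (k + 1) that it contains. *)
Lemma open_measurable_rV A : open A -> measurable A.
Proof.
move=> oA.
pose F (p : 'rV[rat]_n * nat) : set 'rV[R]_n :=
  let B := ball (map_mx ratr p.1 : 'rV[R]_n) (p.2.+1%:R^-1) in
  if pselect (B `<=` A) then B else set0.
have -> : A = \bigcup_p F p.
  apply/seteqP; split=> x; last first.
    by move=> [p _]; rewrite /F; case: pselect => // BA /BA.
  move=> Ax; have : nbhs x A by exact: open_nbhs_nbhs.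
  move=> /nbhs_ballP[e /= e0 xeA].
  pose k := Num.truncn (2 / e); pose d := k.+1%:R^-1 : R.
  have d0 : 0 < d by rewrite invr_gt0.
  have de : d < e / 2.
    rewrite /d -[ltRHS]invrK ltf_pV2 ?posrE ?invr_gt0 ?divr_gt0// invf_div.
    exact: truncnS_gt.
  have Hq i : exists q : rat, `|x ord0 i - ratr q| < d.
    have /rat_in_itvoo[q] : x ord0 i - d < x ord0 i + d by lra.
    rewrite in_itv/= => /andP[? ?]; exists q; rewrite ltr_norml; apply/andP; split; lra.
  pose q : 'rV[rat]_n := \row_i sval (cid (Hq i)).
  have qx i : `|x ord0 i - ratr (q ord0 i)| < d.
    by rewrite /q mxE; exact: (svalP (cid (Hq i))).
  exists (q, k) => //; rewrite /F /= -/d; case: pselect => /= [_|].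
    by apply/rV_ballP => // i; rewrite mxE distrC.
  case=> y /(rV_ballP _ _ d0) qy; apply: xeA; apply/rV_ballP => // i.
  have := qy i; rewrite mxE => qyi.
  apply: (le_lt_trans (ler_distD (ratr (q ord0 i)) _ _)).
  by rewrite [ltRHS]splitr ltrD ?(lt_trans (qx i))// (lt_trans qyi).
apply: (@countable_bigcupT_measurable _ _ ('rV[rat]_n * nat)%type F).
  exact: countableP.
move=> p; rewrite /F /=; case: pselect => BA; last exact: measurable0.
have e0 : 0 < p.2.+1%:R^-1 :> R by rewrite invr_gt0.
exact: (@measurable_rV_ball (map_mx ratr p.1) _ e0).
Qed.

Lemma continuous_measurable_rV f : continuous f -> measurable_fun setT f.
Proof.
move=> cf; apply: (measurability _ (@RGenOpens.measurableE R)).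
move=> _ [_ [a [b ->] <-]]; rewrite setTI; apply: open_measurable_rV.
by apply: open_comp => // x _; exact: cf.
Qed.

End borel.

Section boxes.
Context (R : realType).

Definition box n (M : R) : set 'rV[R]_n := [set x | forall i, `|x ord0 i| <= M].

Lemma closed_box n M : closed (@box n M).
Proof.
have -> : @box n M = \bigcap_(i in [set: 'I_n])
   ((fun x : 'rV[R]_n => x ord0 i) @^-1` `[- M, M]).
  apply/seteqP; split=> x h i; first by move=> _; rewrite /= in_itv/= -ler_norml;
    exact: h.
  by have := h i I; rewrite /= in_itv/= -ler_norml.
apply: closed_bigI => i _; apply: closed_comp; last exact: interval_closed.
by move=> x _; exact: coord_continuous.
Qed.

Lemma compact_box n M : compact (@box n M).
Proof.
have -> : @box n M = [set v : 'rV[R]_n | forall i, `[- M, M]%classic (v ord0 i)].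
  by apply/seteqP; split => x h i; have := h i; rewrite /= in_itv/= -ler_norml.
by apply: (@rV_compact _ _ (fun=> `[- M, M]%classic)) => _; exact: segment_compact.
Qed.

Lemma measurable_box n M : measurable (@box n M).
Proof. by rewrite -[box M]setCK; apply: measurableC; apply: open_measurable_rV;
  rewrite openC; exact: closed_box. Qed.

Lemma rV_cons0 n t (y : 'rV[R]_n) : rV_cons (t, y) ord0 ord0 = t.
Proof. by rewrite mxE unlift_none. Qed.

Lemma rV_consS n t (y : 'rV[R]_n) j : rV_cons (t, y) ord0 (lift ord0 j) = y ord0 j.
Proof. by rewrite mxE liftK. Qed.

Lemma box_cons n M t (y : 'rV[R]_n) :
  box M (rV_cons (t, y)) <-> `|t| <= M /\ box M y.
Proof.
split=> [h|[ht hy] i].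
  by split=> [|j]; [have := h ord0; rewrite rV_cons0|have := h (lift ord0 j);
    rewrite rV_consS].
by case: (unliftP ord0 i) => [j ->|->]; rewrite ?rV_cons0 ?rV_consS.
Qed.

Lemma rV_lebesgueS n A : rV_lebesgue R n.+1 A =
  pushforward (lebesgue_measure \x rV_lebesgue R n)%E (@rV_cons R n) A.
Proof. by []. Qed.

Lemma box_lty n M : (rV_lebesgue R n (@box n M) < +oo)%E.
Proof.
elim: n => [|n IH]; first by rewrite /= diracE ltry.
rewrite rV_lebesgueS /pushforward.
have -> : @rV_cons R n @^-1` (@box n.+1 M) = `[- M, M]%classic `*` @box n M.
  apply/seteqP; split=> -[t y] /=; rewrite in_itv/= -ler_norml.
    by move/box_cons.
  by move=> ?; apply/box_cons.
rewrite product_measure1E//; last exact: measurable_box.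
rewrite lte_mul_pinfty//.
  suff : (lebesgue_measure (`[- M, M]%classic : set R) : \bar R) \is a fin_num by [].
  by rewrite lebesgue_measure_itv/=; case: ifP => // _; rewrite -EFinD.
Qed.

End boxes.

(** * Slices, fibres and Fubini's theorem *)
Section bounded_vanishing.
Context d (X : measurableType d) (R : realType).
Implicit Types (B Q : set X) (f g : X -> R).

(** A class that is stable under products, slices and indicators, and in
    which integrability is automatic once B has finite measure. *)
Definition bounded_supported B f :=
  [/\ measurable_fun setT f, exists C, forall x, `|f x| <= C &
  forall x, ~ B x -> f x = 0].

Lemma bs_lc B a f g : bounded_supported B f -> bounded_supported B g ->
  bounded_supported B (fun x => a * f x + g x).
Proof.
move=> [mf [C fC] fB] [mg [C' gC] gB]; split.
- by apply: measurable_funD => //; exact: measurable_funM.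
- exists (`|a| * C + C') => x; rewrite (le_trans (ler_normD _ _))// lerD//.
  by rewrite normrM ler_wpM2l.
- by move=> x Bx; rewrite fB// gB// mulr0 addr0.
Qed.

Lemma bs_mul B f g : bounded_supported B f -> measurable_fun setT g ->
  (exists C, forall x, `|g x| <= C) -> bounded_supported B (fun x => f x * g x).
Proof.
move=> [mf [C fC] fB] mg [C' gC]; split.
- exact: measurable_funM.
- by exists (C * C') => x; rewrite normrM ler_pM.
- by move=> x Bx; rewrite fB// mul0r.
Qed.

Lemma bs_mulb B f g : bounded_supported B f -> bounded_supported B g ->
  bounded_supported B (fun x => f x * g x).
Proof. by move=> Hf [mg gC _]; exact: bs_mul. Qed.

Lemma bs_sq B f : bounded_supported B f -> bounded_supported B (fun x => f x ^+ 2).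
Proof. by move=> Hf; exact: bs_mulb. Qed.

Lemma bs_indic B Q f : measurable Q -> bounded_supported B f ->
  bounded_supported B (fun x => f x * \1_Q x).
Proof.
move=> mQ Hf; apply: bs_mul => //.
by exists 1 => x; rewrite indicE ger0_norm// lern1 leq_b1.
Qed.

Lemma bs_sum B I (s : seq I) (F : I -> X -> R) : (forall i, bounded_supported B (F i)) ->
  bounded_supported B (fun x => \sum_(i <- s) F i x).
Proof.
move=> HF; elim: s => [|i s IH].
  rewrite (_ : (fun _ => _) = fun=> 0); last by apply/funext => x; rewrite big_nil.
  by split=> //; exists 0 => x; rewrite normr0.
rewrite (_ : (fun _ => _) = fun x => 1 * F i x + \sum_(j <- s) F j x).
  exact: bs_lc.
by apply/funext => x; rewrite big_cons mul1r.
Qed.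

Lemma bs_scale B a f : bounded_supported B f -> bounded_supported B (fun x => a * f x).
Proof.
move=> Hf; rewrite (_ : (fun _ => _) = fun x => (a - 1) * f x + f x).
  exact: bs_lc.
by apply/funext => x; ring.
Qed.

Context (mu : {measure set X -> \bar R}) (B : set X).
Hypotheses (mB : measurable B) (muB : (mu B < +oo)%E).

Lemma bs_integrable f : bounded_supported B f -> mu.-integrable setT (EFin \o f).
Proof.
move=> [mf [C fC] fB].
have -> : EFin \o f = (EFin \o f) \_ B.
  apply/funext => x; rewrite patchE; case: ifPn => //.
  by rewrite notin_setE => /fB; rewrite /= => ->.
apply/(integrable_mkcond _ mB)/measurable_bounded_integrable => //.
  exact: measurable_funTS.
by exists C; split; [exact: num_real|move=> y Cy x _; apply: (le_trans (fC x));
  exact: ltW].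
Qed.

Lemma Rintegral_lc a f g : bounded_supported B f -> bounded_supported B g ->
  \int[mu]_x (a * f x + g x) = a * \int[mu]_x f x + \int[mu]_x g x.
Proof.
move=> Hf Hg; rewrite RintegralD//; [|exact/bs_integrable/bs_scale|exact: bs_integrable].
by rewrite RintegralZl//; exact: bs_integrable.
Qed.

Lemma Rintegral_scale a f : bounded_supported B f ->
  \int[mu]_x (a * f x) = a * \int[mu]_x f x.
Proof. by move=> Hf; rewrite RintegralZl//; exact: bs_integrable. Qed.

Lemma Rintegral_sum I (s : seq I) (F : I -> X ->
  R) : (forall i, bounded_supported B (F i)) ->
  \int[mu]_x (\sum_(i <- s) F i x) = \sum_(i <- s) \int[mu]_x F i x.
Proof.
move=> HF; elim: s => [|i s IH].
  rewrite big_nil (_ : (fun _ => _) = fun=> 0); last first.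
    by apply/funext => x; rewrite big_nil.
  by rewrite /Rintegral integral0.
rewrite big_cons -IH -[X in X + _]mul1r -Rintegral_lc//; last exact: bs_sum.
by apply: eq_Rintegral => x _; rewrite big_cons mul1r.
Qed.

Lemma bs_le f g : bounded_supported B f -> bounded_supported B g ->
  (forall x, f x <= g x) ->
  \int[mu]_x f x <= \int[mu]_x g x.
Proof. by move=> Hf Hg fg; apply: le_Rintegral => //; exact: bs_integrable. Qed.

Lemma bs_one : bounded_supported B (\1_B : X -> R).
Proof.
split=> //; first by exists 1 => x; rewrite indicE ger0_norm// lern1 leq_b1.
by move=> x Bx; rewrite indicE memNset.
Qed.

Lemma bs_CS f g : bounded_supported B f -> bounded_supported B g ->
  (\int[mu]_x (f x * g x)) ^+ 2 <= (\int[mu]_x (f x ^+ 2)) * (\int[mu]_x (g x ^+ 2)).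
Proof.
move=> Hf Hg.
pose b (f g : X -> R) := \int[mu]_x (f x * g x).
have hb : pos_form (bounded_supported B) b.
  split=> [u v _ _|a u v w Hu Hv Hw|u Hu].
  - by apply: eq_Rintegral => x _; rewrite mulrC.
  - rewrite /b -Rintegral_lc; [|exact: bs_mulb|exact: bs_mulb].
    by apply: eq_Rintegral => x _; rewrite /lincomb; ring.
  - by apply: Rintegral_ge0 => x _; rewrite -expr2 sqr_ge0.
have := @form_CS _ _ _ _ f g (@bs_lc B) hb Hf Hg; rewrite /b.
by under [X in _ <= X * _ -> _]eq_Rintegral do rewrite -expr2;
  under [X in _ <= _ * X -> _]eq_Rintegral do rewrite -expr2.
Qed.

End bounded_vanishing.

Section fubini.
Context (R : realType) (n : nat) (M : R).
Implicit Types f : 'rV[R]_n.+1 -> R.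
Notation leb := (@lebesgue_measure R).
Notation L := (@rV_lebesgue R).

Definition centered_segment : set (measurableTypeR R) := `[- M, M]%classic.

Lemma centered_segment_lty : (leb centered_segment < +oo)%E.
Proof. by rewrite /centered_segment lebesgue_measure_itv/=; case: ifP => // _;
  rewrite -EFinD ltry. Qed.

Lemma measurable_centered_segment : measurable centered_segment.
Proof. exact: measurable_itv. Qed.

(** Slices freeze the first coordinate and fibres the other ones, following
    the recursive construction of Lebesgue measure on R^n. *)
Definition slice f (t : R) : 'rV[R]_n -> R := fun y => f (rV_cons (t, y)).
Definition fiber f (y : 'rV[R]_n) : R -> R := fun t => f (rV_cons (t, y)).

Lemma measurable_rV_consl (t : R) : measurable_fun setT (fun y : 'rV[R]_n => rV_cons (t, y)).
Proof. exact: (measurableT_comp (measurable_rV_cons (n := n)) (measurable_pair1 _)). Qed.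

Lemma bs_slice f t : bounded_supported (box M) f -> bounded_supported (box M) (slice f t).
Proof.
move=> [mf [C fC] fB]; split.
- exact: (measurableT_comp mf (measurable_rV_consl t)).
- by exists C => y; exact: fC.
- by move=> y By; apply: fB => /box_cons[].
Qed.

Lemma bs_fiber f y : bounded_supported (box M) f ->
  bounded_supported centered_segment (fiber f y).
Proof.
move=> [mf [C fC] fB]; split.
- apply: (measurableT_comp mf).
  exact: (measurableT_comp (measurable_rV_cons (n := n)) (measurable_pair2 _)).
- by exists C => t; exact: fC.
- by move=> t /= Bt; apply: fB => /box_cons[tM _]; apply: Bt;
  rewrite /centered_segment /= in_itv/= -ler_norml.
Qed.

Lemma bs_box_integrable m (f : 'rV[R]_m -> R) : bounded_supported (box M) f ->
  (L m).-integrable setT (EFin \o f).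
Proof. by apply: bs_integrable; [exact: measurable_box|exact: box_lty]. Qed.

Lemma bs_seg_integrable (f : R -> R) : bounded_supported centered_segment f ->
  leb.-integrable setT (EFin \o f).
Proof. by apply: bs_integrable; [exact: measurable_centered_segment|exact: centered_segment_lty]. Qed.

Lemma bs_prod_integrable f : bounded_supported (box M) f ->
  (leb \x L n)%E.-integrable setT (EFin \o (f \o @rV_cons R n)).
Proof.
move=> [mf [C fC] fB].
apply: (@bs_integrable _ _ _ _ (centered_segment `*` box M)).
- by apply: measurableX; [exact: measurable_centered_segment|exact: measurable_box].
- suff : ((leb \x L n) (centered_segment `*` box M) < +oo)%E by [].
  rewrite product_measure1E//; [|exact: measurable_centered_segment|exact: measurable_box].
  by rewrite lte_mul_pinfty ?box_lty// ge0_fin_numE// centered_segment_lty.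
- split; first exact: (measurableT_comp mf (measurable_rV_cons (n := n))).
    by exists C => z; exact: fC.
  move=> [t y] /= nB; apply: fB => /box_cons[tM yM]; apply: nB; split=> //=.
  by rewrite /centered_segment /= in_itv/= -ler_norml.
Qed.

Lemma integral_rV_lebesgueS f : bounded_supported (box M) f ->
  (\int[L n.+1]_x (f x)%:E = \int[(leb \x L n)]_z (f (rV_cons z))%:E)%E.
Proof.
move=> Hf; have := bs_prod_integrable Hf; have [mf _ _] := Hf.
move=> fi; rewrite -[LHS]/(\int[pushforward (leb \x L n)%E (@rV_cons R n)]_x (f x)%:E)%E.
rewrite (@integral_pushforward _ _ _ _ _ _ (measurable_rV_cons (n:=n)))//.
exact/measurable_EFinP.
Qed.

Lemma fubini_slice f : bounded_supported (box M) f ->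
  \int[L n.+1]_x f x = \int[leb]_t \int[L n]_y slice f t y.
Proof.
move=> Hf; have fi := bs_prod_integrable Hf.
rewrite /Rintegral integral_rV_lebesgueS//.
rewrite -[in LHS](integral12_prod_meas1 fi); congr fine.
apply: eq_integral => t _; rewrite fineK//; apply: integrable_fin_num => //.
exact/bs_box_integrable/bs_slice.
Qed.

Lemma fubini_fiber f : bounded_supported (box M) f ->
  \int[L n.+1]_x f x = \int[L n]_y \int[leb]_t fiber f y t.
Proof.
move=> Hf; have fi := bs_prod_integrable Hf.
rewrite /Rintegral integral_rV_lebesgueS//.
rewrite -[in LHS](integral21_prod_meas1 fi); congr fine.
apply: eq_integral => t _; rewrite fineK//; apply: integrable_fin_num => //.
exact/bs_seg_integrable/bs_fiber.
Qed.

Lemma bs_slice_int f : bounded_supported (box M) f ->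
  bounded_supported centered_segment (fun t => \int[L n]_y slice f t y).
Proof.
move=> Hf; have fi := bs_prod_integrable Hf; split.
- apply/measurable_EFinP; apply: (eq_measurable_fun _ _ (measurable_fubini_F fi)).
  move=> t _; rewrite /fubini_F /= fineK//; apply: integrable_fin_num => //.
  exact/bs_box_integrable/bs_slice.
- have [_ [C fC] _] := Hf.
  exists (C * fine (L n (box M))) => t.
  have Hs := bs_slice t Hf.
  apply: (le_trans (le_normr_Rintegral _ (bs_box_integrable Hs))) => //.
  have mB := @measurable_box R n M.
  rewrite (_ : (fun y => _) = (fun y => `|slice f t y|) \_ (box M)); last first.
    apply/funext => y; rewrite patchE; case: ifPn => //.
    by rewrite notin_setE; have [_ _ sB] := Hs; move=> /sB ->; rewrite normr0.
  rewrite -Rintegral_mkcond -Rintegral_cst//; apply: le_Rintegral => //.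
  + apply: (integrableS measurableT) => //.
    have : (L n).-integrable setT (abse \o (EFin \o slice f t)).
      by apply: integrable_abse; exact: bs_box_integrable.
    by [].
  + apply: measurable_bounded_integrable => //; first exact: box_lty.
    by exists `|C|; split; [exact: num_real|move=> z Cz x _; rewrite ltW].
  + by move=> x _; exact: fC.
- move=> t tM; rewrite (_ : slice f t = fun=> 0); first by rewrite /Rintegral integral0.
  apply/funext => y; have [_ _ fB] := Hf; apply: fB => /box_cons[h _]; apply: tM.
  by rewrite /centered_segment /= in_itv/= -ler_norml.
Qed.

Lemma bs_fiber_int f : bounded_supported (box M) f ->
  bounded_supported (box M) (fun y => \int[leb]_t fiber f y t).
Proof.
move=> Hf; have fi := bs_prod_integrable Hf; split.
- apply/measurable_EFinP; apply: (eq_measurable_fun _ _ (measurable_fubini_G fi)).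
  move=> t _; rewrite /fubini_G /= fineK//; apply: integrable_fin_num => //.
  exact/bs_seg_integrable/bs_fiber.
- have [_ [C fC] _] := Hf.
  exists (C * fine (leb centered_segment)) => y.
  have Hs := bs_fiber y Hf.
  apply: (le_trans (le_normr_Rintegral _ (bs_seg_integrable Hs))) => //.
  have mB := measurable_centered_segment.
  rewrite (_ : (fun y => _) = (fun t => `|fiber f y t|) \_ centered_segment); last first.
    apply/funext => t; rewrite patchE; case: ifPn => //.
    by rewrite notin_setE; have [_ _ sB] := Hs; move=> /sB ->; rewrite normr0.
  rewrite -Rintegral_mkcond -Rintegral_cst//; apply: le_Rintegral => //.
  + apply: (integrableS measurableT) => //.
    have : leb.-integrable setT (abse \o (EFin \o fiber f y)).
      by apply: integrable_abse; exact: bs_seg_integrable.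
    by [].
  + apply: measurable_bounded_integrable => //; first exact: centered_segment_lty.
    by exists `|C|; split; [exact: num_real|move=> z Cz x _; rewrite ltW].
  + by move=> x _; exact: fC.
- move=> y yM; rewrite (_ : fiber f y = fun=> 0); first by rewrite /Rintegral integral0.
  by apply/funext => t; have [_ _ fB] := Hf; apply: fB => /box_cons[_ h].
Qed.

End fubini.

(** * Differentiable functions in a box and integration by parts *)
Section C1_compact.
Context (R : realType).
Notation leb := (@lebesgue_measure R).
Notation L := (@rV_lebesgue R).

Definition C1box n M (f : 'rV[R]_n -> R) := [/\ continuous f,
  forall x, ~ box M x -> f x = 0,
  forall i x, derivable f x (delta_mx ord0 i : 'rV[R]_n) &
  forall i, continuous (partial i f)].

Lemma continuous_bs n M (f : 'rV[R]_n -> R) : continuous f ->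
  (forall x, ~ box M x -> f x = 0) -> bounded_supported (box M) f.
Proof.
move=> cf fB; split=> //; first exact: continuous_measurable_rV.
have [C [_ HC]] : bounded_set (f @` box M).
  apply: compact_bounded; apply: continuous_compact; last exact: compact_box.
  exact: continuous_subspaceT.
exists (`|C| + 1) => x; have [Bx|Bx] := pselect (box M x); last first.
  by rewrite fB// normr0 addr_ge0.
apply: HC; last by exists x.
by rewrite (le_lt_trans (ler_norm _))// ltrDl.
Qed.

Lemma C1box_bs n M (f : 'rV[R]_n -> R) : C1box M f -> bounded_supported (box M) f.
Proof. by move=> [cf fB _ _]; exact: continuous_bs. Qed.

(** The complement of A is open, so the function vanishes near the point. *)
Lemma partial_vanish n (A : set 'rV[R]_n) i (f : 'rV[R]_n -> R) x : closed A ->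
  (forall x, ~ A x -> f x = 0) -> ~ A x -> partial i f x = 0.
Proof.
move=> cA fA Ax; rewrite /partial (@near_eq_derive _ _ _ _ (cst 0));
  first exact: derive_cst.
have : nbhs x (~` A) by apply: open_nbhs_nbhs; split => //; rewrite openC.
by apply: filterS => y Ay; rewrite fA.
Qed.

Lemma C1box_partial_bs n M i (f : 'rV[R]_n -> R) : C1box M f ->
  bounded_supported (box M) (partial i f).
Proof.
move=> [cf fB _ cdf]; apply: continuous_bs => // x Bx.
by apply: (partial_vanish _ (@closed_box _ n M)).
Qed.

Lemma rV_cons_shift n h t j (y : 'rV[R]_n) :
  rV_cons (t, h *: delta_mx ord0 j + y) =
  h *: delta_mx ord0 (lift ord0 j) + rV_cons (t, y).
Proof.
apply/rowP => i; rewrite [RHS]mxE [X in _ = X + _]mxE.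
case: (unliftP ord0 i) => [k ->|->]; rewrite ?rV_consS ?rV_cons0 !mxE /=.
  by rewrite (inj_eq lift_inj).
by rewrite mulr0 add0r.
Qed.

Lemma rV_cons_shift0 n h t (y : 'rV[R]_n) :
  rV_cons (h + t, y) = h *: delta_mx ord0 ord0 + rV_cons (t, y).
Proof.
apply/rowP => i; rewrite [RHS]mxE [X in _ = X + _]mxE.
case: (unliftP ord0 i) => [k ->|->]; rewrite ?rV_consS ?rV_cons0 !mxE /=.
  by rewrite mulr0 add0r.
by rewrite mulr1.
Qed.

Lemma diff_quotient_eq (V W : normedModType R) (f : V -> R) (g : W -> R) a b u v :
  (forall h : R, f (h *: u + a) = g (h *: v + b)) ->
  ((fun h : R => h^-1 *: ((f \o shift a) (h *: u) - f a)) =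
   (fun h : R => h^-1 *: ((g \o shift b) (h *: v) - g b))).
Proof.
move=> fg; have := fg 0; rewrite !scale0r !add0r => fgab.
by apply/funext => h /=; rewrite fg fgab.
Qed.

(** Restricting to a slice or a fibre does not change difference quotients,
    only the space in which the increments live. *)
Lemma derive_reparam (V W : normedModType R) (f : V -> R) (g : W -> R) a b u v :
  (forall h : R, f (h *: u + a) = g (h *: v + b)) -> 'D_u f a = 'D_v g b.
Proof. by move=> /diff_quotient_eq fg; rewrite /derive fg. Qed.

Lemma derivable_reparam (V W : normedModType R) (f : V -> R) (g : W -> R) a b u v :
  (forall h : R, f (h *: u + a) = g (h *: v + b)) ->
  derivable g b v -> derivable f a u.
Proof. by move=> /diff_quotient_eq fg; rewrite /derivable fg. Qed.

Lemma continuous_rV n (T : topologicalType) (g : T -> 'rV[R]_n) :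
  (forall i, continuous (fun t => g t ord0 i)) -> continuous g.
Proof.
move=> cg t; apply/cvg_ballP => e e0.
have : \forall s \near t, forall i, ball (g t ord0 i) e (g s ord0 i).
  by apply: filter_forall => i; have /cvg_ballP/(_ _ e0) := cg i t.
by apply: filterS => s h; split=> // i j; rewrite (ord1 i).
Qed.

Lemma continuous_rV_consr n t : continuous (fun y : 'rV[R]_n => rV_cons (t, y)).
Proof.
apply: continuous_rV => i; case: (unliftP ord0 i) => [k ->|->].
  by under eq_fun do rewrite rV_consS; exact: coord_continuous.
by under eq_fun do rewrite rV_cons0; exact: cst_continuous.
Qed.

Lemma continuous_rV_consl n (y : 'rV[R]_n) : continuous (fun t : R => rV_cons (t, y)).
Proof.
apply: continuous_rV => i; case: (unliftP ord0 i) => [k ->|->].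
  by under eq_fun do rewrite rV_consS; exact: cst_continuous.
by under eq_fun do rewrite rV_cons0; move=> s; exact: cvg_id.
Qed.

Lemma partial_slice n j (f : 'rV[R]_n.+1 -> R) t :
  partial j (slice f t) = slice (partial (lift ord0 j) f) t.
Proof.
apply/funext => y; apply: derive_reparam => h.
by rewrite /slice rV_cons_shift.
Qed.

Lemma derivable_slice n j (f : 'rV[R]_n.+1 -> R) t y :
  derivable f (rV_cons (t, y)) (delta_mx ord0 (lift ord0 j)) ->
  derivable (slice f t) y (delta_mx ord0 j : 'rV[R]_n).
Proof. by apply: derivable_reparam => h; rewrite /slice rV_cons_shift. Qed.

Lemma derive_fiber n (f : 'rV[R]_n.+1 -> R) t y :
  'D_1 (fiber f y) t = fiber (partial ord0 f) y t.
Proof.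
apply: derive_reparam => h.
by rewrite /fiber [h%:A]mulr1 rV_cons_shift0.
Qed.

Lemma derivable_fiber n (f : 'rV[R]_n.+1 -> R) t y :
  derivable f (rV_cons (t, y)) (delta_mx ord0 ord0) ->
  derivable (fiber f y) t 1.
Proof.
by apply: derivable_reparam => h; rewrite /fiber [h%:A]mulr1 rV_cons_shift0.
Qed.

Lemma C1box_slice n M (f : 'rV[R]_n.+1 -> R) t : C1box M f -> C1box M (slice f t).
Proof.
move=> [cf fB df cdf]; split.
- move=> y; apply: (@continuous_comp _ _ _ (fun y => rV_cons (t, y)) f).
    exact: continuous_rV_consr.
  exact: cf.
- by move=> y By; apply: fB => /box_cons[].
- by move=> i y; exact: derivable_slice.
- move=> i; rewrite partial_slice => y.
  apply: (@continuous_comp _ _ _ (fun y => rV_cons (t, y)) (partial (lift ord0 i) f)).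
    exact: continuous_rV_consr.
  exact: cdf.
Qed.

Lemma ftc_derive (h : R -> R) a b : a < b -> (forall t, derivable h t 1) ->
  continuous ('D_1 h) -> \int[leb]_(t in `[a, b]) 'D_1 h t = h b - h a.
Proof.
move=> ab dh cdh; have ch : continuous h.
  by move=> t; apply: differentiable_continuous; exact/derivable1_diffP.
rewrite /Rintegral (@continuous_FTC2 _ _ h)//.
- exact: continuous_subspaceT.
- split=> //; [by apply: cvg_at_right_filter; exact: ch|].
  by apply: cvg_at_left_filter; exact: ch.
- by move=> t _; rewrite derive1E.
Qed.

Lemma fiber_ftc n M (f : 'rV[R]_n.+1 -> R) y a b : C1box M f -> a < b ->
  \int[leb]_(t in `[a, b]) fiber (partial ord0 f) y t = fiber f y b - fiber f y a.
Proof.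
move=> [cf fB df cdf] ab.
have DE : 'D_1 (fiber f y) = fiber (partial ord0 f) y.
  by apply/funext => t; rewrite derive_fiber.
have dh t : derivable (fiber f y) t 1 by exact: derivable_fiber.
have cdh : continuous ('D_1 (fiber f y)).
  rewrite DE => t.
  apply: (@continuous_comp _ _ _ (fun t => rV_cons (t, y)) (partial ord0 f)).
    exact: continuous_rV_consl.
  exact: cdf.
by have := ftc_derive ab dh cdh; rewrite DE.
Qed.

(** A derivative in the first direction is integrated along the fibres by
    the fundamental theorem of calculus; in another direction, it is a derivative
    of the slices, to which induction applies. *)
Lemma integral_partial n M (f : 'rV[R]_n -> R) i : 0 < M -> C1box M f ->
  \int[L n]_x partial i f x = 0.
Proof.
move=> M0; elim: n f i => [f []//|n IH f i Hf].
case: (unliftP ord0 i) => [j ->|->].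
  rewrite (fubini_slice (C1box_partial_bs _ Hf)).
  rewrite (_ : (fun t => _) = fun=> 0); first by rewrite /Rintegral integral0.
  by apply/funext => t; rewrite -partial_slice; apply: IH; exact: C1box_slice.
have Hp := C1box_partial_bs ord0 Hf.
rewrite (fubini_fiber Hp).
rewrite (_ : (fun t => _) = fun=> 0); first by rewrite /Rintegral integral0.
apply/funext => y.
have [_ _ sB] := bs_fiber y Hp.
rewrite (_ : (fun t => _) = fiber (partial ord0 f) y \_ `[- (M + 1), M + 1]); last first.
  apply/funext => t; rewrite patchE; case: ifPn => //; rewrite notin_setE => nt.
  apply: sB => tM; apply: nt; move: tM;
    rewrite /centered_segment /= !in_itv/= => /andP[? ?].
  by apply/andP; split; lra.
rewrite -Rintegral_mkcond (fiber_ftc _ Hf); last by lra.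
have [_ fB _ _] := Hf; rewrite /fiber !fB ?subrr// => /box_cons[];
  rewrite ?normrN ger0_norm; lra.
Qed.

End C1_compact.

(** * An inequality of Ehrling's type *)
Section ehrling.
Context (R : realType).
Notation leb := (@lebesgue_measure R).
Notation L := (@rV_lebesgue R).

Definition segment_from (a h : R) : set R := `[a, a + h]%classic.

Lemma leb_itv (a h : R) : 0 <= h -> leb (segment_from a h) = h%:E.
Proof.
move=> h0; rewrite /segment_from lebesgue_measure_itv/= lte_fin ltrDl.
have [h1|h1] := ltP 0 h; first by rewrite -EFinD addrAC subrr add0r.
by congr EFin; apply/eqP; rewrite eq_le h0 h1.
Qed.

Lemma indic_mkcond d (X : measurableType d) (mu : {measure set X -> \bar R}) Q
    (f : X -> R) : \int[mu]_x (f x * \1_Q x) = \int[mu]_(x in Q) f x.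
Proof.
rewrite [RHS]Rintegral_mkcond; apply: eq_Rintegral => x _.
by rewrite patchE indicE; case: (x \in Q); rewrite ?mulr1 ?mulr0.
Qed.

(** Every value of l on the interval is within r of its mean m / h, hence
    l^2 <= 2 (m / h)^2 + 2 r^2 there. *)
Lemma osc_interval M (l : R -> R) a h r : bounded_supported (centered_segment M) l ->
  0 < h ->
  (forall t s, `|t - s| <= h -> `|l t - l s| <= r) ->
  \int[leb]_t (l t ^+ 2 * \1_(segment_from a h) t) <=
     2 / h * (\int[leb]_t (l t * \1_(segment_from a h) t)) ^+ 2
     + 2 * h * r ^+ 2.
Proof.
move=> Hl h0 lr; rewrite !indic_mkcond; set I := segment_from a h.
have mI : measurable (I : set (measurableTypeR R)) by exact: measurable_itv.
have muI : leb I = h%:E by apply: leb_itv; exact: ltW.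
have muIy : (leb I < +oo)%E by rewrite muI ltry.
have il : leb.-integrable I (EFin \o l).
  by apply: (integrableS measurableT) => //; exact: bs_seg_integrable Hl.
have il2 : leb.-integrable I (EFin \o (fun t => l t ^+ 2)).
  by apply: (integrableS measurableT) => //; exact: bs_seg_integrable (bs_sq Hl).
have ic c : leb.-integrable I (EFin \o (fun=> c)).
  apply: measurable_bounded_integrable => //.
  by exists `|c|; split; [exact: num_real|move=> z cz x _; rewrite ltW].
have intc c : \int[leb]_(t in I) c = c * h.
  by rewrite -[h]/(fine h%:E) -muI Rintegral_cst.
set m := \int[leb]_(t in I) l t.
have lm t : I t -> l t ^+ 2 <= 2 * (m / h) ^+ 2 + 2 * r ^+ 2.
  rewrite /I /segment_from /= in_itv/= => /andP[at_ th].
  have b s : I s -> l t - r <= l s <= l t + r.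
    rewrite /I /segment_from /= in_itv/= => /andP[as_ sh].
    have : `|l t - l s| <= r by apply: lr; rewrite ler_norml; apply/andP; split; lra.
    by rewrite ler_norml => /andP[? ?]; apply/andP; split; lra.
  have m1 : (l t - r) * h <= m.
    by rewrite -intc; apply: le_Rintegral => // s /b/andP[].
  have m2 : m <= (l t + r) * h.
    by rewrite -intc; apply: le_Rintegral => // s /b/andP[].
  rewrite -ler_pdivlMr// in m1; rewrite -ler_pdivrMr// in m2.
  move: (m / h) m1 m2 => x x1 x2.
  have r0 : 0 <= r by lra.
  have : 0 <= (r - (l t - x)) * (r + (l t - x)) by rewrite mulr_ge0; lra.
  have := sqr_ge0 (2 * x - l t).
  by rewrite !expr2 => ? ?; nra.
have -> : 2 / h * m ^+ 2 + 2 * h * r ^+ 2 = (2 * (m / h) ^+ 2 + 2 * r ^+ 2) * h.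
  by field; rewrite gt_eqF.
by rewrite -intc; apply: le_Rintegral.
Qed.

(** A function that is Hoelder continuous of exponent 1/2 oscillates by at
    most the square root of D h on each of the K intervals of length h, so its L^2
    norm is controlled by its means over them, up to an error proportional to h. *)
Lemma holder_step M (l : R -> R) D (K : nat) : 0 < M ->
  bounded_supported (centered_segment M) l ->
  (0 < K)%N -> (forall t s, (l t - l s) ^+ 2 <= D * `|t - s|) ->
  \int[leb]_t (l t ^+ 2) <= 4 * M * (2 * M / K%:R) * D +
     2 / (2 * M / K%:R) * \sum_(k < K)
       (\int[leb]_t (l t * \1_(segment_from (- M +
         k%:R * (2 * M / K%:R)) (2 * M / K%:R)) t)) ^+ 2.
Proof.
move=> M0 Hl K0 lD; set h := 2 * M / K%:R.
pose I (k : 'I_K) := segment_from (- M + k%:R * h) h.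
have K0' : 0 < K%:R :> R by rewrite ltr0n.
have h0 : 0 < h by rewrite !divr_gt0 ?mulr_gt0.
have D0 : 0 <= D.
  by have := lD 1 0; rewrite subr0 normr1 mulr1; apply: le_trans; exact: sqr_ge0.
pose r := Num.sqrt (D * h).
have r2 : r ^+ 2 = D * h by rewrite sqr_sqrtr// mulr_ge0// ltW.
have lr t s : `|t - s| <= h -> `|l t - l s| <= r.
  move=> ts; rewrite -(@ler_pXn2r _ 2) ?nnegrE ?sqrtr_ge0// real_normK ?num_real//.
  by rewrite r2; apply: le_trans (lD t s) _; rewrite ler_wpM2l.
have mI k : measurable (I k : set (measurableTypeR R)) by exact: measurable_itv.
have Hk k : bounded_supported (centered_segment M) (fun t => l t ^+ 2 * \1_(I k) t).
  by apply: bs_indic => //; exact: bs_sq.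
apply: (@le_trans _ _ (\int[leb]_t (\sum_k (l t ^+ 2 * \1_(I k) t)))).
  apply: (bs_le (measurable_centered_segment M) (centered_segment_lty M) (bs_sq Hl));
    first exact: bs_sum.
  move=> t; rewrite -mulr_sumr.
  have [tM|tM] := pselect (centered_segment M t); last first.
    by have [_ _ ->//] := Hl; rewrite expr0n mul0r.
  rewrite -[leLHS]mulr1 ler_wpM2l ?sqr_ge0//.
  move: tM; rewrite /centered_segment/= in_itv/= => /andP[t1 t2].
  suff [k Ik] : exists k, I k t.
    by rewrite (bigD1 k)//= indicE mem_set// lerDl sumr_ge0.
  pose x := (t + M) / h.
  have x0 : 0 <= x by rewrite divr_ge0 ?(ltW h0)//; lra.
  have tx : t = - M + x * h by rewrite /x divfK ?gt_eqF//; lra.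
  have xK : x <= K%:R.
    rewrite /x ler_pdivrMr// /h mulrCA divff ?gt_eqF// mulr1; lra.
  have /andP[n1 n2] := truncn_itv x0; set n := Num.truncn x in n1 n2.
  have [nK|nK] := ltnP n K.
    exists (Ordinal nK); rewrite /I /segment_from /= in_itv/= tx; apply/andP; split.
      by rewrite lerD2l ler_wpM2r// ltW.
    by rewrite -addrA lerD2l -[X in _ + X]mul1r -mulrDl ler_wpM2r ?(ltW h0)// natr1 ltW.
  have xE : x = K%:R.
    by apply/eqP; rewrite eq_le xK/= (le_trans _ n1)// ler_nat.
  have pK : (K.-1 < K)%N by rewrite prednK.
  exists (Ordinal pK); rewrite /I /segment_from /= in_itv/= tx xE; apply/andP; split.
    by rewrite lerD2l ler_wpM2r ?(ltW h0)// ler_nat leq_pred.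
  by rewrite -addrA lerD2l -[X in _ + X]mul1r -mulrDl natr1 prednK.
rewrite (Rintegral_sum (measurable_centered_segment M) (centered_segment_lty M))//.
apply: (@le_trans _ _ (\sum_(k < K) (2 / h * (\int[leb]_t (l t * \1_(I k) t)) ^+ 2
     + 2 * h * r ^+ 2))).
  by apply: ler_sum => k _; exact: osc_interval Hl h0 lr.
rewrite big_split/= sumr_const card_ord -mulr_sumr addrC lerD2r.
rewrite r2 -[leLHS]mulr_natr.
rewrite le_eqVlt; apply/orP; left; apply/eqP.
by rewrite /h; field; rewrite gt_eqF.
Qed.

End ehrling.

Section ehrling_rV.
Context (R : realType).
Notation leb := (@lebesgue_measure R).
Notation L := (@rV_lebesgue R).

Definition cylinder n (I : set R) (Q : set 'rV[R]_n) : set 'rV[R]_n.+1 :=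
  [set x | I (x ord0 ord0) /\ Q (\row_j x ord0 (lift ord0 j))].

Lemma measurable_cylinder n (I : set (measurableTypeR R)) (Q : set 'rV[R]_n) :
  measurable I -> measurable Q -> measurable (cylinder I Q).
Proof.
move=> mI mQ.
have -> : cylinder I Q = (@rV_coord R n.+1 ord0 @^-1` I) `&`
    ((fun x : 'rV[R]_n.+1 => \row_j x ord0 (lift ord0 j)) @^-1` Q) by [].
apply: measurableI.
  by rewrite -[X in measurable X]setTI; exact: measurable_rV_coord.
rewrite -[X in measurable X]setTI; apply: measurable_fun_rV => // i.
rewrite (_ : (fun _ => _) = @rV_coord R n.+1 (lift ord0 i)).
  exact: measurable_rV_coord.
by apply/funext => x /=; rewrite mxE.
Qed.

Lemma indic_cylinder n (I : set R) (Q : set 'rV[R]_n) t y :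
  \1_(cylinder I Q) (rV_cons (t, y)) = \1_I t * \1_Q y :> R.
Proof.
rewrite !indicE -natrM mulnb; congr (_ : bool)%:R.
have yE : \row_j rV_cons (t, y) ord0 (lift ord0 j) = y.
  by apply/rowP => j; rewrite mxE rV_consS.
apply/idP/andP => [/set_mem[]|[/set_mem It /set_mem Qy]].
  by rewrite rV_cons0 yE => It Qy; rewrite !mem_set.
by apply/mem_set; split; rewrite ?rV_cons0 ?yE.
Qed.

(** The increment of f along a fibre is the integral of the first partial
    derivative, to which the Cauchy-Schwarz inequality is applied. *)
Lemma fiber_osc n M (f : 'rV[R]_n.+1 -> R) y t s : C1box M f ->
  (fiber f y t - fiber f y s) ^+ 2 <=
  `|t - s| * \int[leb]_r (fiber (partial ord0 f) y r ^+ 2).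
Proof.
move=> Hf.
have Hp := bs_fiber y (C1box_partial_bs ord0 Hf).
set g := fiber (partial ord0 f) y in Hp *.
wlog ts : t s / t < s.
  move=> H; have [ts|st|->] := ltgtP t s; first exact: H.
    by rewrite distrC -[X in X ^+ 2]opprB sqrrN; exact: H.
  by rewrite !subrr expr0n normr0 mul0r.
rewrite -[X in X ^+ 2]opprB sqrrN -(fiber_ftc _ Hf ts) -/g -indic_mkcond.
have mI : measurable (`[t, s]%classic : set (measurableTypeR R)) by exact: measurable_itv.
have muI : leb (`[t, s]%classic : set R) = (s - t)%:E.
  by rewrite lebesgue_measure_itv/= lte_fin ts EFinB.
have H1 : bounded_supported (centered_segment M `|` `[t, s]%classic) g.
  by case: Hp => mg Cg gB; split=> // x nx; apply: gB => xM; apply: nx; left.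
have H2 : bounded_supported (centered_segment M `|` `[t, s]%classic) (\1_(`[t, s]%classic) : R -> R).
  split; first exact: measurable_indic.
    by exists 1 => x; rewrite indicE ger0_norm// lern1 leq_b1.
  by move=> x nx; rewrite indicE memNset// => xI; apply: nx; right.
have mU : measurable (centered_segment M `|` `[t, s]%classic : set (measurableTypeR R)).
  by apply: measurableU => //; exact: measurable_centered_segment.
have muU : (leb (centered_segment M `|` `[t, s]%classic) < +oo)%E.
  apply: (le_lt_trans (measureU2 _ _ _)) => //; first exact: measurable_centered_segment.
  by rewrite lte_add_pinfty ?centered_segment_lty// [X in (X < _)%E]muI ltry.
apply: (le_trans (bs_CS mU muU H1 H2)).
rewrite mulrC le_eqVlt; apply/orP; left; apply/eqP; congr (_ * _).
rewrite (_ : (fun x => _) = fun x => 1 * \1_(`[t, s]%classic) x); last first.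
  by apply/funext => x; rewrite indicE mul1r; case: (x \in _); rewrite ?expr1n ?expr0n.
rewrite indic_mkcond Rintegral_cst// mul1r.
rewrite distrC gtr0_norm ?subr_gt0//.
by rewrite -[RHS]/(fine (s - t)%:E) -muI.
Qed.

(** By induction on n.  The inequality for the slices f_t, integrated over t,
    leaves the squares of the integrals l_j(t) of f_t over Q_j.  By [fiber_osc] each
    l_j is Hoelder continuous of exponent 1/2, with a constant proportional to the
    integral of the square of the first partial derivative, so [holder_step]
    replaces l_j by its means over K intervals, that is by integrals of f over
    cylinders.  The Q_j do not depend on f, so K can be taken large enough for the
    error to be at most eps. *)
Theorem ehrling n (M eps : R) : 0 < M -> 0 < eps ->
  exists (J : finType) (Q : J -> set 'rV[R]_n) (c : R),
  [/\ 0 <= c, forall j, measurable (Q j) &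
   forall f, C1box M f -> \int[L n]_x (f x ^+ 2) <=
     eps * \sum_i \int[L n]_x (partial i f x ^+ 2) +
     c * \sum_j (\int[L n]_x (f x * \1_(Q j) x)) ^+ 2].
Proof.
move=> M0 e0; elim: n => [|n [J [Q [c [c0 mQ IH]]]]].
  exists unit, (fun=> setT), 1; split=> // f Hf.
  rewrite big_ord0 mulr0 add0r mul1r (big_pred1 tt)//.
  have int0 (g : 'rV[R]_0 -> R) : bounded_supported (box M) g -> \int[L 0]_x g x = g 0.
    move=> [mg _ _]; rewrite /Rintegral /= integral_dirac//.
      by rewrite diracT mul1e.
    exact/measurable_EFinP.
  have Hb := C1box_bs Hf.
  by rewrite (int0 _ (bs_sq Hb)) (int0 _ (bs_indic measurableT Hb)) indicT mulr1.
pose V := fine (L n (box M)).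
have V0 : 0 <= V by rewrite fine_ge0.
pose N := #|J|.
pose K := (Num.truncn (4 * M * (2 * M) * V * c * N%:R / eps)).+1.
pose h := 2 * M / K%:R.
have K0 : 0 < K%:R :> R by [].
have h0 : 0 < h by rewrite !divr_gt0 ?mulr_gt0.
have Kh : c * (N%:R * (4 * M * h * V)) <= eps.
  have : 4 * M * (2 * M) * V * c * N%:R / eps < K%:R by exact: truncnS_gt.
  rewrite ltr_pdivrMr// => /ltW H.
  rewrite (_ : c * _ = 4 * M * (2 * M) * V * c * N%:R / K%:R); last first.
    by rewrite /h; field; rewrite gt_eqF.
  by rewrite ler_pdivrMr// [leRHS]mulrC.
pose I (k : 'I_K) := segment_from (- M + k%:R * h) h.
have mI k : measurable (I k : set (measurableTypeR R)) by exact: measurable_itv.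
exists (J * 'I_K)%type, (fun p => cylinder (I p.2) (Q p.1)), (c * (2 / h)); split.
- by rewrite mulr_ge0// divr_ge0// ltW.
- by move=> p; apply: measurable_cylinder => //; exact: mI.
move=> f Hf.
have Hb := C1box_bs Hf.
pose l j t := \int[L n]_y (slice f t y * \1_(Q j) y).
pose G := \int[L n.+1]_x (partial ord0 f x ^+ 2).
have mB := @measurable_box R n M.
have muB := @box_lty R n M.
pose fQ j x := f x * \1_(cylinder setT (Q j)) x.
have HfQ j : bounded_supported (box M) (fQ j) by apply: bs_indic => //;
  exact: measurable_cylinder.
have slQ j t : slice (fQ j) t = fun y => slice f t y * \1_(Q j) y.
  by apply/funext => y; rewrite /slice /fQ indic_cylinder indicT mul1r.
have Hl j : bounded_supported (centered_segment M) (l j).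
  by have := bs_slice_int (HfQ j); under eq_fun do rewrite slQ.
have Hs t : bounded_supported (box M) (slice f t) by exact: bs_slice.
have lG j t s : (l j t - l j s) ^+ 2 <= V * G * `|t - s|.
  (* Cauchy-Schwarz in y, then the increments along the fibres *)
  pose u y := -1 * slice f s y + slice f t y.
  have Hu : bounded_supported (box M) u by exact: bs_lc.
  have -> : l j t - l j s = \int[L n]_y (u y * \1_(box M `&` Q j) y).
    rewrite /l addrC -mulN1r -(Rintegral_lc mB muB); [|exact: bs_indic..].
    apply: eq_Rintegral => y _; rewrite indicI /=.
    have [By|nBy] := pselect (box M y).
      by rewrite [X in X * \1_(Q j) y]indicE mem_set// mul1r /u; ring.
    by have [_ _ sB] := Hs s; have [_ _ tB] := Hs t; rewrite /u sB// tB//; ring.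
  have HBQ : bounded_supported (box M) (\1_(box M `&` Q j) : 'rV[R]_n -> R).
    split; first by apply: measurable_indic; exact: measurableI.
      by exists 1 => x; rewrite indicE ger0_norm// lern1 leq_b1.
    by move=> x nx; rewrite indicE memNset// => -[].
  apply: (le_trans (bs_CS mB muB Hu HBQ)).
  rewrite mulrC -mulrA; apply: ler_pM.
  - by apply: Rintegral_ge0 => x _; exact: sqr_ge0.
  - by apply: Rintegral_ge0 => x _; exact: sqr_ge0.
  - apply: (@le_trans _ _ (\int[L n]_x (1 * \1_(box M) x))).
      apply: (bs_le mB muB (bs_sq HBQ)); first exact/bs_scale/bs_one.
      move=> x; rewrite !indicE in_setI; case: (x \in box M) => /=;
        last by rewrite expr0n mul1r.
      by case: (x \in _); rewrite ?expr1n ?expr0n ?mul1r.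
    by rewrite indic_mkcond Rintegral_cst// mul1r.
  - rewrite /G (fubini_fiber (bs_sq (C1box_partial_bs _ Hf))) mulrC.
    have Hfi := bs_fiber_int (bs_sq (C1box_partial_bs ord0 Hf)).
    rewrite -(Rintegral_scale mB muB)//.
    apply: (bs_le mB muB (bs_sq Hu)); first exact: bs_scale.
    move=> y; rewrite /u mulN1r addrC; exact: (fiber_osc y t s Hf).
rewrite (fubini_slice (bs_sq Hb)).
have mS := measurable_centered_segment M. have muS := centered_segment_lty M.
have Hpi j : bounded_supported (centered_segment M) (fun t => \int[L n]_y slice (fun x => partial (lift ord0 j) f x ^+ 2) t y).
  by apply: bs_slice_int; apply: bs_sq; exact: C1box_partial_bs.
have Hl2 j : bounded_supported (centered_segment M) (fun t => l j t ^+ 2) by exact: bs_sq.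
pose rhs t := eps * (\sum_j \int[L n]_y slice (fun x => partial (lift ord0 j) f x ^+
  2) t y) +
   c * \sum_j (l j t) ^+ 2.
have Hr1 : bounded_supported (centered_segment M) (fun t => \sum_j \int[L n]_y slice (fun x => partial (lift ord0 j) f x ^+ 2) t y).
  exact: bs_sum.
have Hr2 : bounded_supported (centered_segment M) (fun t => c * \sum_j (l j t) ^+
  2) by apply: bs_scale; exact: bs_sum.
apply: (@le_trans _ _ (\int[leb]_t rhs t)).
  apply: (bs_le mS muS).
  - exact: (bs_slice_int (bs_sq Hb)).
  - exact: bs_lc.
  move=> t; apply: (le_trans (IH _ (C1box_slice t Hf))).
  apply: lerD; last exact: lexx.
  apply: ler_wpM2l; first exact: ltW.
  by apply: ler_sum => j _; rewrite partial_slice.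
rewrite /rhs (Rintegral_lc mS muS)// (Rintegral_scale mS muS); last exact: bs_sum.
rewrite !(Rintegral_sum mS muS)//.
under [X in eps * X + _ <= _]eq_bigr do
  rewrite -(fubini_slice (bs_sq (C1box_partial_bs _ Hf))).
rewrite [X in _ <= eps * X + _]big_ord_recl -/G.
have hk j : \int[leb]_t (l j t) ^+ 2 <= 4 * M * h * (V * G) +
    2 / h * \sum_k (\int[leb]_t (l j t * \1_(I k) t)) ^+ 2.
  exact: (holder_step M0 (Hl j) _ (lG j)).
have key j k : \int[leb]_t (l j t * \1_(I k) t) =
    \int[L n.+1]_x (f x * \1_(cylinder (I k) (Q j)) x).
  rewrite (fubini_slice (M := M)); last first.
    by apply: bs_indic => //; exact: measurable_cylinder.
  apply: eq_Rintegral => t _; rewrite /l mulrC -(Rintegral_scale mB muB);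
    last exact: bs_indic.
  by apply: eq_Rintegral => y _; rewrite /slice indic_cylinder; ring.
apply: (@le_trans _ _ (eps * \sum_(i < n) \int[L n.+1]_x (partial (lift ord0 i) f x ^+
  2) +
   c * \sum_j (4 * M * h * (V * G) +
    2 / h * \sum_k (\int[leb]_t (l j t * \1_(I k) t)) ^+ 2))).
  by rewrite lerD2l ler_wpM2l// ler_sum.
rewrite big_split/= sumr_const -mulr_sumr.
rewrite pair_big/= (eq_bigr (fun p => (\int[L n.+1]_x (f x * \1_(cylinder (I p.2) (Q p.1)) x)) ^+ 2)); last first.
  by move=> p _; rewrite key.
set T := (X in eps * X + c * _ <= _); set S := (X in _ <= _ + _ * X).
have G0 : 0 <= G by apply: Rintegral_ge0 => x _; exact: sqr_ge0.
have : c * (N%:R * (4 * M * h * V)) * G <= eps * G by rewrite ler_wpM2r.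
rewrite -/N -[4 * M * h * (V * G) *+ N]mulr_natr => HG.
set S' := (X in eps * T + c * (_ + _ * X) <= _).
have -> : S' = S by [].
have -> : eps * (G + T) + c * (2 / h) * S = eps * G + eps * T + c * (2 / h) * S by ring.
have -> : eps * T + c * (4 * M * h * (V * G) * N%:R + 2 / h * S) =
  c * (N%:R * (4 * M * h * V)) * G + eps * T + c * (2 / h) * S by ring.
by rewrite !lerD2r.
Qed.

End ehrling_rV.

(** * Smooth functions and test functions *)
Section smooth_calculus.
Context (R : realType) (n : nat).
Implicit Types (f g : 'rV[R]_n -> R) (A : set 'rV[R]_n).
Notation e i := (delta_mx ord0 i : 'rV[R]_n).

Lemma partialM i f g x : derivable f x (e i) -> derivable g x (e i) ->
  partial i (fun x => f x * g x) x = f x * partial i g x + g x * partial i f x.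
Proof. by move=> df dg; rewrite /partial -[LHS]/('D_(e i) (f * g) x) deriveM. Qed.

Lemma derivable_mul i f g x : derivable f x (e i) -> derivable g x (e i) ->
  derivable (fun x => f x * g x) x (e i).
Proof. by move=> df dg; exact: derivableM. Qed.

Lemma partial_lc i a f g x : derivable f x (e i) -> derivable g x (e i) ->
  partial i (lincomb a f g) x = a * partial i f x + partial i g x.
Proof.
move=> df dg; have da : derivable (a \*: (f : _ -> R^o)) x (e i) by exact: derivableZ.
by rewrite /partial -[LHS]/('D_(e i) (a \*: (f : _ -> R^o) +
  g) x) (deriveD da dg) (deriveZ _ df).
Qed.

Lemma derivable_lc i a f g x : derivable f x (e i) -> derivable g x (e i) ->
  derivable (lincomb a f g) x (e i).
Proof.
move=> df dg; have da : derivable (a \*: (f : _ -> R^o)) x (e i) by exact: derivableZ.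
exact: (derivableD da dg).
Qed.

Lemma continuous_lc a f g : continuous f -> continuous g -> continuous (lincomb a f g).
Proof.
by move=> cf cg x; exact: (cvgD (cvgM (cvg_cst a) (cf x)) (cg x)).
Qed.

Lemma CkS k f : Ck k.+1 f -> Ck k f.
Proof.
elim: k f => [|k IH] f; first by case.
by move=> [cf df pf]; split=> // i; apply: IH; exact: pf.
Qed.

Lemma Ck_lc k a f g : Ck k f -> Ck k g -> Ck k (lincomb a f g).
Proof.
elim: k f g => [|k IH] f g; first exact: continuous_lc.
move=> [cf df pf] [cg dg pg]; split.
- exact: continuous_lc.
- by move=> i x; exact: (derivable_lc (df i x) (dg i x)).
- move=> i; rewrite (_ : partial i _ = lincomb a (partial i f) (partial i g)).
    by apply: IH; [exact: pf|exact: pg].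
  by apply/funext => x; exact: (partial_lc a (df i x) (dg i x)).
Qed.

Lemma Ck_mul k f g : Ck k f -> Ck k g -> Ck k (fun x => f x * g x).
Proof.
elim: k f g => [|k IH] f g; first by move=> cf cg x; exact: (cvgM (cf x) (cg x)).
move=> Hf Hg; have [cf df pf] := Hf; have [cg dg pg] := Hg; split.
- by move=> x; exact: (cvgM (cf x) (cg x)).
- by move=> i x; exact: (derivable_mul (df i x) (dg i x)).
- move=> i; rewrite (_ : partial i _ = lincomb 1 (fun x => f x * partial i g x)
    (fun x => g x * partial i f x)).
    by apply: Ck_lc; apply: IH; [exact: CkS Hf|exact: pg|exact: CkS Hg|exact: pf].
  by apply/funext => x; rewrite (partialM (df i x) (dg i x)) /lincomb mul1r.
Qed.

Lemma partial_cst (i : 'I_n) (c : R) : partial i (fun=> c) = fun=> 0.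
Proof. by apply/funext => x; exact: derive_cst. Qed.

Lemma smooth_cst (c : R) : smooth ((fun=> c) : 'rV[R]_n -> R).
Proof.
move=> k; elim: k c => [|k IH] c; first exact: cst_continuous.
split; [exact: cst_continuous|by move=> i x; exact: derivable_cst|].
by move=> i; rewrite partial_cst; exact: IH.
Qed.

Lemma is_derive_coord (i j : 'I_n) x : is_derive x (e i) (fun y : 'rV[R]_n => y ord0 j) (i == j)%:R.
Proof.
have E : (fun h : R => h^-1 *: (((fun y : 'rV[R]_n => y ord0 j) \o shift x) (h *: e i) - x ord0 j))
    @ 0^' --> ((i == j)%:R : R).
  apply: cvg_near_cst; near=> h.
  rewrite /= !mxE eqxx addrK /= eq_sym -[_ *: _]/(h^-1 * (h * _)) mulrA mulVf ?mul1r//.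
  by near: h; exact: nbhs_dnbhs_neq.
split; first by apply/cvg_ex; eexists; exact: E.
exact: (cvg_lim _ E).
Unshelve. all: by end_near. Qed.

Lemma derivable_coord (i j : 'I_n) x : derivable (fun y : 'rV[R]_n => y ord0 j) x (e i).
Proof. by have [] := is_derive_coord i j x. Qed.

Lemma partial_coord (i j : 'I_n) x : partial i (fun y : 'rV[R]_n => y ord0 j) x = (i == j)%:R.
Proof. by have [_] := is_derive_coord i j x. Qed.

Lemma smooth_coord (j : 'I_n) : smooth (fun y : 'rV[R]_n => y ord0 j).
Proof.
case=> [|k]; first exact: coord_continuous.
split; [exact: coord_continuous|by move=> i x; exact: derivable_coord|].
move=> i; rewrite (_ : partial i _ = fun=> (i == j)%:R); first exact: smooth_cst.
by apply/funext => x; rewrite partial_coord.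
Qed.

Lemma smooth_lc a f g : smooth f -> smooth g -> smooth (lincomb a f g).
Proof. by move=> sf sg k; exact: Ck_lc. Qed.

Lemma smooth_mul f g : smooth f -> smooth g -> smooth (fun x => f x * g x).
Proof. by move=> sf sg k; exact: Ck_mul. Qed.

Lemma smooth_partial i f : smooth f -> smooth (partial i f).
Proof. by move=> sf k; have [_ _ pf] := sf k.+1; exact: pf. Qed.

Lemma smooth_continuous f : smooth f -> continuous f.
Proof. by move=> sf; exact: (sf 0%N). Qed.

Lemma smooth_derivable f i x : smooth f -> derivable f x (e i).
Proof. by move=> /(_ 1%N)[_ df _]; exact: df. Qed.

Lemma supp_closed f : closed (supp f).
Proof. exact: closed_closure. Qed.

Lemma notin_supp f x : ~ supp f x -> f x = 0.
Proof.
by move=> nx; apply/eqP; apply: contrapT => /negP fx; apply: nx; exact: subset_closure.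
Qed.

Lemma supp_sub f A : closed A -> (forall x, ~ A x -> f x = 0) -> supp f `<=` A.
Proof.
move=> cA fA; rewrite [X in _ `<=` X](closure_id A).1//; apply: closure_subset => x /= fx.
by apply: contrapT => /fA f0; move: fx; rewrite f0 eqxx.
Qed.

(** Any compact set outside which f vanishes may serve to check that f is
    a test function; this avoids computing supports. *)
Lemma test_sub Omega f A : smooth f -> compact A -> closed A -> A `<=` Omega ->
  (forall x, ~ A x -> f x = 0) -> test_function Omega f.
Proof.
move=> sf cA clA AO fA; have sA := supp_sub clA fA; split=> //.
  exact: (subclosed_compact (@supp_closed f) cA sA).
exact: (subset_trans sA AO).
Qed.

Lemma test_lc Omega : lin_closed (@test_function R n Omega).
Proof.
move=> a f g [sf cf fO] [sg cg gO].
apply: (@test_sub _ _ (supp f `|` supp g)).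
- exact: smooth_lc.
- exact: compactU.
- by apply: closedU; exact: supp_closed.
- by move=> x [/fO|/gO].
- move=> x nx; rewrite /lincomb !notin_supp ?mulr0 ?addr0// => sx; apply: nx;
  [by right|by left].
Qed.

Lemma test_mul Omega f g : smooth f -> test_function Omega g ->
  test_function Omega (fun x => f x * g x).
Proof.
move=> sf [sg cg gO]; apply: (@test_sub _ _ (supp g)) => //.
- exact: smooth_mul.
- exact: supp_closed.
- by move=> x nx; rewrite (notin_supp nx) mulr0.
Qed.

Lemma test_mulr Omega f g : test_function Omega f -> smooth g ->
  test_function Omega (fun x => f x * g x).
Proof.
move=> tf sg; rewrite (_ : (fun _ => _) = fun x => g x * f x); first exact: test_mul.
by apply/funext => x; rewrite mulrC.
Qed.

Lemma test_partial Omega i f : test_function Omega f ->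
  test_function Omega (partial i f).
Proof.
move=> [sf cf fO]; apply: (@test_sub _ _ (supp f)) => //.
- exact: smooth_partial.
- exact: supp_closed.
- by move=> x; apply: partial_vanish; [exact: supp_closed|exact: notin_supp].
Qed.

Lemma test_smooth Omega f : test_function Omega f -> smooth f.
Proof. by case. Qed.

Lemma test_out Omega f x : test_function Omega f -> ~ Omega x -> f x = 0.
Proof. by move=> [_ _ fO] nx; apply: notin_supp => /fO. Qed.

End smooth_calculus.

(** * Powers of the height and the orthonormal frame *)
Section inverse_height.
Context (R : realType) (n : nat).
Notation N := n.+1.
Implicit Types (f F : 'rV[R]_N -> R) (Omega : set 'rV[R]_N).
Notation e i := (delta_mx ord0 i : 'rV[R]_N).

Lemma partialV i f x : derivable f x (e i) -> f x != 0 ->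
  derivable (fun y => (f y)^-1) x (e i) /\
  partial i (fun y => (f y)^-1) x = - (f x) ^- 2 * partial i f x.
Proof.
move=> df fx; split; first exact: (derivableV fx df).
by rewrite /partial -[LHS]/('D_(e i) (fun y => (f y)^-1) x) (deriveV fx df).
Qed.

Definition last_delta (i : 'I_N) : R := (i == ord_max)%:R.

Lemma height_coord : @height R n = fun y => y ord0 ord_max.
Proof. by []. Qed.

Lemma smooth_height : smooth (@height R n).
Proof. exact: smooth_coord. Qed.

Lemma smooth_hpow m : smooth (fun y : 'rV[R]_N => height y ^+ m).
Proof.
elim: m => [|m IH]; first by under eq_fun do rewrite expr0; exact: smooth_cst.
under eq_fun do rewrite exprS; apply: smooth_mul => //; exact: smooth_height.
Qed.

Lemma partial_hpow i m x :
  partial i (fun y : 'rV[R]_N => height y ^+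
    m.+1) x = m.+1%:R * last_delta i * height x ^+ m.
Proof.
elim: m => [|m IH].
  under eq_fun do rewrite expr1.
  by rewrite height_coord partial_coord expr0 mulr1 mul1r.
under eq_fun do rewrite exprS.
rewrite partialM; [|exact: (smooth_derivable smooth_height)|
  exact: (smooth_derivable (smooth_hpow _))].
rewrite IH {2}height_coord partial_coord -/(last_delta i).
by rewrite -[m.+2%:R]natr1 exprS; ring.
Qed.

Lemma hinv_derive i m x : height x != 0 ->
  derivable (fun y : 'rV[R]_N => height y ^- m) x (e i) /\
  partial i (fun y : 'rV[R]_N => height y ^- m) x =
    - (m%:R * last_delta i) * height x ^- m.+1.
Proof.
move=> hx; case: m => [|m].
  under eq_fun do rewrite expr0 invr1.
  by split; [exact: (smooth_derivable (@smooth_cst _ _ _))|rewrite partial_cst !mul0r oppr0 mul0r].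
have hm : height x ^+ m.+1 != 0 by rewrite expf_neq0.
have dh : derivable (fun y : 'rV[R]_N => height y ^+ m.+1) x (e i).
  exact: (smooth_derivable (@smooth_hpow m.+1)).
have [d1 ->] := partialV dh hm.
split=> //; rewrite partial_hpow !exprS; field.
by rewrite expf_neq0.
Qed.

Section test_over_height.
Context (Omega : set 'rV[R]_N).
Hypothesis Ohalf : Omega `<=` @half_space R n.

(** A test function divided by a power of the height is smooth although
    the height vanishes on the boundary of the half-space: either the height is
    not zero, or the test function vanishes nearby. *)
Lemma test_cases F x : test_function Omega F -> height x != 0 \/ ~ supp F x.
Proof.
move=> [_ _ FO]; have [sx|sx] := pselect (supp F x); [left|by right].
by rewrite gt_eqF//; exact: (Ohalf (FO _ sx)).
Qed.

Lemma near_notin_supp F x : ~ supp F x -> \forall y \near x, F y = 0.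
Proof.
move=> sx; have : nbhs x (~` supp F).
  by apply: open_nbhs_nbhs; split=> //; rewrite openC; exact: supp_closed.
by apply: filterS => y; exact: notin_supp.
Qed.

Lemma continuous_test_hinv F m : test_function Omega F ->
  continuous (fun y => F y * height y ^- m).
Proof.
move=> tF x; have [hx|sx] := test_cases x tF.
  have cF : continuous F by apply: smooth_continuous; exact: test_smooth tF.
  have ch : continuous (fun y : 'rV[R]_N => height y ^+ m).
    exact: (smooth_continuous (smooth_hpow m)).
  exact: (cvgM (cF x) (cvgV (expf_neq0 m hx) (ch x))).
apply: (@cvg_near_cst _ _ _ _ (nbhs (x : 'rV[R]_N))); near=> y.
have Fy : F y = 0 by near: y; exact: near_notin_supp.
by rewrite Fy (notin_supp sx) !mul0r.
Unshelve. all: by end_near. Qed.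

Lemma partial_test_hinv F i m x : test_function Omega F ->
  derivable (fun y => F y * height y ^- m) x (e i) /\
  partial i (fun y => F y * height y ^- m) x =
    partial i F x * height x ^- m - m%:R * last_delta i * (F x * height x ^- m.+1).
Proof.
move=> tF; have sF := test_smooth tF.
have [hx|sx] := test_cases x tF.
  have [d1 p1] := hinv_derive i m hx.
  have dF : derivable F x (e i) by exact: smooth_derivable.
  by split; [exact: (derivable_mul dF d1)|rewrite (partialM dF d1) p1; ring].
have F0 := near_notin_supp sx.
have G0 : \forall y \near x, cst 0 y = F y * height y ^- m.
  near=> y; have Fy : F y = 0 by near: y; exact: F0.
  by rewrite Fy mul0r.
split.
  by apply: (near_eq_derivable G0); exact: (smooth_derivable (@smooth_cst _ _ _)).
rewrite /partial -(near_eq_derive _ G0) -/(partial i F x).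
rewrite (partial_vanish _ (@supp_closed _ _ F) (@notin_supp _ _ F) sx).
by rewrite (notin_supp sx) !mul0r mulr0 subr0; exact: derive_cst.
Unshelve. all: by end_near. Qed.

Lemma C1box_test_hinv M F m : Omega `<=` box M -> test_function Omega F ->
  C1box M (fun y => F y * height y ^- m).
Proof.
move=> OM tF; split.
- exact: continuous_test_hinv.
- by move=> x nx; rewrite (test_out tF) ?mul0r// => /OM.
- by move=> i x; have [] := partial_test_hinv i m x tF.
- move=> i; rewrite (_ : partial i _ = fun x => 1 * (partial i F x * height x ^- m) +
     (- (m%:R * last_delta i)) * (F x * height x ^- m.+1)); last first.
    by apply/funext => x; have [_ ->] := partial_test_hinv i m x tF; ring.
  apply: (@continuous_lc R N 1 (fun x => partial i F x * height x ^- m)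
     (fun x => (- (m%:R * last_delta i)) * (F x * height x ^- m.+1))).
    exact: (@continuous_test_hinv (partial i F) m (test_partial i tF)).
  rewrite (_ : (fun x => _) = lincomb (- (m%:R * last_delta i)) (fun x => F x * height x ^- m.+1) (fun=> 0)).
    apply: continuous_lc; last exact: cst_continuous.
    exact: (@continuous_test_hinv F m.+1 tF).
  by apply/funext => x; rewrite /lincomb addr0.
Qed.

End test_over_height.

(** The orthonormal frame of the hyperbolic metric. *)
Definition D i f : 'rV[R]_N -> R := fun x => height x * partial i f x.

Lemma smooth_D i f : smooth f -> smooth (D i f).
Proof. by move=> sf; apply: smooth_mul; [exact: smooth_height|exact: smooth_partial]. Qed.

Lemma test_D Omega i f : test_function Omega f -> test_function Omega (D i f).
Proof. by move=> tf; apply: test_mul; [exact: smooth_height|exact: test_partial]. Qed.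

Lemma D_mul i f g x : smooth f -> smooth g ->
  D i (fun y => f y * g y) x = f x * D i g x + g x * D i f x.
Proof.
move=> sf sg; rewrite /D partialM; [|exact: smooth_derivable|exact: smooth_derivable].
by ring.
Qed.

Lemma D_lc i a f g x : smooth f -> smooth g ->
  D i (lincomb a f g) x = a * D i f x + D i g x.
Proof.
move=> sf sg; rewrite /D partial_lc; [|exact: smooth_derivable|exact: smooth_derivable].
by ring.
Qed.

Lemma D_coord i j x : D i (fun y => y ord0 j) x = (i == j)%:R * height x.
Proof. by rewrite /D partial_coord mulrC. Qed.

Lemma D_height i x : D i (@height R n) x = last_delta i * height x.
Proof. exact: D_coord. Qed.

(** The divergence involves the density h^-(n+1), whose derivative produces
    the first order term. *)
Lemma laplacian_D Omega f x : Omega `<=` @half_space R n ->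
  test_function Omega f -> Omega x ->
  hyp_laplacian f x = \sum_i D i (D i f) x - n%:R * D ord_max f x.
Proof.
move=> Oh tf Ox; have hx : height x != 0 by rewrite gt_eqF//; exact: Oh.
rewrite /hyp_laplacian /hyp_div.
have E i : partial i (fun y => vol_density y * hyp_grad f y ord0 i) x =
    partial i (D i f) x * height x ^- n - n%:R * last_delta i * (D i f x * height x ^- n.+1).
  have [_ <-] := partial_test_hinv Oh i n x (test_D i tf).
  congr (partial i _ x); apply/funext => y; rewrite mxE /vol_density /D.
  have [->|hy] := eqVneq (height y) 0; first by rewrite !expr0n/= !(mul0r, mulr0, invr0).
  by rewrite exprS; field; rewrite hy expf_neq0.
under eq_bigr do rewrite E.
rewrite sumrB mulrBr; congr (_ - _).
  rewrite mulr_sumr; apply: eq_bigr => i _.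
  by rewrite /vol_density {2}/D exprS; field; rewrite hx expf_neq0.
rewrite (bigD1 ord_max)//= big1 ?addr0.
  have -> : last_delta ord_max = 1 by rewrite /last_delta eqxx.
  by rewrite /vol_density exprS; field; rewrite hx expf_neq0.
by move=> i ni; rewrite /last_delta (negbTE ni) mulr0 mul0r.
Qed.

End inverse_height.

Lemma cvg_sumr (R : realType) (J : Type) (s : seq J) (f : J -> nat -> R) (l : J -> R) :
  (forall j, f j @ \oo --> l j) ->
  (fun k => \sum_(j <- s) f j k) @ \oo --> \sum_(j <- s) l j.
Proof.
move=> fl; elim: s => [|j s IH].
  by rewrite big_nil; under eq_fun do rewrite big_nil; exact: cvg_cst.
by rewrite big_cons; under eq_fun do rewrite big_cons; exact: cvgD.
Qed.

(** * The Dirichlet form of a domain *)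
Section domain.
Context (R : realType) (n : nat) (Omega : set 'rV[R]_n.+1) (M c : R).
Notation N := n.+1.
Notation mu := (@rV_lebesgue R N).
Notation vol := (@vol_density R n).
Notation test := (@test_function R N Omega).
Notation intV := (integralV Omega).
Hypotheses (Ohalf : Omega `<=` @half_space R n) (oO : open Omega).
Hypotheses (M0 : 0 < M) (OM : Omega `<=` box M).
Hypotheses (c0 : 0 < c) (Oc : forall x, Omega x -> c <= height x).
Implicit Types f g F u : 'rV[R]_N -> R.

Notation sq := (sqint mu Omega vol).
Notation b := (wdot mu Omega vol).

Lemma measurable_domain : measurable Omega.
Proof. exact: open_measurable_rV. Qed.

Lemma vol_gt0 x : Omega x -> 0 < vol x.
Proof. by move=> /Oc cx; rewrite invr_gt0 exprn_gt0// (lt_le_trans c0). Qed.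

(** On the domain the height is at least c, so the density agrees with a
    function that is continuous on the whole space. *)
Lemma measurable_vol : measurable_fun Omega vol.
Proof.
pose g (x : 'rV[R]_N) : R := (Num.max c (height x)) ^- N.
apply: (@eq_measurable_fun _ _ _ _ _ g).
  by move=> x /[!inE] Ox; rewrite /g (max_r (Oc Ox)).
apply: measurable_funTS; apply: continuous_measurable_rV => x.
have mx0 : Num.max c (height x) != 0 by rewrite gt_eqF// lt_max c0.
have cm : continuous (fun x : 'rV[R]_N => Num.max c (height x) ^+ N); last first.
  exact: (cvgV (expf_neq0 N mx0) (cm x)).
move=> {mx0}x; apply: (@continuous_comp _ _ _ (fun x : 'rV[R]_N => Num.max c (height x)) (fun y : R => y ^+ N)).
  apply: (@continuous_comp _ _ _ (@height R n) (fun y : R => Num.max c y)).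
    exact: coord_continuous.
  by apply: continuous_max; [exact: cst_continuous|move=> y; exact: cvg_id].
exact: exprn_continuous.
Qed.

Lemma test_vol_bs F : test F -> bounded_supported (box M) (fun x => F x * vol x).
Proof.
move=> tF; apply: continuous_bs; first exact: (continuous_test_hinv Ohalf tF).
by move=> x nx; rewrite (test_out tF) ?mul0r// => /OM.
Qed.

Lemma box_integrable f : bounded_supported (box M) f -> mu.-integrable setT (EFin \o f).
Proof. exact: (bs_integrable (@measurable_box R N M) (@box_lty R N M)). Qed.

Lemma test_vol_integrable F : test F -> mu.-integrable Omega (fun x => (F x * vol x)%:E).
Proof.
move=> tF; apply: (integrableS measurableT) => //; first exact: measurable_domain.
exact: (box_integrable (test_vol_bs tF)).
Qed.

Lemma integral_domain f : (forall x, ~ Omega x -> f x = 0) ->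
  \int[mu]_(x in Omega) f x = \int[mu]_x f x.
Proof.
move=> fO; rewrite Rintegral_mkcond; apply: eq_Rintegral => x _.
by rewrite patchE; case: ifPn => //; rewrite notin_setE => /fO ->.
Qed.

Lemma integralV_test F : test F -> intV F = \int[mu]_x (F x * vol x).
Proof. by move=> tF; apply: integral_domain => x nx; rewrite (test_out tF)// mul0r. Qed.

Lemma test_sqint f : test f -> sq f.
Proof.
move=> tf; split.
  apply: measurable_funTS; apply: continuous_measurable_rV.
  by apply: smooth_continuous; exact: test_smooth tf.
have := test_vol_integrable (test_mul (test_smooth tf) tf).
by apply: eq_integrable; [exact: measurable_domain|move=> x _; rewrite expr2].
Qed.

Lemma intV_lc a F G : test F -> test G -> intV (lincomb a F G) = a * intV F + intV G.
Proof.
move=> tF tG; rewrite !integralV_test//; last exact: test_lc.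
rewrite -(Rintegral_lc (@measurable_box R N M) (@box_lty R N M)); [|exact: test_vol_bs..].
by apply: eq_Rintegral => x _; rewrite /lincomb; ring.
Qed.

Lemma test0 : test (fun=> 0).
Proof.
apply: (@test_sub _ _ _ _ set0) => //.
- exact: smooth_cst.
- exact: compact0.
- exact: closed0.
Qed.

Lemma test_sum (J : Type) (s : seq J) (F : J -> 'rV[R]_N -> R) : (forall j, test (F j)) ->
  test (fun x => \sum_(j <- s) F j x).
Proof.
move=> tF; elim: s => [|j s IH].
  by rewrite (_ : (fun _ => _) = fun=> 0);
    [exact: test0|apply/funext => x; rewrite big_nil].
rewrite (_ : (fun _ => _) = lincomb 1 (F j) (fun x => \sum_(j <- s) F j x));
  first exact: test_lc.
by apply/funext => x; rewrite big_cons /lincomb mul1r.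
Qed.

Lemma intV_sum (J : Type) (s : seq J) (F : J -> 'rV[R]_N -> R) : (forall j, test (F j)) ->
  intV (fun x => \sum_(j <- s) F j x) = \sum_(j <- s) intV (F j).
Proof.
move=> tF; elim: s => [|j s IH].
  rewrite big_nil (_ : (fun _ => _) = fun=> 0).
    by rewrite (integralV_test test0); under eq_Rintegral do rewrite mul0r;
      rewrite /Rintegral integral0.
  by apply/funext => x; rewrite big_nil.
rewrite big_cons -IH -[X in X + _]mul1r -intV_lc//; last exact: test_sum.
by congr (intV _); apply/funext => x; rewrite big_cons /lincomb mul1r.
Qed.

(** Up to the density, D_i F is the partial derivative of F h^-n minus the term
    in which the power of h is differentiated. *)
Lemma intV_D i F : test F -> intV (D i F) = n%:R * last_delta R i * intV F.
Proof.
move=> tF.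
have := integral_partial i M0 (C1box_test_hinv Ohalf n OM tF).
under eq_Rintegral do rewrite (partial_test_hinv Ohalf i n _ tF).2.
move=> H; rewrite !integralV_test//; last exact: test_D.
apply/eqP; rewrite -subr_eq0 -mulNr addrC -(Rintegral_lc (@measurable_box R N M) (@box_lty R N M)); last 2 first.
- exact: test_vol_bs.
- exact/test_vol_bs/test_D.
rewrite -[X in _ == X]H; apply/eqP; apply: eq_Rintegral => x _.
have [Ox|nOx] := pselect (Omega x); last first.
  rewrite (test_out tF nOx) (test_out (test_partial i tF) nOx) (test_out (test_D i tF) nOx).
  by rewrite !(mul0r, mulr0) subr0 addr0.
have hx : height x != 0 by rewrite gt_eqF// (lt_le_trans c0)// Oc.
rewrite /vol_density /D !exprS; field; rewrite hx expf_neq0//.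
Qed.

Lemma wdot_test f g : b f g = intV (fun x => f x * g x).
Proof. by []. Qed.

(** Integration by parts of f D_i g, summed over i; the first order term of
    the Laplacian cancels the one of [intV_D]. *)
Lemma green f g : test f -> test g ->
  intV (fun x => f x * hyp_laplacian g x) = - \sum_i b (D i f) (D i g).
Proof.
move=> tf tg.
have sf := test_smooth tf; have sg := test_smooth tg.
have H1 : \sum_i intV (D i (fun x => f x * D i g x)) = n%:R * intV (fun x => f x * D ord_max g x).
  rewrite (bigD1 ord_max)//= big1 ?addr0.
    rewrite intV_D; last by apply: test_mul => //; exact: test_D.
    by rewrite /last_delta eqxx mulr1.
  move=> i ni; rewrite intV_D; last by apply: test_mul => //; exact: test_D.
  by rewrite /last_delta (negbTE ni) mulr0 mul0r.
have H2 : \sum_i intV (D i (fun x => f x * D i g x)) =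
    \sum_i intV (fun x => f x * D i (D i g) x) + \sum_i b (D i f) (D i g).
  rewrite -big_split/=; apply: eq_bigr => i _.
  rewrite wdot_test -[X in X + _]mul1r -intV_lc; last 2 first.
  - by apply: test_mul => //; do 2 apply: test_D.
  - by apply: test_mul; [exact: smooth_D|exact: test_D].
  congr (intV _); apply/funext => x; rewrite D_mul//; last exact: smooth_D.
  by rewrite /lincomb; ring.
have -> : intV (fun x => f x * hyp_laplacian g x) =
    intV (lincomb (- n%:R) (fun x => f x * D ord_max g x) (fun x => \sum_i f x * D i (D i g) x)).
  apply: eq_Rintegral => x /[!inE] Ox;
    rewrite (laplacian_D Ohalf tg Ox) /lincomb -mulr_sumr.
  by ring.
rewrite intV_lc; last 2 first.
- by apply: test_mul => //; exact: test_D.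
- by apply: test_sum => i; apply: test_mul => //; do 2 apply: test_D.
rewrite intV_sum; last by move=> i; apply: test_mul => //; do 2 apply: test_D.
by rewrite mulNr -H1 H2 opprD addrAC addNr add0r.
Qed.

Lemma wdot_form_test : pos_form test b.
Proof.
have [C L P] := wdot_form mu measurable_domain measurable_vol vol_gt0.
split=> [u v tu tv|a u v w tu tv tw|u tu].
- by apply: C; exact: test_sqint.
- by apply: L; exact: test_sqint.
- by apply: P; exact: test_sqint.
Qed.

Definition energy f g := \sum_i b (D i f) (D i g).

Lemma D_lcE i a f g : test f -> test g -> D i (lincomb a f g) = lincomb a (D i f) (D i g).
Proof.
by move=> tf tg; apply/funext => x; rewrite D_lc//;
  [exact: test_smooth tf|exact: test_smooth tg].
Qed.

Lemma energy_form : pos_form test energy.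
Proof.
have [C L P] := wdot_form_test.
split=> [u v tu tv|a u v w tu tv tw|u tu].
- by apply: eq_bigr => i _; apply: C; exact: test_D.
- rewrite /energy mulr_sumr -big_split/=; apply: eq_bigr => i _.
  by rewrite D_lcE// L//; exact: test_D.
- by apply: sumr_ge0 => i _; apply: P; exact: test_D.
Qed.

(** * Compactness of the Dirichlet form *)
Let mO := measurable_domain.
Let mvol := measurable_vol.
Let vol0 := vol_gt0.
Let lsq : lin_closed sq := sqint_lc mO mvol vol0.
Let fb : pos_form sq b := wdot_form mu mO mvol vol0.
Let tsq f : test f -> sq f := @test_sqint f.
Let mB := @measurable_box R N M.
Let muB := @box_lty R N M.

Lemma vol_le x : Omega x -> vol x <= c ^- N.
Proof.
move=> Ox; have cx := Oc Ox; have hx : 0 < height x by exact: lt_le_trans cx.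
rewrite /vol_density lef_pV2 ?posrE ?exprn_gt0// ler_pXn2r// nnegrE ltW//.
Qed.

Lemma vol_ge x : Omega x -> M ^- N <= vol x.
Proof.
move=> Ox; have cx := Oc Ox; have hx : 0 < height x by exact: lt_le_trans cx.
rewrite /vol_density lef_pV2 ?posrE ?exprn_gt0// ler_pXn2r// ?nnegrE ?(ltW M0) ?(ltW hx)//.
by rewrite (le_trans (ler_norm _))//; exact: (OM Ox ord_max).
Qed.

Lemma test_C1box u : test u -> C1box M u.
Proof.
move=> tu; rewrite (_ : u = fun y => u y * height y ^- 0).
  exact: (C1box_test_hinv Ohalf 0 OM tu).
by apply/funext => y; rewrite expr0 invr1 mulr1.
Qed.

Lemma wdot_int u : test u -> b u u = \int[mu]_x ((u x ^+ 2) * vol x).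
Proof.
move=> tu; rewrite wdot_test (integralV_test (test_mul (test_smooth tu) tu)).
by apply: eq_Rintegral => x _; rewrite expr2.
Qed.

Lemma sq_vol_bs u : test u -> bounded_supported (box M) (fun x => u x ^+ 2 * vol x).
Proof.
move=> tu; have := test_vol_bs (test_mul (test_smooth tu) tu).
by under eq_fun do rewrite -expr2.
Qed.

Lemma wdot_le_int u : test u -> b u u <= c ^- N * \int[mu]_x (u x ^+ 2).
Proof.
move=> tu; have Hu := bs_sq (C1box_bs (test_C1box tu)).
rewrite wdot_int// -(Rintegral_scale mB muB)//.
apply: (bs_le mB muB (sq_vol_bs tu) (bs_scale _ Hu)) => x.
have [Ox|nOx] := pselect (Omega x);
  last by rewrite (test_out tu nOx) expr0n/= mul0r mulr0.
by rewrite mulrC ler_wpM2r ?sqr_ge0// vol_le.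
Qed.

Lemma int_le_wdot u : test u -> \int[mu]_x (u x ^+ 2) <= M ^+ N * b u u.
Proof.
move=> tu; have Hu := bs_sq (C1box_bs (test_C1box tu)); have Hv := sq_vol_bs tu.
rewrite wdot_int// -(Rintegral_scale mB muB)//.
apply: (bs_le mB muB Hu (bs_scale _ Hv)) => x.
have [Ox|nOx] := pselect (Omega x);
  last by rewrite (test_out tu nOx) expr0n/= mul0r mulr0.
rewrite mulrCA ler_peMr ?sqr_ge0// -ler_pdivrMl ?exprn_gt0// mulr1.
exact: vol_ge.
Qed.

Lemma int_partial_le i u : test u ->
  \int[mu]_x (partial i u x ^+ 2) <= (M ^+ N / c ^+ 2) * b (D i u) (D i u).
Proof.
move=> tu; have tD := test_D i tu; have tp := test_partial i tu.
have Hu := bs_sq (C1box_bs (test_C1box tp)); have Hv := sq_vol_bs tD.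
rewrite wdot_int// -(Rintegral_scale mB muB)//.
apply: (bs_le mB muB Hu (bs_scale _ Hv)) => x.
have [Ox|nOx] := pselect (Omega x); last first.
  by rewrite (test_out tp nOx) (test_out tD nOx) expr0n/= mul0r mulr0.
have hx : c ^+ 2 <= height x ^+ 2.
  by rewrite ler_pXn2r ?nnegrE ?(ltW c0) ?Oc// (le_trans (ltW c0)) ?Oc.
have v1 : 1 <= M ^+ N * vol x.
  by rewrite -ler_pdivrMl ?exprn_gt0// mulr1; exact: vol_ge.
rewrite /D exprMn.
rewrite (_ : _ * (_ * vol x) = partial i u x ^+ 2 * (height x ^+ 2 / c ^+ 2 * (M ^+
  N * vol x))); last by ring.
rewrite ler_peMr ?sqr_ge0//.
by apply: mulr_ege1 => //; rewrite ler_pdivlMr ?exprn_gt0// mul1r.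
Qed.

(** On the domain the height lies between c and M, so the hyperbolic
    quantities are comparable with the Euclidean ones of [ehrling]. *)
Lemma energy_dominated : finitely_dominated test energy b.
Proof.
move=> eps e0.
have Mc : 0 < M ^+ N / c ^+ 2 by rewrite divr_gt0 ?exprn_gt0.
have cN : 0 < c ^+ N by rewrite exprn_gt0.
have e'0 : 0 < eps * c ^+ N / (M ^+ N / c ^+ 2) by exact: (divr_gt0 (mulr_gt0 e0 cN) Mc).
have [J [Q [K [K0 mQ HQ]]]] := ehrling n.+1 M0 e'0.
pose s := Num.sqrt (c ^- N * K).
have s2 : s ^+ 2 = c ^- N * K by rewrite sqr_sqrtr// mulr_ge0// invr_ge0 ltW.
pose V := \int[mu]_x (\1_(box M) x ^+ 2 : R).
have HuQ u j : test u -> bounded_supported (box M) (fun x => u x * \1_(Q j) x).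
  by move=> tu; apply: bs_indic => //; exact: C1box_bs (test_C1box tu).
exists J, (fun j u => s * \int[mu]_x (u x * \1_(Q j) x)), (s ^+ 2 * (M ^+ N * V)); split.
- move=> j a u v tu tv.
  have -> : \int[mu]_x (lincomb a u v x * \1_(Q j) x) =
     a * \int[mu]_x (u x * \1_(Q j) x) + \int[mu]_x (v x * \1_(Q j) x).
    rewrite -(Rintegral_lc mB muB); [|exact: HuQ..].
    by apply: eq_Rintegral => x _; rewrite /lincomb; ring.
  by ring.
- move=> j u tu; rewrite exprMn -(mulrA (s ^+ 2)).
  apply: ler_wpM2l; first exact: sqr_ge0.
  have Hu := C1box_bs (test_C1box tu).
  have := bs_CS mB muB (HuQ u j tu) (bs_one R mB).
  have -> : \int[mu]_x (u x * \1_(Q j) x * \1_(box M) x) = \int[mu]_x (u x * \1_(Q j) x).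
    apply: eq_Rintegral => x _.
    have [Bx|nBx] := pselect (box M x);
      first by rewrite [X in _ * X]indicE mem_set// mulr1.
    by have [_ _ uB] := Hu; rewrite uB// !mul0r.
  move=> /le_trans; apply; rewrite -/V [leRHS]mulrAC.
  apply: ler_wpM2r; first by apply: Rintegral_ge0 => x _; exact: sqr_ge0.
  apply: le_trans (int_le_wdot tu).
  apply: (bs_le mB muB (bs_sq (HuQ u j tu)) (bs_sq Hu)) => x.
  rewrite exprMn ler_piMr ?sqr_ge0// indicE; case: (_ \in _); rewrite ?expr1n ?expr0n//.
move=> u tu; apply: (le_trans (wdot_le_int tu)).
have -> : \sum_j (s * \int[mu]_x (u x * \1_(Q j) x)) ^+ 2 =
    c ^- N * (K * \sum_j (\int[mu]_x (u x * \1_(Q j) x)) ^+ 2).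
  by rewrite mulrA -s2 mulr_sumr; apply: eq_bigr => j _; rewrite exprMn.
have -> : eps * energy u u = c ^- N * (c ^+ N * eps * energy u u).
  by rewrite !mulrA mulVf ?mul1r// gt_eqF.
rewrite -mulrDr ler_wpM2l ?invr_ge0 ?(ltW cN)//.
apply: (le_trans (HQ _ (test_C1box tu))); rewrite lerD2r.
apply: (@le_trans _ _ (eps * c ^+ N / (M ^+ N / c ^+ 2) *
   ((M ^+ N / c ^+ 2) * energy u u))).
  apply: ler_wpM2l; first exact: ltW.
  by rewrite /energy mulr_sumr; apply: ler_sum => i _; exact: int_partial_le.
by rewrite mulrA divfK ?gt_eqF// mulrC [X in _ <= X]mulrC (mulrC eps).
Qed.

(** * Eigenfunctions as limits of test functions *)

(** An element u of the Sobolev space together with its derivatives G in the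
    frame and with test functions that converge to it. *)
Record H10_limit u (G : 'I_N -> 'rV[R]_N -> R) (phi : nat -> 'rV[R]_N -> R) : Prop :=
  H10Limit {
  H10_limit_sq : sq u;
  H10_limit_sqG : forall i, sq (G i);
  H10_limit_test : forall k, test (phi k);
  H10_limit_cvg : form_cvg b phi u;
  H10_limit_cvgG : forall i, form_cvg b (fun k => D i (phi k)) (G i) }.

Definition weak_eigen nu u (G : 'I_N -> 'rV[R]_N -> R) := forall psi, test psi ->
  \sum_i b (G i) (D i psi) = nu * b u psi.

Definition frame_laplacian f : 'rV[R]_N -> R :=
  lincomb (- n%:R) (D ord_max f) (fun x => \sum_i D i (D i f) x).

Lemma test_frame_laplacian f : test f -> test (frame_laplacian f).
Proof.
move=> tf; apply: test_lc; first exact: test_D.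
by apply: test_sum => i; do 2 apply: test_D.
Qed.

Lemma intV_laplacian u f : test f ->
  intV (fun x => u x * hyp_laplacian f x) = b u (frame_laplacian f).
Proof.
move=> tf; apply: eq_Rintegral => x /[!inE] Ox.
by rewrite (laplacian_D Ohalf tf Ox) /frame_laplacian /lincomb; ring.
Qed.

Lemma form_cvg_energy u G phi psi : H10_limit u G phi -> test psi ->
  (fun k => energy (phi k) psi) @ \oo --> \sum_i b (G i) (D i psi).
Proof.
move=> [su sG tp cu cG] tpsi; rewrite /energy.
apply: cvg_sumr => i.
apply: (form_cvg_form lsq fb _ _ (sG i) _ (cG i) (form_cvg_const lsq fb _)).
- by move=> k; apply: tsq; exact: test_D.
- by move=> _; apply: tsq; exact: test_D.
- by apply: tsq; exact: test_D.
- by apply: tsq; exact: test_D.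
Qed.

(** Green's formula passed to the limit, which is legitimate because
    the Laplacian of psi agrees on the domain with a test function. *)
Lemma weak_laplacian u G phi psi : H10_limit u G phi -> test psi ->
  b u (frame_laplacian psi) = - \sum_i b (G i) (D i psi).
Proof.
move=> H tpsi; have [su sG tp cu cG] := H.
have tl := tsq (test_frame_laplacian tpsi).
have h1 : (fun k => b (phi k) (frame_laplacian psi)) @ \oo --> b u (frame_laplacian psi).
  by apply: (form_cvg_form lsq fb _ _ su tl cu (form_cvg_const lsq fb tl)) => // k;
    exact: tsq.
have h2 : (fun k => b (phi k) (frame_laplacian psi)) @ \oo --> - \sum_i b (G i) (D i psi).
  rewrite (_ : (fun k => _) = fun k => - energy (phi k) psi).
    exact: (cvgN (form_cvg_energy H tpsi)).
  apply/funext => k; rewrite -intV_laplacian//.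
  exact: (green (tp k) tpsi).
by rewrite -(cvg_lim _ h1)// -(cvg_lim _ h2).
Qed.

Lemma measurable_rV_component (W : 'rV[R]_N -> 'rV[R]_N) i :
  measurable_fun Omega W -> measurable_fun Omega (fun x => W x ord0 i).
Proof. exact: measurableT_comp (measurable_rV_coord _). Qed.

Lemma test_measurable f : test f -> measurable_fun Omega f.
Proof. by move=> /tsq[]. Qed.

Lemma height_measurable : measurable_fun Omega (@height R n).
Proof. by apply: measurable_funTS; apply: continuous_measurable_rV;
  exact: coord_continuous. Qed.

(** The distance to the k-th test function in the Sobolev space bounds
    the L^2 distance of u and of each G_i to the corresponding test functions, so
    these converge, and G_i is square-integrable because it is at finite distance
    from a test function. *)
Lemma eigen_H10_limit nu u : dirichlet_eigenspace Omega nu u ->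
  exists G phi, H10_limit u G phi /\ weak_eigen nu u G.
Proof.
move=> [[[mu_ u2] [W [phi [mW tphi cv]]]] hw].
have su : sq u by exact: sqint_lty.
pose G i x := height x * W x ord0 i.
have mG i : measurable_fun Omega (G i).
  by apply: measurable_funM; [exact: height_measurable|exact: measurable_rV_component].
pose E k := eintegralV Omega (fun x => (u x - phi k x) ^+ 2
   + conorm2 x (W x - differential (phi k) x)).
(* None stands for the function itself and Some i for its i-th derivative *)
pose d k (o : option 'I_N) : 'rV[R]_N -> R :=
  if o is Some i then lincomb (-1) (G i) (D i (phi k)) else lincomb (-1) u (phi k).
have md k o : measurable_fun Omega (d k o).
  case: o => [i|]; apply: measurable_funD.
  - by apply: measurable_funM.
  - by apply: test_measurable; exact: test_D.
  - by apply: measurable_funM.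
  - exact: test_measurable.
have dE k o x : d k o x ^+ 2 <= (u x - phi k x) ^+ 2
   + conorm2 x (W x - differential (phi k) x).
  have cE : conorm2 x (W x - differential (phi k) x) = \sum_i d k (Some i) x ^+ 2.
    rewrite /conorm2 mulr_sumr; apply: eq_bigr => i _.
    by rewrite /d /lincomb /G /D !mxE; ring.
  case: o => [i|].
    rewrite cE (bigD1 i)//= addrCA lerDl addr_ge0 ?sqr_ge0// sumr_ge0// => j _.
    exact: sqr_ge0.
  rewrite /d /lincomb (_ : -1 * u x + phi k x = - (u x - phi k x)); last by ring.
  by rewrite sqrrN lerDl cE sumr_ge0// => i _; exact: sqr_ge0.
have mE k : measurable_fun Omega (fun x => ((u x - phi k x) ^+ 2
   + conorm2 x (W x - differential (phi k) x)) * vol x).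
  apply: measurable_funM => //; apply: measurable_funD.
    by apply/measurable_funX/measurable_funB => //; exact: test_measurable.
  apply: measurable_funM; first by apply: measurable_funX; exact: height_measurable.
  apply: measurable_sum => i; apply: measurable_funX.
  rewrite (_ : (fun x => _) = fun x => W x ord0 i - partial i (phi k) x); last first.
    by apply/funext => x; rewrite !mxE.
  apply: measurable_funB; first exact: measurable_rV_component.
  by apply: test_measurable; exact: test_partial.
have dEk k o : (\int[mu]_(x in Omega) (d k o x ^+ 2 * vol x)%:E <= E k)%E.
  apply: ge0_le_integral => //.
  - by move=> x Ox; rewrite lee_fin mulr_ge0 ?sqr_ge0// ltW// vol0.
  - by apply/measurable_EFinP; apply: measurable_funM => //; exact: measurable_funX.
  - by apply/measurable_EFinP.
  - by move=> x Ox; rewrite lee_fin ler_wpM2r ?dE// ltW// vol0.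
have /fine_cvgP[[k0 _ Ek0] Ecv] : E @ \oo --> 0%:E by exact: cv.
have Efin k : (k0 <= k)%N -> E k = (fine (E k))%:E.
  by move=> kk; rewrite fineK//; exact: Ek0.
have sG i : sq (G i).
  have s1 : sq (d k0 (Some i)).
    apply: sqint_lty => //; apply: (le_lt_trans (dEk k0 (Some i))).
    by rewrite Efin// ltry.
  rewrite (_ : G i = lincomb (-1) (d k0 (Some i)) (D i (phi k0))).
    by apply: lsq => //; apply: tsq; exact: test_D.
  by apply/funext => x; rewrite /d /lincomb; ring.
have sd k o : sq (d k o).
  by case: o => [i|]; apply: lsq => //; apply: tsq => //; exact: test_D.
have dcv o : (fun k => b (d k o) (d k o)) @ \oo --> 0.
  apply: squeeze_cvgr (@cvg_cst _ (0 : R) _ \oo _) Ecv.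
  exists k0 => // k /= kk; rewrite (form_ge0 fb)//= -lee_fin -wdot_integral//.
  by rewrite -Efin.
have H : H10_limit u G phi.
  by split=> //; [exact: (dcv None)|move=> i; exact: (dcv (Some i))].
exists G, phi; split => // psi tpsi.
have := hw psi tpsi; rewrite intV_laplacian// (weak_laplacian H)// mulNr.
by move=> /oppr_inj.
Qed.

(** * Small Rayleigh quotients produce eigenfunctions *)

(** The weak differential is recovered from G by dividing by the height;
    the division by max(c, h) and the restriction of G to the domain make
    measurability hold on the whole space. *)
Lemma H10_limit_eigen nu u G phi : H10_limit u G phi -> weak_eigen nu u G ->
  dirichlet_eigenspace Omega nu u.
Proof.
move=> H hw; have [su sG tp cu cG] := H; split; last first.
  move=> psi tpsi; rewrite (intV_laplacian _ tpsi).
  by rewrite (weak_laplacian H tpsi) hw// mulNr.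
split; first by split; [case: su|rewrite /eintegralV wdot_integral// ltry].
pose G' i := G i \_ Omega.
pose W x : 'rV[R]_N := \row_i (G' i x * (Num.max c (height x))^-1).
have WE x i : Omega x -> height x * W x ord0 i = G i x.
  move=> Ox; have cx := Oc Ox; have hx : 0 < height x by exact: lt_le_trans cx.
  rewrite mxE /G' patchE mem_set// max_r//; field; rewrite gt_eqF//.
exists W, phi; split => //.
  apply: measurable_funTS; apply: measurable_fun_rV => i.
  rewrite (_ : (fun t => _) = fun x => G' i x * (Num.max c (height x))^-1); last first.
    by apply/funext => x; rewrite mxE.
  apply: measurable_funM.
    by apply/(measurable_restrictT _ mO); case: (sG i).
  apply: continuous_measurable_rV => x.
  have mx0 : Num.max c (height x) != 0 by rewrite gt_eqF// lt_max c0.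
  have cm : continuous (fun x : 'rV[R]_N => Num.max c (height x)); last first.
    exact: (cvgV mx0 (cm x)).
  move=> {mx0}x; apply: (@continuous_comp _ _ _ (@height R n) (fun y : R => Num.max c y)).
    exact: coord_continuous.
  by apply: continuous_max; [exact: cst_continuous|move=> y; exact: cvg_id].
pose d k (o : option 'I_N) : 'rV[R]_N -> R :=
  if o is Some i then lincomb (-1) (G i) (D i (phi k)) else lincomb (-1) u (phi k).
have sd k o : sq (d k o).
  by case: o => [i|]; apply: lsq => //; apply: tsq => //; exact: test_D.
have E k : eintegralV Omega (fun x => (u x - phi k x) ^+ 2
           + conorm2 x (W x - differential (phi k) x)) =
   (b (d k None) (d k None) + \sum_i b (d k (Some i)) (d k (Some i)))%:E.
  rewrite EFinD -sumEFin -(wdot_integral mO) ?sd//.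
  under [in RHS]eq_bigr do rewrite -(wdot_integral mO) ?sd//.
  rewrite -(@integral_sum _ _ _ mu Omega mO)//; last first.
    by move=> i; have [_] := sd k (Some i).
  rewrite -integralD//; last 2 first.
  - by have [_] := sd k None.
  - by apply: integrable_sum => // i _; have [_] := sd k (Some i).
  apply: eq_integral => x /[!inE] Ox; rewrite sumEFin -EFinD; congr EFin.
  rewrite mulrDl; congr (_ + _); first by rewrite /d /lincomb; ring.
  rewrite -mulr_suml; congr (_ * _); rewrite /conorm2 mulr_sumr; apply: eq_bigr => i _.
  by rewrite /d /lincomb -(WE x i Ox) /D !mxE; ring.
under eq_fun do rewrite E.
apply/fine_cvgP; split; first by near=> k.
rewrite (_ : fine \o _ = fun k => b (d k None) (d k None) +
  \sum_i b (d k (Some i)) (d k (Some i)))//.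
rewrite -[X in _ --> X]addr0; apply: cvgD; first exact: cu.
have := @cvg_sumr R _ (index_enum 'I_N) (fun i k => b (d k (Some i)) (d k (Some i))) (fun=> 0) cG.
by rewrite big1.
Unshelve. all: by end_near. Qed.

Lemma ler_cvg_seq (x y : nat -> R) (l m : R) : x @ \oo --> l -> y @ \oo --> m ->
  (forall k, x k <= y k) -> l <= m.
Proof.
move=> xl ym xy; rewrite -(cvg_lim _ xl)// -(cvg_lim _ ym)//.
by apply: ler_lim; [apply/cvg_ex; exists l|apply/cvg_ex; exists m|exact: nearW].
Qed.

Lemma eq_cvg_seq (x y : nat -> R) (l m : R) : x @ \oo --> l -> y @ \oo --> m ->
  (forall k, x k = y k) -> l = m.
Proof.
move=> xl ym xy; have E : x = y by apply/funext.
by rewrite -(cvg_lim _ xl)// -(cvg_lim _ ym)// E.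
Qed.

Lemma form_cvg_l u phi f : form_cvg b phi u -> (forall k, sq (phi k)) -> sq u -> sq f ->
  (fun k => b f (phi k)) @ \oo --> b f u.
Proof.
move=> cu sp su sf.
by apply: (form_cvg_form lsq fb _ _ sf su (form_cvg_const lsq fb sf) cu).
Qed.

(** The minimizer v of the penalized quotient satisfies
    a(v, .) + (Lam - lam1) b(u, v) b(u, .) = nu b(v, .).  Tested against u, whose own
    equation gives a(u, v) = lam1 b(u, v), it reduces to (Lam - nu) b(u, v) = 0.  As
    nu < Lam, the penalty vanishes and v is an eigenfunction. *)
Lemma rayleigh_or_eigen lam1 Lam u G phi :
  H10_limit u G phi -> weak_eigen lam1 u G -> b u u = 1 -> lam1 <= Lam ->
  (exists nu v Gv vk, [/\ nu < Lam, H10_limit v Gv vk, weak_eigen nu v Gv,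
     b v v = 1 & b u v = 0]) \/
  (forall f, test f -> Lam * b f f <= energy f f + (Lam - lam1) * (b u f) ^+ 2).
Proof.
move=> Hu wu uu lL; have [su sG tp cu cG] := Hu.
have [//|nall] := pselect (forall f, test f ->
  Lam * b f f <= energy f f + (Lam - lam1) * (b u f) ^+ 2); [by right|left].
have [f [tf hf]] : exists f, test f /\
    energy f f + (Lam - lam1) * (b u f) ^+ 2 < Lam * b f f.
  apply: contrapT => nex; apply: nall => f tf; rewrite leNgt; apply/negP => h.
  by apply: nex; exists f.
have hbt : pos_form test b := wdot_form_test.
have he : pos_form test energy := energy_form.
have lt : lin_closed test := @test_lc R N Omega.
have tau0 : 0 <= Lam - lam1 by rewrite subr_ge0.
have ul a f1 g1 : test f1 -> test g1 -> b u (lincomb a f1 g1) = a * b u f1 + b u g1.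
  move=> tf1 tg1; rewrite !(formC fb su) ?(formL fb)//; try exact: tsq.
  by apply: lsq; exact: tsq.
have hq := form_addsq tau0 he ul.
set q := (X in pos_form test X) in hq.
have qe g1 : test g1 -> energy g1 g1 <= q g1 g1.
  by move=> _; rewrite /q lerDl mulr_ge0// -expr2 sqr_ge0.
have fd : finitely_dominated test q b.
  move=> eps e0; have [J [L [C [L1 L2 L3]]]] := energy_dominated e0.
  exists J, L, C; split=> // g1 tg1; apply: (le_trans (L3 g1 tg1)).
  by rewrite lerD2r ler_wpM2l ?(ltW e0)// qe.
have hfq : q f f < Lam * b f f by rewrite /q -expr2.
have [nu [vk [nL tv bv dv cv]]] := min_rayleigh lt hq hbt fd tf hfq.
have sv k : sq (vk k) by exact: tsq.
have sDv i k : sq (D i (vk k)) by apply: tsq; exact: test_D.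
have te k : test (increment vk k) by exact: lt.
have ev k : energy (increment vk k) (increment vk k) +
  b (increment vk k) (increment vk k) <= 16 ^- k.
  by apply: (le_trans _ (dv k)); rewrite lerD2r qe.
have [v sqv cvv] : exists2 v, sq v & form_cvg b vk v.
  apply: (riesz_fischer mO mvol vol0 sv) => k; apply: (le_trans _ (ev k)).
  by rewrite lerDr (form_ge0 he).
have HG i : exists2 g1, sq g1 & form_cvg b (fun k => D i (vk k)) g1.
  apply: (riesz_fischer mO mvol vol0 (sDv i)) => k; apply: (le_trans _ (ev k)).
  rewrite {1 2}/increment -(D_lcE _ _ (tv k) (tv k.+1)) -/(increment vk k).
  apply: (@le_trans _ _ (energy (increment vk k) (increment vk k))).
    rewrite /energy (bigD1 i)//= lerDl sumr_ge0// => j _.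
    by apply: (form_ge0 hbt); exact: test_D.
  by rewrite lerDl (form_ge0 hbt).
pose Gv i := s2val (cid2 (HG i)).
have sGv i : sq (Gv i) by exact: (s2valP (cid2 (HG i))).
have cGv i : form_cvg b (fun k => D i (vk k)) (Gv i) by exact: (s2valP' (cid2 (HG i))).
have Hv : H10_limit v Gv vk by [].
have vv : b v v = 1.
  have := form_cvg_form lsq fb sv sv sqv sqv cvv cvv.
  by move=> h; apply: (eq_cvg_seq h (cvg_cst (1 : R))) => k; exact: bv.
(* the Euler-Lagrange equation of the penalized quotient *)
have EL g1 : test g1 -> \sum_i b (Gv i) (D i g1) +
  (Lam - lam1) * (b u v * b u g1) = nu * b v g1.
  move=> tg1; have sg1 := tsq tg1.
  have h1 := form_cvg_energy Hv tg1.
  have h2 := form_cvg_l cvv sv sqv su.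
  have h3 := form_cvg_form lsq fb sv (fun=> sg1) sqv sg1 cvv (form_cvg_const lsq fb sg1).
  have h4 : (fun k => q (vk k) g1 - nu * b (vk k) g1) @ \oo -->
      \sum_i b (Gv i) (D i g1) + (Lam - lam1) * (b u v * b u g1) - nu * b v g1.
    apply: cvgB; last by apply: cvgM => //; exact: cvg_cst.
    apply: cvgD; first exact: h1.
    by apply: cvgM; [exact: cvg_cst|apply: cvgM => //; exact: cvg_cst].
  have h5 : (fun k => q (vk k) g1 - nu * b (vk k) g1) @ \oo --> 0 := cv g1 tg1.
  apply/eqP; rewrite -subr_eq0; apply/eqP.
  exact: (eq_cvg_seq h4 h5 (fun k => erefl)).
have sp k : sq (phi k) by exact: tsq.
have spD i k : sq (D i (phi k)) by apply: tsq; exact: test_D.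
have uv : b u v = 0.
  (* both weak equations extend by continuity to limits of test functions *)
  have e1 : \sum_i b (Gv i) (G i) + (Lam - lam1) * (b u v * b u u) = nu * b v u.
    have h1 : (fun k => \sum_i b (Gv i) (D i (phi k))) @ \oo --> \sum_i b (Gv i) (G i).
      by apply: cvg_sumr => i; exact: (form_cvg_l (cG i) (spD i) (sG i) (sGv i)).
    have h2 := form_cvg_l cu sp su su.
    have h3 := form_cvg_l cu sp su sqv.
    have h4 : (fun k => \sum_i b (Gv i) (D i (phi k)) +
      (Lam - lam1) * (b u v * b u (phi k)))
        @ \oo --> \sum_i b (Gv i) (G i) + (Lam - lam1) * (b u v * b u u).
      apply: cvgD; first exact: h1.
      by apply: cvgM; [exact: cvg_cst|apply: cvgM => //; exact: cvg_cst].
    have h5 : (fun k => nu * b v (phi k)) @ \oo --> nu * b v u.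
      by apply: cvgM => //; exact: cvg_cst.
    by apply: (eq_cvg_seq h4 h5) => k; exact: EL.
  have e2 : \sum_i b (G i) (Gv i) = lam1 * b u v.
    have h1 : (fun k => \sum_i b (G i) (D i (vk k))) @ \oo --> \sum_i b (G i) (Gv i).
      by apply: cvg_sumr => i; exact: (form_cvg_l (cGv i) (sDv i) (sGv i) (sG i)).
    have h5 : (fun k => lam1 * b u (vk k)) @ \oo --> lam1 * b u v.
      by apply: cvgM; [exact: cvg_cst|exact: (form_cvg_l cvv sv sqv su)].
    by apply: (eq_cvg_seq h1 h5) => k; exact: wu.
  have e3 : \sum_i b (Gv i) (G i) = \sum_i b (G i) (Gv i).
    by apply: eq_bigr => i _; rewrite (formC fb).
  have e4 : b v u = b u v by rewrite (formC fb).
  move: e1; rewrite e3 e2 e4 uu mulr1 => e1.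
  have : (Lam - nu) * b u v = 0 by rewrite mulrBl -e1; ring.
  by move/eqP; rewrite mulf_eq0 subr_eq0 gt_eqF//= => /eqP.
exists nu, v, Gv, vk; split=> // g1 tg1.
by have := EL g1 tg1; rewrite uv mul0r mulr0 addr0.
Qed.

(** * Three identities for test functions *)

Definition shifted i (a : R) : 'rV[R]_N -> R := fun x => x ord0 i - a.

Lemma smooth_shifted i a : smooth (shifted i a).
Proof.
rewrite (_ : shifted i a = lincomb 1 (fun x => x ord0 i) (fun=> - a)).
  by apply: smooth_lc; [exact: smooth_coord|exact: smooth_cst].
by apply/funext => x; rewrite /lincomb mul1r.
Qed.

Lemma D_shifted j i a x : D j (shifted i a) x = (j == i)%:R * height x.
Proof.
rewrite (_ : shifted i a = lincomb 1 (fun x => x ord0 i) (fun=> - a)); last first.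
  by apply/funext => y; rewrite /lincomb mul1r.
rewrite D_lc; [|exact: smooth_coord|exact: smooth_cst].
by rewrite D_coord /D partial_cst mulr0 addr0 mul1r.
Qed.

Lemma last_delta_max : last_delta R (@ord_max n) = 1.
Proof. by rewrite /last_delta eqxx. Qed.

(** With N = n + 1 this is N / 2 - 1, the exponent of h in the substitution that
    turns the hyperbolic equation into that of a Euclidean membrane. *)
Definition kappa : R := (n%:R - 1) / 2.

(** If f = h^kappa w, then this is h^(kappa + 2) d_i w: the Euclidean
    derivative of w, in terms of f. *)
Definition conj_deriv i f : 'rV[R]_N -> R :=
  fun x => height x * (D i f x - kappa * last_delta R i * f x).

Lemma test_conj_deriv i f : test f -> test (conj_deriv i f).
Proof.
move=> tf; apply: test_mul; first exact: smooth_height.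
rewrite (_ : (fun _ => _) = lincomb (- (kappa * last_delta R i)) f (D i f)).
  by apply: test_lc => //; exact: test_D.
by apply/funext => x; rewrite /lincomb; ring.
Qed.

(** The Euclidean identity int (x_i - a) w d_i w = - (1/2) int w^2,
    obtained by integrating D_i of (x_i - a) h f^2. *)
Lemma commutator_identity i a f : test f ->
  b (fun x => shifted i a x * f x) (conj_deriv i f) =
  - (b (fun x => height x * f x) (fun x => height x * f x)) / 2.
Proof.
move=> tf; have sf := test_smooth tf.
have sh := @smooth_height R n. have ss := smooth_shifted i a.
pose F x := shifted i a x * (height x * (f x * f x)).
have tff : test (fun x => f x * f x) by exact: test_mul.
have tF : test F by apply: test_mul => //; exact: test_mul.
have := intV_D i tF.
have DF x : D i F x = height x * f x * (height x * f x) +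
   shifted i a x * (last_delta R i * height x * (f x * f x) +
     2 * height x * f x * D i f x).
  rewrite /F D_mul//; last by apply: smooth_mul => //; exact: smooth_mul.
  rewrite D_mul//; last exact: smooth_mul.
  by rewrite D_mul// D_shifted eqxx mul1r D_height; ring.
have t1 : test (fun x => shifted i a x * f x * conj_deriv i f x).
  by apply: test_mulr; [exact: test_mul|exact: test_smooth (test_conj_deriv i tf)].
have t2 : test (fun x => height x * f x * (height x * f x)).
  by apply: test_mulr; [exact: test_mul|exact: smooth_mul].
have -> : D i F = lincomb (n%:R * last_delta R i) F
   (lincomb 2 (fun x => shifted i a x * f x * conj_deriv i f x) (fun x => height x * f x * (height x * f x))).
  by apply/funext => x; rewrite DF /lincomb /F /conj_deriv /kappa; field.
rewrite intV_lc //; last exact: test_lc.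
rewrite intV_lc // => H; rewrite !wdot_test.
by move: H; move: (intV (fun _ => _)) (intV (fun _ => _)) => y z H; lra.
Qed.

(** Expanding the squares gives, besides the energy, a multiple of
    the integral of h^2 f D_N f, which integrating D_N of h^2 f^2 turns into a
    multiple of the integral of h^2 f^2.  With N = n + 1 the constant (n^2 - 5) / 4
    is N (N - 2) / 4 - 1. *)
Lemma sum_conj_deriv_identity f : test f ->
  \sum_i b (conj_deriv i f) (conj_deriv i f) =
  energy f (fun x => height x ^+ 2 * f x)
   - (n%:R ^+ 2 - 5) / 4 * b (fun x => height x * f x) (fun x => height x * f x).
Proof.
move=> tf; have sf := test_smooth tf.
have sh := @smooth_height R n.
have sh2 : smooth (fun x : 'rV[R]_N => height x ^+ 2) by exact: smooth_hpow.
have tff : test (fun x => f x * f x) by exact: test_mul.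
pose F x := height x ^+ 2 * (f x * f x).
have tF : test F by exact: test_mul.
have Dh2 j x : D j (fun x : 'rV[R]_N => height x ^+
  2) x = 2 * last_delta R j * height x ^+ 2.
  by rewrite /D partial_hpow expr1 expr2; ring.
pose X x := height x ^+ 2 * (f x * D ord_max f x).
have tX : test X.
  by apply: test_mul => //; apply: test_mul => //; exact: test_D.
have IX : 2 * intV X = (n%:R - 2) * intV F.
  have := intV_D ord_max tF.
  have -> : D ord_max F = lincomb 2 F (lincomb 2 X (lincomb (-1) F F)).
    apply/funext => x; rewrite /F D_mul//; last exact: smooth_mul.
    by rewrite D_mul// Dh2 last_delta_max /lincomb /X; ring.
  have tz : test (lincomb (-1) F F) by exact: test_lc.
  rewrite intV_lc//; last exact: test_lc.
  by rewrite !intV_lc// last_delta_max; lra.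
have FE : b (fun x => height x * f x) (fun x => height x * f x) = intV F.
  by congr (intV _); apply/funext => x; rewrite /F; ring.
rewrite FE.
have tT i : test (fun x => D i f x * D i (fun x => height x ^+ 2 * f x) x).
  by apply: test_mul; [exact: smooth_D|apply: test_D; exact: test_mul].
have SE : \sum_i b (conj_deriv i f) (conj_deriv i f) =
   intV (fun x => \sum_i (conj_deriv i f x * conj_deriv i f x)).
  rewrite intV_sum//.
  by move=> i; apply: test_mul; [exact: test_smooth (test_conj_deriv i tf)|exact: test_conj_deriv].
have EE : energy f (fun x => height x ^+ 2 * f x) =
   intV (fun x => \sum_i (D i f x * D i (fun x => height x ^+ 2 * f x) x)).
  by rewrite intV_sum.
rewrite SE EE.
have -> : (fun x => \sum_i (conj_deriv i f x * conj_deriv i f x)) =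
  lincomb (kappa ^+ 2) F (lincomb (- (2 * kappa + 2)) X
     (fun x => \sum_i (D i f x * D i (fun x => height x ^+ 2 * f x) x))).
  apply/funext => x; rewrite /lincomb.
  have -> : kappa ^+ 2 * F x = \sum_(i : 'I_N) (kappa * last_delta R i * height x * f x) ^+ 2.
    rewrite (bigD1 ord_max)//= big1 ?addr0; first by rewrite last_delta_max /F; ring.
    by move=> i ni; rewrite /last_delta (negbTE ni) mulr0 !mul0r expr0n.
  have -> : - (2 * kappa + 2) * X x =
     \sum_(i : 'I_N) (- (2 * kappa + 2) * last_delta R i * height x ^+
       2 * (f x * D i f x)).
    rewrite (bigD1 ord_max)//= big1 ?addr0; first by rewrite last_delta_max /X; ring.
    by move=> i ni; rewrite /last_delta (negbTE ni) mulr0 !mul0r.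
  rewrite -!big_split/=; apply: eq_bigr => i _.
  by rewrite D_mul// Dh2 /conj_deriv; ring.
rewrite intV_lc//; last by apply: test_lc => //; exact: test_sum.
rewrite intV_lc//; last exact: test_sum.
have -> : - (2 * kappa + 2) * intV X = - (kappa +
  1) * ((n%:R - 2) * intV F) by rewrite -IX; ring.
by rewrite /kappa; field.
Qed.

(** The product rule gives |D (g f)|^2 = <D f, D (g^2 f)> + f^2 |D g|^2
    pointwise, and |D g|^2 = h^2 for g = x_i - a. *)
Lemma localization_identity i a f : test f ->
  energy (fun x => shifted i a x * f x) (fun x => shifted i a x * f x) =
  energy f (fun x => (shifted i a x * shifted i a x) * f x) +
  b (fun x => height x * f x) (fun x => height x * f x).
Proof.
move=> tf; have sf := test_smooth tf; have ss := smooth_shifted i a.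
have t1 : test (fun x => shifted i a x * f x) by exact: test_mul.
have t2 : test (fun x => (shifted i a x * shifted i a x) * f x).
  by apply: test_mul => //; exact: smooth_mul.
have t3 : test (fun x => height x * f x * (height x * f x)).
  have sh := @smooth_height R n.
  by apply: test_mulr; [exact: test_mul|exact: smooth_mul].
have t4 j : test (fun x => D j (fun x => shifted i a x * f x) x * D j (fun x => shifted i a x * f x) x).
  by apply: test_mul; [apply: smooth_D; exact: smooth_mul|exact: test_D].
have t5 j : test (fun x => D j f x * D j (fun x => (shifted i a x * shifted i a x) * f x) x).
  by apply: test_mul; [exact: smooth_D|exact: test_D].
have -> : energy (fun x => shifted i a x * f x) (fun x => shifted i a x * f x) =
   intV (fun x => \sum_j (D j (fun x => shifted i a x * f x) x * D j (fun x => shifted i a x * f x) x)).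
  by rewrite intV_sum.
have -> : energy f (fun x => (shifted i a x * shifted i a x) * f x) =
   intV (fun x => \sum_j (D j f x * D j (fun x => (shifted i a x * shifted i a x) * f x) x)).
  by rewrite intV_sum.
rewrite addrC wdot_test -[X in X + _]mul1r -intV_lc//; last exact: test_sum.
congr (intV _); apply/funext => x; rewrite /lincomb mul1r.
have -> : height x * f x * (height x * f x) = \sum_j (j == i)%:R * (height x * f x * (height x * f x)).
  rewrite (bigD1 i)//= eqxx mul1r big1 ?addr0// => j ji.
  by rewrite (negbTE ji) mul0r.
rewrite -big_split/=; apply: eq_bigr => j _.
rewrite !D_mul//; try exact: smooth_mul.
rewrite !D_shifted; by case: (j == i); rewrite ?mul1r ?mul0r; ring.
Qed.

(** * The gap inequality *)

Lemma bounded_on_domain (p : 'rV[R]_N -> R) : continuous p ->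
  exists C, forall x, Omega x -> `|p x| <= C.
Proof.
move=> cp.
have [C [_ HC]] : bounded_set (p @` box M).
  apply: compact_bounded; apply: continuous_compact; last exact: compact_box.
  exact: continuous_subspaceT.
exists (C + 1) => x Ox; apply: HC; first by rewrite ltrDl.
by exists x => //; exact: OM.
Qed.

Lemma sq_cmul (p : 'rV[R]_N -> R) f : continuous p -> sq f -> sq (fun x => p x * f x).
Proof.
move=> cp sf; have [C pC] := bounded_on_domain cp.
apply: (sqint_mul mO mvol vol0 _ pC sf).
by apply: measurable_funTS; exact: continuous_measurable_rV.
Qed.

Lemma form_cvg_cmul (p : 'rV[R]_N -> R) phi f : continuous p -> (forall k, sq (phi k)) ->
  sq f -> form_cvg b phi f -> form_cvg b (fun k x => p x * phi k x) (fun x => p x * f x).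
Proof.
move=> cp sphi sf cf; have [C pC] := bounded_on_domain cp.
apply: (form_cvg_mul mO mvol vol0 _ pC sphi sf cf).
by apply: measurable_funTS; exact: continuous_measurable_rV.
Qed.

(** The equation of u may be tested against p phi_k, which stays bounded in
    the Sobolev norm, and phi_k converges to u in that norm. *)
Lemma weak_mul lam u G phi (p : 'rV[R]_N -> R) : H10_limit u G phi ->
  weak_eigen lam u G -> smooth p ->
  (fun k => energy (phi k) (fun x => p x * phi k x)) @ \oo -->
    lam * b u (fun x => p x * u x).
Proof.
move=> H wu sp; have [su sG tp cu cG] := H.
have cp := smooth_continuous sp.
have cDp i : continuous (D i p) by apply: smooth_continuous; exact: smooth_D.
have spk k : sq (phi k) by exact: tsq.
have sDk i k : sq (D i (phi k)) by apply: tsq; exact: test_D.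
have tpp k : test (fun x => p x * phi k x) by exact: test_mul.
(* the limit of D_i (p phi_k), by the product rule *)
pose T i x := p x * G i x + D i p x * u x.
have sT i : sq (T i).
  rewrite (_ : T i = lincomb 1 (fun x => p x * G i x) (fun x => D i p x * u x)).
    by apply: lsq; exact: sq_cmul.
  by apply/funext => x; rewrite /lincomb mul1r.
have sDp i k : sq (D i (fun x => p x * phi k x)) by apply: tsq; exact: test_D.
have cT i : form_cvg b (fun k => D i (fun x => p x * phi k x)) (T i).
  have -> : T i = lincomb 1 (fun x => p x * G i x) (fun x => D i p x * u x).
    by apply/funext => x; rewrite /lincomb mul1r.
  have -> : (fun k => D i (fun x => p x * phi k x)) =
    fun k => lincomb 1 (fun x => p x * D i (phi k) x) (fun x => D i p x * phi k x).
    apply/funext => k; apply/funext => x.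
    rewrite D_mul//; last exact: test_smooth (tp k).
    by rewrite /lincomb; ring.
  apply: (form_cvg_lc lsq fb).
  - by move=> k; exact: sq_cmul.
  - by move=> k; exact: sq_cmul.
  - exact: sq_cmul.
  - exact: sq_cmul.
  - exact: form_cvg_cmul.
  - exact: form_cvg_cmul.
have h1 : (fun k => energy (phi k) (fun x => p x * phi k x)) @ \oo -->
   \sum_i b (G i) (T i).
  by apply: cvg_sumr => i; exact: (form_cvg_form lsq fb (sDk i) (sDp i) (sG i) (sT i) (cG i) (cT i)).
have h2 : (fun k => \sum_i b (G i) (D i (fun x => p x * phi k x))) @ \oo -->
   \sum_i b (G i) (T i).
  by apply: cvg_sumr => i; exact: (form_cvg_l (cT i) (sDp i) (sT i) (sG i)).
have h3 : (fun k => lam * b u (fun x => p x * phi k x)) @ \oo -->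
  lam * b u (fun x => p x * u x).
  apply: cvgM; first exact: cvg_cst.
  apply: (form_cvg_l (form_cvg_cmul cp spk su cu)) => //.
  - by move=> k; exact: tsq.
  - exact: sq_cmul.
by rewrite -(eq_cvg_seq h2 h3 (fun k => wu _ (tpp k))).
Qed.

(** Writing B, A_i and C_i for the squared norms of h u, (x_i - a_i) u and
    of the limit of conj_deriv i phi_k, the three identities give in the limit
    (Lam - lam1) A_i <= B, B^2 / 4 <= A_i C_i and
    sum_i C_i = (lam1 - (n^2 - 5) / 4) B. *)
Lemma gap_bound lam1 Lam u G phi :
  H10_limit u G phi -> weak_eigen lam1 u G -> b u u = 1 -> lam1 <= Lam ->
  (forall f, test f -> Lam * b f f <= energy f f + (Lam - lam1) * (b u f) ^+ 2) ->
  N%:R * (Lam - lam1) <= 4 * (lam1 - (n%:R ^+ 2 - 5) / 4).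
Proof.
move=> H wu uu lL var; have [su sG tp cu cG] := H.
have ch : continuous (@height R n) by apply: smooth_continuous; exact: smooth_height.
have spk k : sq (phi k) by exact: tsq.
have sDk i k : sq (D i (phi k)) by apply: tsq; exact: test_D.
pose hu x := height x * u x; pose hphi k x := height x * phi k x.
have shu : sq hu by exact: sq_cmul.
have shphi k : sq (hphi k) by exact: sq_cmul.
have chu : form_cvg b hphi hu by exact: form_cvg_cmul.
pose B := b hu hu.
have cB : (fun k => b (hphi k) (hphi k)) @ \oo --> B.
  exact: (form_cvg_form lsq fb shphi shphi shu shu chu chu).
(* the height is at least c and u is normalized *)
have B0 : 0 < B.
  have : b (fun x => c * u x) (fun x => c * u x) <= B.
    apply: (wdot_le mO mvol vol0 _ shu); first exact: (sqint_scale mO mvol vol0).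
    move=> x Ox; rewrite /hu !normrM ler_wpM2r// !ger0_norm ?Oc// ?(ltW c0)//.
    by rewrite (le_trans (ltW c0))// Oc.
  apply: lt_le_trans; rewrite (_ : (fun x => c * u x) = lincomb (c - 1) u u).
    by rewrite (form_sq _ lsq fb)// uu !mulr1 (_ : _ + _ = c ^+ 2) ?exprn_gt0//; ring.
  by apply/funext => x; rewrite /lincomb; ring.
pose Su i x := height x * (G i x - kappa * last_delta R i * u x).
have sSu i : sq (Su i).
  apply: sq_cmul => //; rewrite (_ : (fun _ => _) = lincomb (- (kappa * last_delta R i)) u (G i)).
    exact: lsq.
  by apply/funext => x; rewrite /lincomb; ring.
have sSk i k : sq (conj_deriv i (phi k)) by apply: tsq; exact: test_conj_deriv.
have cS i : form_cvg b (fun k => conj_deriv i (phi k)) (Su i).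
  have -> : Su i = fun x => height x * lincomb (- (kappa * last_delta R i)) u (G i) x.
    by apply/funext => x; rewrite /Su /lincomb; ring.
  have -> : (fun k => conj_deriv i (phi k)) =
    fun k x => height x * lincomb (- (kappa * last_delta R i)) (phi k) (D i (phi k)) x.
    by apply/funext => k; apply/funext => x; rewrite /conj_deriv /lincomb; ring.
  apply: (form_cvg_cmul ch); last exact: (form_cvg_lc lsq fb).
  - by move=> k; exact: lsq.
  - exact: lsq.
have sumC : \sum_i b (Su i) (Su i) = (lam1 - (n%:R ^+ 2 - 5) / 4) * B.
  have h1 : (fun k => \sum_i b (conj_deriv i (phi k)) (conj_deriv i (phi k))) @ \oo -->
    \sum_i b (Su i) (Su i).
    by apply: cvg_sumr => i; exact: (form_cvg_form lsq fb (sSk i) (sSk i) (sSu i) (sSu i) (cS i) (cS i)).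
  have sh2 : smooth (fun x : 'rV[R]_N => height x ^+ 2) by exact: smooth_hpow.
  have h2 : (fun k => energy (phi k) (fun x => height x ^+ 2 * phi k x) -
      (n%:R ^+ 2 - 5) / 4 * b (hphi k) (hphi k)) @ \oo -->
      lam1 * b u (fun x => height x ^+ 2 * u x) - (n%:R ^+ 2 - 5) / 4 * B.
    apply: cvgB; first exact: (weak_mul H wu sh2).
    by apply: cvgM => //; exact: cvg_cst.
  rewrite (eq_cvg_seq h1 h2); last first.
    by move=> k; rewrite (sum_conj_deriv_identity (tp k)).
  have -> : b u (fun x => height x ^+ 2 * u x) = B.
    by apply: eq_Rintegral => x _; rewrite /hu; ring.
  by ring.
have main i : (Lam - lam1) * B <= 4 * b (Su i) (Su i).
  pose a := b u (fun x => x ord0 i * u x).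
  pose pu x := shifted i a x * u x; pose pphi k x := shifted i a x * phi k x.
  have ss := smooth_shifted i a.
  have cs : continuous (shifted i a) by exact: smooth_continuous.
  have spu : sq pu by exact: sq_cmul.
  have tpphi k : test (pphi k) by exact: test_mul.
  have sppk k : sq (pphi k) by exact: tsq.
  have cpu : form_cvg b pphi pu by exact: form_cvg_cmul.
  pose A := b pu pu.
  have cA : (fun k => b (pphi k) (pphi k)) @ \oo --> A.
    exact: (form_cvg_form lsq fb sppk sppk spu spu cpu cpu).
  have upu : b u pu = 0.
    have sxu : sq (fun x => x ord0 i * u x).
      by apply: sq_cmul => //; exact: coord_continuous.
    have -> : pu = lincomb (- a) u (fun x => x ord0 i * u x).
      by apply/funext => x; rewrite /pu /shifted /lincomb; ring.
    rewrite (formC fb)//; last exact: lsq.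
    by rewrite (formL fb)// uu mulr1 (formC fb sxu su) addNr.
  have cpu' : (fun k => b u (pphi k)) @ \oo --> 0.
    by rewrite -upu; exact: (form_cvg_l cpu sppk spu su).
  (* the choice of a makes the penalty vanish in the limit *)
  have trial : (Lam - lam1) * A <= B.
    have hl : (fun k => Lam * b (pphi k) (pphi k)) @ \oo --> Lam * A.
      by apply: cvgM => //; exact: cvg_cst.
    have hr : (fun k => energy (pphi k) (pphi k) + (Lam - lam1) * (b u (pphi k)) ^+ 2)
        @ \oo --> (lam1 * A + B) + (Lam - lam1) * (0 * 0).
      apply: cvgD; last by apply: cvgM; [exact: cvg_cst|exact: cvgM].
      have -> : (fun k => energy (pphi k) (pphi k)) =
        fun k => energy (phi k) (fun x => (shifted i a x * shifted i a x) * phi k x) +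
          b (hphi k) (hphi k).
        by apply/funext => k; rewrite -(localization_identity i a (tp k)).
      apply: cvgD => //.
      have -> : A = b u (fun x => (shifted i a x * shifted i a x) * u x).
        by apply: eq_Rintegral => x _; rewrite /pu; ring.
      by apply: (weak_mul H wu); exact: smooth_mul.
    have := ler_cvg_seq hl hr (fun k => var _ (tpphi k)).
    by rewrite mul0r mulr0 addr0; lra.
  have comm : b pu (Su i) = - B / 2.
    have h1 : (fun k => b (pphi k) (conj_deriv i (phi k))) @ \oo --> b pu (Su i).
      exact: (form_cvg_form lsq fb sppk (sSk i) spu (sSu i) cpu (cS i)).
    have h2 : (fun k => - b (hphi k) (hphi k) / 2) @ \oo --> - B / 2.
      by apply: cvgM; [exact: cvgN|exact: cvg_cst].
    apply: (eq_cvg_seq h1 h2) => k.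
    exact: (commutator_identity i a (tp k)).
  have CS := form_CS lsq fb spu (sSu i); rewrite comm in CS.
  have L0 : 0 <= Lam - lam1 by rewrite subr_ge0.
  have C0 : 0 <= b (Su i) (Su i) by exact: (form_ge0 fb).
  have h1 : (Lam - lam1) * (- B / 2) ^+ 2 <= (Lam - lam1) * (A * b (Su i) (Su i)).
    by rewrite ler_wpM2l.
  have h2 : (Lam - lam1) * A * b (Su i) (Su i) <= B * b (Su i) (Su i) by rewrite ler_wpM2r.
  rewrite -(ler_pM2r B0).
  move: h1 h2; rewrite (_ : (- B / 2) ^+ 2 = B * B / 4); last by field.
  by move: (b (Su i) (Su i)) => C; lra.
have : \sum_(i : 'I_N) (Lam - lam1) * B <= \sum_i 4 * b (Su i) (Su i).
  by apply: ler_sum => i _; exact: main.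
rewrite sumr_const card_ord -mulr_sumr sumC => h.
rewrite -(ler_pM2r B0); apply: le_trans (le_trans _ h) _; rewrite -?[leRHS]mulr_natl; lra.
Qed.

(** * Eigenfunctions of a list of eigenvalues *)

Lemma ae_zero_ip f : sq f -> {ae mu, forall x, Omega x -> f x = 0} -> b f f = 0.
Proof.
move=> sf f0; apply: (@EFin_inj R); rewrite -(wdot_integral mO)//.
rewrite (@ae_eq_integral _ _ _ mu Omega (cst 0%E) (fun x => (f x ^+ 2 * vol x)%:E))//.
- exact: integral0.
- by have [_ /measurable_int] := sf.
- by apply: filterS f0 => x fx Ox; rewrite fx// expr0n mul0r.
Qed.

Lemma wdot_zero_ae f : sq f -> b f f = 0 -> {ae mu, forall x, Omega x -> f x = 0}.
Proof.
move=> sf bf; have [_ fi] := sf.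
have : (\int[mu]_(x in Omega) `|(f x ^+ 2 * vol x)%:E| = 0)%E.
  under eq_integral => x /[!inE] Ox.
    rewrite gee0_abs ?lee_fin; last by rewrite mulr_ge0 ?sqr_ge0// ltW// vol0.
  over.
  by rewrite (wdot_integral mO)// bf.
move=> /(ae_eq_integral_abs mu mO (measurable_int _ fi)).
apply: filterS => x /= fx Ox; have := fx Ox => -[] /eqP.
by rewrite mulf_eq0 sqrf_eq0 (gt_eqF (vol0 Ox)) orbF => /eqP.
Qed.

Lemma H10_limit_scale s u G phi : H10_limit u G phi ->
  H10_limit (lincomb s u u) (fun i => lincomb s (G i) (G i)) (fun k => lincomb s (phi k) (phi k)).
Proof.
move=> [su sG tp cu cG].
have lt : lin_closed test := @test_lc R N Omega.
have sp k : sq (phi k) by exact: tsq.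
have spD i k : sq (D i (phi k)) by apply: tsq; exact: test_D.
split.
- exact: lsq.
- by move=> i; exact: lsq.
- by move=> k; exact: lt.
- exact: (form_cvg_lc lsq fb).
- move=> i; rewrite (_ : (fun k => _) = fun k => lincomb s (D i (phi k)) (D i (phi k))).
    exact: (form_cvg_lc lsq fb).
  by apply/funext => k; rewrite (D_lcE _ _ (tp k) (tp k)).
Qed.

Lemma weak_scale nu s u G phi : H10_limit u G phi -> weak_eigen nu u G ->
  weak_eigen nu (lincomb s u u) (fun i => lincomb s (G i) (G i)).
Proof.
move=> [su sG tp cu cG] wu psi tpsi.
rewrite (formL fb)//; last exact: tsq.
rewrite (eq_bigr (fun i => s * b (G i) (D i psi) + b (G i) (D i psi))); last first.
  by move=> i _; rewrite (formL fb)//; apply: tsq; exact: test_D.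
rewrite big_split/= -mulr_sumr wu//; ring.
Qed.

(** An eigenfunction of positive norm is multiplied by s + 1, written as
    lincomb s u u. *)
Lemma normalized_eigenpair nu u : dirichlet_eigenspace Omega nu u -> 0 < b u u ->
  exists v G phi, [/\ H10_limit v G phi, weak_eigen nu v G & b v v = 1].
Proof.
move=> /(eigen_H10_limit)[G [phi [H wu]]] u0.
pose s := (Num.sqrt (b u u))^-1 - 1.
exists (lincomb s u u), (fun i => lincomb s (G i) (G i)), (fun k => lincomb s (phi k) (phi k)).
split; [exact: H10_limit_scale|exact: (weak_scale _ H)|].
have su : sq u by case: H.
rewrite (form_sq _ lsq fb)//.
rewrite (_ : _ + _ = (s + 1) ^+ 2 * b u u); last by ring.
by rewrite /s subrK exprVn sqr_sqrtr ?(ltW u0)// mulVf// gt_eqF.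
Qed.

Lemma normalized_free v : sq v -> b v v = 1 -> ae_free Omega (fun _ : 'I_1 => v).
Proof.
move=> sv vv a av i; rewrite (ord1 i).
have sav : sq (fun x => a ord0 * v x) by exact: (sqint_scale mO mvol vol0).
have E : (fun x => a ord0 * v x) = lincomb (a ord0 - 1) v v.
  by apply/funext => x; rewrite /lincomb; ring.
have : b (fun x => a ord0 * v x) (fun x => a ord0 * v x) = 0.
  by apply: ae_zero_ip => //; apply: filterS av => x + Ox => /(_ Ox); rewrite big_ord1.
rewrite E (form_sq _ lsq fb)// vv.
rewrite (_ : _ + _ = a ord0 ^+ 2); last by ring.
by move/eqP; rewrite sqrf_eq0 => /eqP.
Qed.

Lemma orthonormal_free u v : sq u -> sq v -> b u u = 1 -> b v v = 1 -> b u v = 0 ->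
  ae_free Omega (fun i : 'I_2 => if i == ord0 then u else v).
Proof.
move=> su sv uu vv uv a av.
have sav : sq (fun x => a ord_max * v x) by exact: (sqint_scale mO mvol vol0).
have E : (fun x => a ord_max * v x) = lincomb (a ord_max - 1) v v.
  by apply/funext => x; rewrite /lincomb; ring.
have b1 : b u (fun x => a ord_max * v x) = 0.
  by rewrite (formC fb)// E (formL fb)// (formC fb sv su) uv; ring.
have b2 : b (fun x => a ord_max * v x) (fun x => a ord_max * v x) = a ord_max ^+ 2.
  by rewrite E (form_sq _ lsq fb)// vv; ring.
have : b (lincomb (a ord0) u (fun x => a ord_max * v x)) (lincomb (a ord0) u (fun x => a ord_max * v x)) = 0.
  apply: ae_zero_ip; first exact: lsq.
  apply: filterS av => x + Ox => /(_ Ox); rewrite big_ord_recl big_ord1 /=.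
  by rewrite (_ : lift ord0 ord0 = ord_max)//; exact: val_inj.
rewrite (form_sq _ lsq fb)// b1 b2 uu mulr0 addr0 mulr1 => H.
have := sqr_ge0 (a ord0); have := sqr_ge0 (a ord_max) => a1 a0.
have /eqP := H; rewrite paddr_eq0// !sqrf_eq0 => /andP[/eqP z0 /eqP z1] i.
case: (unliftP ord0 i) => [j ->|->//]; rewrite (ord1 j).
by rewrite (_ : lift ord0 ord0 = ord_max)//; exact: val_inj.
Qed.

(** If the variational inequality for the second eigenvalue failed, an
    eigenfunction v orthogonal to u would have an eigenvalue below lam 1; it would
    be either a second occurrence of lam 0 or another value below lam 1, and the
    list, being sorted, contains neither. *)
Lemma second_eigenvalue_bound (lam : nat -> R) : dirichlet_eigenvalues Omega lam ->
  N%:R * (lam 1%N - lam 0%N) <= 4 * (lam 0%N - (n%:R ^+ 2 - 5) / 4).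
Proof.
move=> [mono mult].
have nd j : lam 1%N <= lam j.+1.
  by elim: j => [//|j IH]; exact: le_trans IH (mono _).
have [w [ew fw]] : exists w : 'I_1 -> 'rV[R]_N -> R,
    (forall i, dirichlet_eigenspace Omega (lam 0%N) (w i)) /\ ae_free Omega w.
  apply/mult; exists (fun=> 0%N); split=> // i j _; by rewrite (ord1 i) (ord1 j).
have ew0 := ew ord0; set w0 := w ord0 in ew0.
have sw0 : sq w0.
  have [G [phi [H _]]] := eigen_H10_limit ew0.
  by case: H.
have w00 : 0 < b w0 w0.
  have := form_ge0 fb sw0; rewrite le_eqVlt => /orP[/eqP b0|//].
  have z := wdot_zero_ae sw0 (esym b0).
  have /(_ ord0)/eqP : forall i : 'I_1, (fun=> 1 : R) i = 0.
    apply: fw; apply: filterS z => x zx Ox.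
    by rewrite big_ord1 mul1r; exact: zx.
  by rewrite oner_eq0.
have [u [G [phi [H wu uu]]]] := normalized_eigenpair ew0 w00.
have su : sq u by case: H.
have [[nu [v [Gv [vk [nuL Hv wv vv uv]]]]]|] :=
    rayleigh_or_eigen H wu uu (mono 0%N); last first.
  exact: (gap_bound H wu uu (mono 0%N)).
exfalso.
have sv : sq v by case: Hv.
have ev := H10_limit_eigen Hv wv.
have eu := H10_limit_eigen H wu.
have [nE|nE] := eqVneq nu (lam 0%N).
  have [k [kinj kE]] : exists k : 'I_2 ->
    nat, injective k /\ forall i, lam (k i) = lam 0%N.
    apply/mult; exists (fun i => if i == ord0 then u else v); split.
      by move=> i; case: ifP => // _; rewrite -nE.
    exact: orthonormal_free.
  have [i ki] : exists i, k i != 0%N.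
    have [k0|k0] := eqVneq (k ord0) 0%N; last by exists ord0.
    exists ord_max; apply/eqP => k1.
    by have := kinj ord0 ord_max; rewrite k0 k1 => /(_ erefl).
  have := nd (k i).-1; rewrite prednK ?lt0n// kE -nE.
  by rewrite leNgt nuL.
have [k [_ kE]] : exists k : 'I_1 -> nat, injective k /\ forall i, lam (k i) = nu.
  apply/mult; exists (fun=> v); split => //; exact: normalized_free.
have := kE ord0; case: (k ord0) => [|j] lj; first by rewrite lj eqxx in nE.
by have := nd j; rewrite lj leNgt nuL.
Qed.

End domain.

(** * Bounded domains of the half-space *)

Section bounded_domains.
Context (R : realType) (n : nat).

(** The logarithm of c + sqrt (c^2 - 1) bounds that of c from above. *)
Lemma arcosh_le (t m : R) : 0 <= t -> arcosh (1 + t) <= m -> t <= expR m.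
Proof.
move=> t0; rewrite /arcosh.
set s := Num.sqrt _; have s0 : 0 <= s by exact: sqrtr_ge0.
have p0 : 0 < 1 + t + s by lra.
rewrite -ler_expR lnK ?posrE//; lra.
Qed.

(** The distance to a fixed point y bounds |x - y|^2 / (2 x_N y_N).  As
    (x_N - y_N)^2 <= |x - y|^2, the ratio of the heights of x and y is bounded in
    both directions, and then so is |x - y|. *)
Lemma domain_bounds (Omega : set 'rV[R]_n.+1) : bounded_domain Omega ->
  exists M c : R, [/\ 0 < M, Omega `<=` box M, 0 < c &
    forall x, Omega x -> c <= height x].
Proof.
move=> [Oh _ _ [y Oy] [m Hm]].
pose K := expR m; have K0 : 0 < K by exact: expR_gt0.
have hy : 0 < height y by exact: Oh.
(* q bounds the ratio of two heights *)
pose q := 2 * K + 2; have q0 : 0 < q by rewrite /q; lra.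
have key x : Omega x -> forall i, (x ord0 i - y ord0 i) ^+
  2 <= 2 * K * height x * height y.
  move=> Ox i; have hx : 0 < height x by exact: Oh.
  have d0 : 0 < 2 * height x * height y by rewrite !mulr_gt0.
  pose t := (\sum_i (x ord0 i - y ord0 i) ^+ 2) / (2 * height x * height y).
  have s0 : 0 <= \sum_i (x ord0 i - y ord0 i) ^+ 2 by apply: sumr_ge0 => j _;
    exact: sqr_ge0.
  have t0 : 0 <= t by rewrite divr_ge0// ltW.
  have tK : t <= K := arcosh_le t0 (Hm x y Ox Oy).
  apply: (@le_trans _ _ (\sum_i (x ord0 i - y ord0 i) ^+ 2)).
    rewrite [leRHS](bigD1 i)//= lerDl; apply: sumr_ge0 => j _; exact: sqr_ge0.
  by move: tK; rewrite /t ler_pdivrMr//; lra.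
have hx_bounds x : Omega x -> height x <= q * height y /\ height y <= q * height x.
  move=> Ox; have hx : 0 < height x by exact: Oh.
  have := key x Ox ord_max; rewrite -!/(height _) => k.
  have p : 0 <= height x * height y by apply: mulr_ge0; exact: ltW.
  split.
    by rewrite -(ler_pM2r hx) /q; nra.
  by rewrite -(ler_pM2r hy) /q; nra.
exists (\sum_j `|y ord0 j| + q * height y + 1), (height y / q); split.
- by rewrite ltr_wpDl// addr_ge0 ?sumr_ge0// mulr_ge0// ltW.
- move=> x Ox i; have hx : 0 < height x by exact: Oh.
  have [h1 h2] := hx_bounds x Ox.
  have xy : `|x ord0 i - y ord0 i| <= q * height y.
    rewrite -(@ler_pXn2r _ 2) ?nnegrE ?mulr_ge0 ?(ltW q0) ?(ltW hy)//.
    rewrite real_normK ?num_real//; apply: (le_trans (key x Ox i)).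
    have : 2 * K * height y * height x <= 2 * K * height y * (q * height y).
      by rewrite ler_wpM2l// !mulr_ge0 ?(ltW K0) ?(ltW hy).
    have : 0 <= height y ^+ 2 by exact: sqr_ge0.
    have : 0 <= height y * height y * q by rewrite !mulr_ge0 ?(ltW q0) ?(ltW hy).
    rewrite !expr2 /q; nra.
  have yi : `|y ord0 i| <= \sum_j `|y ord0 j|.
    by rewrite (bigD1 i)//= lerDl sumr_ge0.
  have := ler_normD (x ord0 i - y ord0 i) (y ord0 i); rewrite subrK => xi.
  by apply: (le_trans xi); lra.
- exact: divr_gt0.
- move=> x Ox; have [_ h2] := hx_bounds x Ox.
  by rewrite ler_pdivrMr// mulrC.
Qed.

End bounded_domains.

Theorem theorem1p3 (R : realType) (n : nat) (Omega : set 'rV[R]_n.+1)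
    (hOmega : bounded_domain Omega)
    (lam : nat -> R) (hlam : dirichlet_eigenvalues Omega lam) :
  let N : R := n.+1%:R in
  lam 1%N - lam 0%N <= 4 / N * (lam 0%N - (N ^+ 2 - 2 * N - 4) / 4).
Proof.
cbv zeta; set N : R := n.+1%:R.
have [M [c [M0 OM c0 Oc]]] := domain_bounds hOmega.
have [Oh oO _ _ _] := hOmega.
have := second_eigenvalue_bound Oh oO M0 OM c0 Oc hlam.
have N0 : 0 < N by rewrite ltr0n.
have nN : n%:R = N - 1 :> R by rewrite /N -natr1 addrK.
rewrite -/N nN => H.
rewrite -(ler_pM2l N0); apply: (le_trans H).
rewrite le_eqVlt; apply/orP; left; apply/eqP; field.
by rewrite gt_eqF.
Qed.
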